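(* Let $d\ge 1$ and $0<T<\infty$. Let $(\rho,u,\theta)$ be a smooth solution on $[0,T)\times\mathbb R^d$ of the compressible Euler system $$\partial_t\rho+\nabla_x\cdot(\rho u)=0,\qquad \partial_t(\rho u)+\nabla_x\cdot(\rho u\otimes u)+\nabla_x(\rho\theta)=0,$$ $$\partial_tE+\nabla_x\cdot\bigl(u(E+\rho\theta)\bigr)=0,\qquad E=\tfrac12\rho|u|^2+\tfrac d2\rho\theta,$$ satisfying: (B) $\int_{\mathbb R^d}\rho(t,x)\,\mathrm dx=1$ for all $t\in[0,T)$; $\rho(t,x)>0$ and $0<\underline\theta\le\theta(t,x)\le\overline\theta$ for all $(t,x)\in[0,T)\times\mathbb R^d$, for constants $\underline\theta,\overline\theta$; and $u,\nabla_xu,\nabla_x\log\theta\in L^\infty((0,T)\times\mathbb R^d)$. Let $M$ be the associated Maxwellian $$M(t,x,v)=\frac{\rho(t,x)}{(2\pi\theta(t,x))^{d/2}}\exp\!\left(-\frac{|v-u(t,x)|^2}{2\theta(t,x)}\right),$$ and let $M_0:=M(0,\cdot,\cdot)$. For each $0<\varepsilon\le1$ let $f_0^\varepsilon\ge0$ have unit mass on $\mathbb R^{2d}$ and let $f^\varepsilon$ be a smooth nonnegative solution on $[0,T)\times\mathbb R^d_x\times\mathbb R^d_v$ of the BGK equation $$\partial_tf^\varepsilon+v\cdot\nabla_xf^\varepsilon=-\frac1\varepsilon\bigl(f^\varepsilon-\mathcal M(f^\varepsilon)\bigr),\qquad f^\varepsilon(0,x,v)=f_0^\varepsilon(x,v),$$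 with local Maxwellian $\mathcal M(f^\varepsilon)$ and macroscopic fields $\rho^\varepsilon,u^\varepsilon,\theta^\varepsilon$ (defined in the context). Assume: (A) $\iint_{\mathbb R^{2d}}f^\varepsilon(t,x,v)\,\mathrm dv\,\mathrm dx=1$ for all $t\in[0,T)$ and all $\varepsilon\in(0,1]$, and there exist constants $U>0$, $0<\underline\Theta\le\overline\Theta<\infty$, $A>0$ such that $$\sup_{0<\varepsilon\le1}\|u^\varepsilon\|_\infty\le U,\qquad \underline\Theta\le\theta^\varepsilon(t,x)\le\overline\Theta\ \text{ for all }(t,x)\in[0,T)\times\mathbb R^d,\ 0<\varepsilon\le1,$$ $$\sup_{0<\varepsilon\le1}\ \sup_{t\in[0,T)}\iint_{\mathbb R^{2d}}|v|^6f^\varepsilon(t,x,v)\,\mathrm dv\,\mathrm dx\le A.$$ Assume also the regularity, decay and finite-entropy assumptions (R) stated in the context. Then there exists a positive constant $$C=C\bigl(d,\underline\theta,\overline\theta,U,\underline\Theta,\overline\Theta,A,\|u\|_\infty,\|\nabla_xu\|_\infty,\|\nabla_x\log\theta\|_\infty\bigr),$$ independent of $\varepsilon$, such that for every $0<\varepsilon\le1$ $$\frac{\mathrm d}{\mathrm dt}H(f^\varepsilon\mid M)\le C\bigl(H(f^\varepsilon\mid M)+\varepsilon\bigr)\qquad\text{for all }t\in[0,T).$$ Consequently, if $H(f_0^\varepsilon\mid M_0)\to0$ as $\varepsilon\to0$, then $$\sup_{t\in[0,T)}H\bigl(f^\varepsilon(t)\mid M(t)\bigr)\to0\qquad\text{as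 }\varepsilon\to0.$$
   Context: Notation: $\|\cdot\|_\infty:=\|\cdot\|_{L^\infty((0,T)\times\mathbb R^d)}$. Macroscopic fields of $f^\varepsilon$: $\rho^\varepsilon(t,x)=\int_{\mathbb R^d}f^\varepsilon(t,x,v)\,\mathrm dv$; where $\rho^\varepsilon(t,x)>0$, $$u^\varepsilon=\frac1{\rho^\varepsilon}\int_{\mathbb R^d}vf^\varepsilon\,\mathrm dv,\qquad \theta^\varepsilon=\frac1{d\rho^\varepsilon}\int_{\mathbb R^d}|v-u^\varepsilon|^2f^\varepsilon\,\mathrm dv,$$ and $u^\varepsilon=0$, $\theta^\varepsilon=1$ where $\rho^\varepsilon(t,x)=0$. Local Maxwellian: $$\mathcal M(f^\varepsilon)(t,x,v)=\frac{\rho^\varepsilon(t,x)}{(2\pi\theta^\varepsilon(t,x))^{d/2}}\exp\!\left(-\frac{|v-u^\varepsilon(t,x)|^2}{2\theta^\varepsilon(t,x)}\right).$$ Relative entropy: for nonnegative unit-mass densities $f,g$ on $\mathbb R^{2d}$, $H(f\mid g):=\iint_{\mathbb R^{2d}}f\log\frac fg\,\mathrm dv\,\mathrm dx$, the integrand being $0$ where $f=0$ (and $+\infty$ where $f>0=g$). For time-dependent densities, $H(f^\varepsilon\mid M)$ denotes the function $t\mapsto H(f^\varepsilon(t)\mid M(t))$. Assumption (R): the functions $f^\varepsilon$ and $(\rho,u,\theta)$ have sufficient regularity, decay and integrability so that all relative entropies and entropy productions involved are finite, and all integrations by parts and differentiations under the integral sign are justified. Concretely, for each $\varepsilon$ and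 each $t\in[0,T)$: $H(f^\varepsilon\mid M)$, $H(f^\varepsilon\mid\mathcal M(f^\varepsilon))$, $H(\mathcal M(f^\varepsilon)\mid M)$ and $\iint(f^\varepsilon-\mathcal M(f^\varepsilon))\log\frac{f^\varepsilon}{\mathcal M(f^\varepsilon)}\,\mathrm dv\,\mathrm dx$ are finite; $t\mapsto H(f^\varepsilon\mid M)$ is differentiable on $[0,T)$ (one-sided at $t=0$) with $$\frac{\mathrm d}{\mathrm dt}H(f^\varepsilon\mid M)=\iint\partial_tf^\varepsilon\log\frac{f^\varepsilon}{M}\,\mathrm dv\,\mathrm dx+\iint f^\varepsilon\,\partial_t\log\frac{f^\varepsilon}{M}\,\mathrm dv\,\mathrm dx;$$ $\iint f^\varepsilon\partial_t\log f^\varepsilon\,\mathrm dv\,\mathrm dx=\frac{\mathrm d}{\mathrm dt}\iint f^\varepsilon\,\mathrm dv\,\mathrm dx$; $\iint(v\cdot\nabla_xf^\varepsilon)\log\frac{f^\varepsilon}{M}\,\mathrm dv\,\mathrm dx=\iint f^\varepsilon\,v\cdot\nabla_x\log M\,\mathrm dv\,\mathrm dx$ (integration by parts in $x$); and these integrals, as well as $\iint(f^\varepsilon-\mathcal M(f^\varepsilon))\log\frac{\mathcal M(f^\varepsilon)}{M}\,\mathrm dv\,\mathrm dx$, $\iint f^\varepsilon\partial_t\log M\,\mathrm dv\,\mathrm dx$ and $\iint f^\varepsilon(\partial_t+v\cdot\nabla_x)\log M\,\mathrm dv\,\mathrm dx$, converge absolutely. *)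

(* Defs.v *)
From HB Require Import structures.
From mathcomp Require Import all_boot all_order all_algebra.
From mathcomp Require Import all_classical all_reals all_analysis.
Import numFieldNormedType.Exports.
Import Order.TTheory GRing.Theory Num.Theory.
Set Implicit Arguments.
Unset Strict Implicit.
Unset Printing Implicit Defensive.
Local Open Scope classical_set_scope.
Local Open Scope ring_scope.

(* 'rV[R]_n with the sigma-algebra generated by the coordinates, i.e. the Borel
   sigma-algebra of R^n. *)
Section measurable_rV.
Context {R : realType} (n : nat).

Definition rV_coord (i : 'I_n) (x : 'rV[R]_n) : measurableTypeR R := x 0 i.

Let rV_set0 : g_sigma_preimage rV_coord set0.
Proof. exact: sigma_algebra0. Qed.

Let rV_setC A : g_sigma_preimage rV_coord A -> g_sigma_preimage rV_coord (~` A).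
Proof. exact: sigma_algebraC. Qed.

Let rV_bigcup (F : (set 'rV[R]_n)^nat) :
  (forall i, g_sigma_preimage rV_coord (F i)) ->
  g_sigma_preimage rV_coord (\bigcup_i (F i)).
Proof. exact: sigma_algebra_bigcup. Qed.

HB.instance Definition _ := @isMeasurable.Build default_measure_display
  'rV[R]_n (g_sigma_preimage rV_coord) rV_set0 rV_setC rV_bigcup.

Lemma measurable_rV_coord (i : 'I_n) : measurable_fun setT (rV_coord i).
Proof.
move=> _ Y mY; rewrite setTI; apply: sub_sigma_algebra => /=.
rewrite -bigcup_seq/=; exists i => /=; first by rewrite mem_index_enum.
by exists Y => //; rewrite setTI.
Qed.

Lemma measurable_fun_rVP d (T : measurableType d) (f : T -> 'rV[R]_n) :
  (forall i, measurable_fun setT (rV_coord i \o f)) -> measurable_fun setT f.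
Proof.
move=> mf _ Y mY; rewrite setTI.
have : g_sigma_preimage (fun i => rV_coord i \o f) (f @^-1` Y).
  by rewrite g_sigma_preimage_comp; exists Y => //; rewrite setTI.
apply: smallest_sub; first exact: sigma_algebra_measurable.
rewrite -bigcup_seq; apply: bigcup_sub => i _ A [B mB <-].
exact: mf.
Qed.

End measurable_rV.

(* The canonical sigma-finite structure inferred on m1 \x m2 is the one for
   (sub)probabilities, hence this direct proof. *)
Lemma sigma_finite_product d1 d2 (T1 : measurableType d1)
    (T2 : measurableType d2) (R : realType)
    (m1 : {sigma_finite_measure set T1 -> \bar R})
    (m2 : {sigma_finite_measure set T2 -> \bar R}) :
  sigma_finite setT (m1 \x m2)%E.
Proof.
have /sigma_finiteP[F [TF ndF Foo]] := sigma_finiteT m1.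
have /sigma_finiteP[G [TG ndG Goo]] := sigma_finiteT m2.
exists (fun n => F n `*` G n).
  rewrite -setXTT TF TG predeqE => -[x y]; split.
    move=> [/= [n _ Fnx] [k _ Gky]]; exists (maxn n k) => //; split.
    - by move: x Fnx; exact/subsetPset/ndF/leq_maxl.
    - by move: y Gky; exact/subsetPset/ndG/leq_maxr.
  by move=> [n _ []/= ? ?]; split; exists n.
move=> k; have [? ?] := Foo k; have [? ?] := Goo k.
split; first exact: measurableX.
by rewrite product_measure1E// lte_mul_pinfty// ge0_fin_numE.
Qed.

Section rV_lebesgue_step.
Context {R : realType} (n : nat).

Definition rV_cons (p : measurableTypeR R * 'rV[R]_n) : 'rV[R]_n.+1 :=
  \row_(i < n.+1) oapp (p.2 0) p.1 (unlift ord0 i).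

Lemma measurable_rV_cons : measurable_fun setT rV_cons.
Proof.
apply: measurable_fun_rVP => i; have [j|] := unliftP ord0 i => ->.
  rewrite (_ : _ \o _ = rV_coord j \o snd).
    by apply: measurableT_comp; [exact: measurable_rV_coord|].
  by apply/funext => p /=; rewrite /rV_coord mxE liftK.
rewrite (_ : _ \o _ = fst); first exact: measurable_fst.
by apply/funext => p /=; rewrite /rV_coord mxE unlift_none.
Qed.

Variable mu : {sigma_finite_measure set 'rV[R]_n -> \bar R}.

Definition rV_lebesgue_step : set 'rV[R]_n.+1 -> \bar R :=
  pushforward (@lebesgue_measure R \x mu)%E rV_cons.

Let step0 : rV_lebesgue_step set0 = 0%E.
Proof. by rewrite /rV_lebesgue_step /pushforward preimage_set0 measure0. Qed.

Let measurable_cons_preimage A : measurable A -> measurable (rV_cons @^-1` A).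
Proof.
by move=> mA; rewrite -[X in measurable X]setTI; exact: measurable_rV_cons.
Qed.

Let step_ge0 A : (0 <= rV_lebesgue_step A)%E.
Proof. by rewrite /rV_lebesgue_step /pushforward; exact: measure_ge0. Qed.

Let step_sigma_additive : semi_sigma_additive rV_lebesgue_step.
Proof.
move=> F mF tF mUF; rewrite /rV_lebesgue_step /pushforward preimage_bigcup.
apply: measure_semi_sigma_additive.
- by move=> k; exact: measurable_cons_preimage.
- apply/trivIsetP => /= i j _ _ ij; rewrite -preimage_setI.
  by move/trivIsetP : tF => /(_ _ _ _ _ ij) ->//; rewrite preimage_set0.
- by rewrite -preimage_bigcup; exact: measurable_cons_preimage.
Qed.

HB.instance Definition _ := isMeasure.Build _ _ _ rV_lebesgue_step
  step0 step_ge0 step_sigma_additive.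

Let rV_uncons (x : 'rV[R]_n.+1) : measurableTypeR R * 'rV[R]_n :=
  (x 0 ord0, \row_j x 0 (lift ord0 j)).

Let rV_consK : cancel rV_cons rV_uncons.
Proof.
case=> a y; rewrite /rV_uncons /rV_cons mxE unlift_none; congr pair.
by apply/rowP => j; rewrite !mxE liftK.
Qed.

Let rV_unconsK : cancel rV_uncons rV_cons.
Proof.
move=> x; apply/rowP => i; rewrite mxE.
by have [j ->|->] := unliftP ord0 i; rewrite ?liftK ?unlift_none//= mxE.
Qed.

Let measurable_rV_uncons : measurable_fun setT rV_uncons.
Proof.
apply/measurable_fun_pairP; split; first exact: measurable_rV_coord.
apply: measurable_fun_rVP => i.
rewrite (_ : _ \o _ = rV_coord (lift ord0 i)); first exact: measurable_rV_coord.
by apply/funext => x /=; rewrite /rV_coord mxE.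
Qed.

Let step_sigma_finite : sigma_finite setT rV_lebesgue_step.
Proof.
have [F TF Foo] := sigma_finite_product (@lebesgue_measure R) mu.
exists (fun k => rV_uncons @^-1` (F k)); first by rewrite -preimage_bigcup -TF.
move=> k; have [mF Fk] := Foo k; split.
  by rewrite -[X in measurable X]setTI; exact: measurable_rV_uncons.
rewrite /rV_lebesgue_step /pushforward -comp_preimage.
by rewrite (_ : _ \o _ = id)//; apply/funext => p /=; rewrite rV_consK.
Qed.

HB.instance Definition _ := Measure_isSigmaFinite.Build _ _ _ rV_lebesgue_step
  step_sigma_finite.

End rV_lebesgue_step.

(* Lebesgue measure on R^n, as an iterated product; its value on boxes is
   rV_lebesgue_box. *)
Fixpoint rV_lebesgue {R : realType} (n : nat) :
    {sigma_finite_measure set 'rV[R]_n -> \bar R} :=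
  match n with
  | 0 => [the {sigma_finite_measure set 'rV[R]_0 -> \bar R} of
           dirac (0 : 'rV[R]_0)]
  | k.+1 => [the {sigma_finite_measure set 'rV[R]_k.+1 -> \bar R} of
              rV_lebesgue_step (rV_lebesgue k)]
  end.

Lemma measurable_rV_box {R : realType} (n : nat)
    (A : 'I_n -> set (measurableTypeR R)) : (forall i, measurable (A i)) ->
  measurable [set x : 'rV[R]_n | forall i, A i (x 0 i)].
Proof.
move=> mA; rewrite (_ : [set x | _] =
    \bigcap_(i in [set: 'I_n]) (rV_coord i @^-1` A i)).
  apply: fin_bigcap_measurable => // i _.
  by rewrite -[X in measurable X]setTI; exact: measurable_rV_coord.
by apply/seteqP; split => [y Ay i _|y Ay i]; [exact: Ay|exact: (Ay i)].
Qed.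

Lemma rV_lebesgue_box {R : realType} (n : nat)
    (A : 'I_n -> set (measurableTypeR R)) : (forall i, measurable (A i)) ->
  rV_lebesgue n [set x | forall i, A i (x 0 i)] =
  (\prod_(i < n) lebesgue_measure (A i))%E.
Proof.
elim: n A => [|n ih] A mA.
  by rewrite big_ord0 /= diracE mem_set//=; case.
rewrite big_ord_recl /= /rV_lebesgue_step /pushforward.
rewrite (_ : _ @^-1` _ =
    A ord0 `*` [set y : 'rV[R]_n | forall i, A (lift ord0 i) (y 0 i)]).
  rewrite [LHS]product_measure1E//; last first.
    exact: (@measurable_rV_box R n (fun i => A (lift ord0 i))).
  by congr (_ * _)%E; exact: (ih (fun i => A (lift ord0 i))).
apply/seteqP; split => [[a y] /= Aay|[a y] /= [Aa Ay] i].
  split => /=; first by have := Aay ord0; rewrite mxE unlift_none.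
  by move=> i; have := Aay (lift ord0 i); rewrite mxE liftK.
by have [j ->|->] := unliftP ord0 i; rewrite mxE ?liftK ?unlift_none.
Qed.

Section calculus.
Context {R : realType}.

(* Derivative at t of a function of time relative to [0, T[: two-sided for
   0 < t, one-sided at t = 0; values of g outside [0, T[ are irrelevant. *)
Definition time_quotient (T : R) (g : R -> R) (t : R) :=
  (g s - g t) / (s - t) @[s --> within `[0, T[%classic t^'].

Definition is_dt (T : R) (g : R -> R) (t l : R) := time_quotient T g t --> l.

Definition dt (T : R) (g : R -> R) (t : R) : R := lim (time_quotient T g t).

(* C^n and C^oo regularity on [0, T[ * V (up to t = 0) for V a
   finite-dimensional normed space: all iterated partial derivatives exist and
   are jointly continuous. *)
Fixpoint Cn (T : R) (V : normedModType R) (n : nat) (F : R -> V -> R) : Prop :=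
  {within [set p : R * V | 0 <= p.1 < T], continuous (fun p => F p.1 p.2)} /\
  match n with
  | 0 => True
  | m.+1 =>
      [/\ forall t x, 0 <= t < T -> cvg (time_quotient T (F ^~ x) t),
          Cn T m (fun t x => dt T (F ^~ x) t) &
          forall v : V,
            (forall t x, 0 <= t < T -> derivable (F t) x v) /\
            Cn T m (fun t x => 'D_v (F t) x)]
  end.

Definition smooth (T : R) (V : normedModType R) (F : R -> V -> R) :=
  forall n, Cn T n F.

(* The canonical norm of 'M[R]_(m, n) is the sup norm; this is the Euclidean
   (Frobenius) one. *)
Definition enorm m n (A : 'M[R]_(m, n)) : R :=
  Num.sqrt (\sum_i \sum_j A i j ^+ 2).

Context {d : nat}.
Implicit Types (v w x : 'rV[R]_d).

Definition dotp v w : R := \sum_i v 0 i * w 0 i.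

Definition grad (g : 'rV[R]_d -> R) x : 'rV[R]_d :=
  \row_i 'D_(delta_mx 0 i) g x.

Definition gradv (w : 'rV[R]_d -> 'rV[R]_d) x : 'M[R]_d :=
  \matrix_(i, j) 'D_(delta_mx 0 i) (fun y => w y 0 j) x.

Definition divg (w : 'rV[R]_d -> 'rV[R]_d) x : R :=
  \sum_i 'D_(delta_mx 0 i) (fun y => w y 0 i) x.

(* L^oo(]0, T[ * R^d) norm (an essential supremum): F is extended by 0 outside
   ]0, T[. *)
Definition Linfty (T : R) m n (F : R -> 'rV[R]_d -> 'M[R]_(m, n)) : \bar R :=
  ('N[(@lebesgue_measure R \x rV_lebesgue d)%E]_+oo
    [(fun p => (enorm (F p.1 p.2))%:E) \_ (`]0%R, T[ `*` setT)])%E.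

End calculus.

Section kinetic.
Context {R : realType} {d : nat}.
Local Notation Rd := 'rV[R]_d.

(* Lebesgue measure on the pairs z = (x, v) *)
Definition phase_measure : {measure set (Rd * Rd)%type -> \bar R} :=
  (rV_lebesgue d \x rV_lebesgue d)%E.

Definition maxwellian (r : R) (w : Rd) (th : R) (v : Rd) : R :=
  r / (2 * pi * th) `^ (d%:R / 2) * expR (- (enorm (v - w) ^+ 2 / (2 * th))).

Definition maxwellian_field (rho : R -> Rd -> R) (u : R -> Rd -> Rd)
    (theta : R -> Rd -> R) (t : R) (x v : Rd) : R :=
  maxwellian (rho t x) (u t x) (theta t x) v.

(* The fields of f at (t, x) are those of g = f t x. Divergent integrals have
   value 0 by the convention of Rintegral. *)
Definition density (g : Rd -> R) : R := \int[rV_lebesgue d]_v g v.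

Definition velocity (g : Rd -> R) : Rd :=
  if 0 < density g then
    (density g)^-1 *: \row_i \int[rV_lebesgue d]_v (v 0 i * g v)
  else 0.

Definition temperature (g : Rd -> R) : R :=
  if 0 < density g then
    (d%:R * density g)^-1 *
      \int[rV_lebesgue d]_v (enorm (v - velocity g) ^+ 2 * g v)
  else 1.

Definition local_maxwellian (g : Rd -> R) : Rd -> R :=
  maxwellian (density g) (velocity g) (temperature g).

(* log (a / b) for a, b >= 0, with log (0 / b) = -oo and log (a / 0) = +oo for
   a, b > 0; the value at a = b = 0 only occurs multiplied by 0, and
   0 * (-oo) = 0 in \bar R. *)
Definition elog_ratio (a b : R) : \bar R := lne (a%:E / b%:E)%E.

Lemma elog_ratio0l (b : R) : 0 < b -> elog_ratio 0 b = -oo%E.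
Proof. by move=> b0; rewrite /elog_ratio le0_lneNy// mul0e. Qed.

Lemma elog_ratio0r (a : R) : 0 < a -> elog_ratio a 0 = +oo%E.
Proof. by move=> a0; rewrite /elog_ratio inve0 gt0_muley ?lte_fin. Qed.

Lemma elog_ratioE (a b : R) : 0 < a -> 0 < b ->
  elog_ratio a b = (ln (a / b))%:E.
Proof.
move=> a0 b0.
by rewrite /elog_ratio inver gt_eqF// -EFinM lne_EFin// divr_gt0.
Qed.

Definition rel_entropy (g h : Rd -> Rd -> R) : \bar R :=
  (\int[phase_measure]_z
     ((g z.1 z.2)%:E * elog_ratio (g z.1 z.2) (h z.1 z.2)))%E.

Definition euler_system (T : R) (rho : R -> Rd -> R) (u : R -> Rd -> Rd)
    (theta : R -> Rd -> R) : Prop :=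
  let E t x := 2^-1 * rho t x * enorm (u t x) ^+ 2
               + d%:R / 2 * rho t x * theta t x in
  forall t x, 0 <= t < T ->
  [/\ dt T (rho ^~ x) t + divg (fun y => rho t y *: u t y) x = 0,
      forall j,
        dt T (fun s => rho s x * u s x 0 j) t
        + divg (fun y => (rho t y * u t y 0 j) *: u t y) x
        + grad (fun y => rho t y * theta t y) x 0 j = 0 &
      dt T (E ^~ x) t
      + divg (fun y => (E t y + rho t y * theta t y) *: u t y) x = 0].

Definition bgk_equation (T eps : R) (f : R -> Rd -> Rd -> R) : Prop :=
  forall t x v, 0 <= t < T ->
    dt T (fun s => f s x v) t + dotp v (grad (fun y => f t y v) x)
    = - (eps^-1 * (f t x v - local_maxwellian (f t x) v)).

Section regularity.
Variables (T : R) (f M : R -> Rd -> Rd -> R) (t : R).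
Implicit Type z : Rd * Rd.

Local Notation Mf := (fun x => local_maxwellian (f t x)).
Local Notation f_ z := (f t z.1 z.2).
Local Notation M_ z := (M t z.1 z.2).
Local Notation Mf_ z := (local_maxwellian (f t z.1) z.2).
Local Notation dt_logM z := (dt T (fun s => ln (M s z.1 z.2)) t).
Local Notation v_grad_logM z :=
  (dotp z.2 (grad (fun y => ln (M t y z.2)) z.1)).

Definition dtf_log_fM z : \bar R :=
  ((dt T (fun s => f s z.1 z.2) t)%:E * elog_ratio (f_ z) (M_ z))%E.

Definition f_dt_log_fM z : \bar R :=
  (f_ z * dt T (fun s => ln (f s z.1 z.2 / M s z.1 z.2)) t)%:E.

Definition f_dt_logf z : \bar R :=
  (f_ z * dt T (fun s => ln (f s z.1 z.2)) t)%:E.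

Definition v_gradf_log_fM z : \bar R :=
  ((dotp z.2 (grad (fun y => f t y z.2) z.1))%:E * elog_ratio (f_ z) (M_ z))%E.

Definition f_v_grad_logM z : \bar R := (f_ z * v_grad_logM z)%:E.

Definition f_dt_logM z : \bar R := (f_ z * dt_logM z)%:E.

Definition f_transport_logM z : \bar R :=
  (f_ z * (dt_logM z + v_grad_logM z))%:E.

Definition fMf_log_fMf z : \bar R :=
  ((f_ z - Mf_ z)%:E * elog_ratio (f_ z) (Mf_ z))%E.

Definition fMf_log_MfM z : \bar R :=
  ((f_ z - Mf_ z)%:E * elog_ratio (Mf_ z) (M_ z))%E.

Record regular_at : Prop := RegularAt {
  rel_entropy_fM : rel_entropy (f t) (M t) \is a fin_num ;
  rel_entropy_fMf : rel_entropy (f t) Mf \is a fin_num ;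
  rel_entropy_MfM : rel_entropy Mf (M t) \is a fin_num ;
  entropy_production : (\int[phase_measure]_z fMf_log_fMf z)%E \is a fin_num ;
  integrable_dtf_log_fM : phase_measure.-integrable setT dtf_log_fM ;
  integrable_f_dt_log_fM : phase_measure.-integrable setT f_dt_log_fM ;
  integrable_f_dt_logf : phase_measure.-integrable setT f_dt_logf ;
  integrable_v_gradf_log_fM : phase_measure.-integrable setT v_gradf_log_fM ;
  integrable_f_v_grad_logM : phase_measure.-integrable setT f_v_grad_logM ;
  integrable_fMf_log_MfM : phase_measure.-integrable setT fMf_log_MfM ;
  integrable_f_dt_logM : phase_measure.-integrable setT f_dt_logM ;
  integrable_f_transport_logM :
    phase_measure.-integrable setT f_transport_logM ;
  dt_rel_entropy : is_dt T (fun s => fine (rel_entropy (f s) (M s))) t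
    (fine (\int[phase_measure]_z dtf_log_fM z)%E
     + fine (\int[phase_measure]_z f_dt_log_fM z)%E) ;
  dt_mass : fine (\int[phase_measure]_z f_dt_logf z)%E =
    dt T (fun s => fine (\int[phase_measure]_z (f s z.1 z.2)%:E)%E) t ;
  integration_by_parts_x : (\int[phase_measure]_z v_gradf_log_fM z =
    \int[phase_measure]_z f_v_grad_logM z)%E }.

End regularity.

End kinetic.

(* Main.v *)
Require Import Defs.
From HB Require Import structures.
From mathcomp Require Import all_boot all_order all_algebra.
From mathcomp Require Import all_classical all_reals all_analysis.
From mathcomp Require Import measurable_realfun ess_sup_inf ring lra.
Import numFieldNormedType.Exports.
Import Order.TTheory GRing.Theory Num.Theory.
Set Implicit Arguments.
Unset Strict Implicit.
Unset Printing Implicit Defensive.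
Local Open Scope classical_set_scope.
Local Open Scope ring_scope.

(* Along an Euler flow, (d_t + v . grad_x) log M is an explicit polynomial Q of
   degree three in v, so that
     d/dt H(f | M) = - \int f Q - eps^-1 \int (f - M(f)) log (f / M).
   For a fixed x, f and M(f) have the same mass, momentum and energy and
   log (M(f) / M) is quadratic in v, so M may be replaced by M(f) in the last
   integral, and (a - b) log (a / b) >= (a - b)^2 / (a + b).  Split
   f Q = M(f) Q + (f - M(f)) Q.  By Young's inequality the dissipation absorbs
   the second part up to eps \int (f + M(f)) Q^2, a sixth moment.  The Gaussian
   average of Q over M(f) vanishes to second order at (u_eps, theta_eps) =
   (u, theta), so it is controlled by the relative entropy of M(f) with respect
   to M, since the velocities and temperatures are bounded.  Integrating in x
   and applying Gronwall's lemma concludes.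
   The L^oo bounds, which hold at almost every time, are transferred to every
   time by continuity for the Euler fields, and by Fatou's lemma for u_eps. *)

(** Three obstacles shape the proof. (1) Gaussian moments. The average of [Q] needs the moments of
    orders one to three exactly. They are read off from generating functions: completing the square
    gives the mean of [exp (h e.(v - w))] in closed form, and comparing it with polynomial bounds of
    exp as h tends to 0 yields one inequality per moment, used for e and -e or summed over
    coordinates. The sixth moment only needs a bound, obtained by doubling the temperature. (2) The
    velocity of f. It is a quotient of integrals in v, and smoothness of f gives no domination in v,
    so continuity in time at fixed x is not at hand. The bound is therefore rewritten as the
    inequalities [\int_B rho (U +- u_i) >= 0] for all measurable B, linear in f, which do pass to
    the limit in time. (3) Zeros of f. There the logarithm is -oo. Where the density is positive,
    M(f) is positive, and the absolute convergence in (R) together with the BGK equation forces f >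
    0 almost everywhere; where the density is 0, the slice contributes nothing to the entropy or to
    its dissipation. *)

Lemma cvg_near {T U : Type} {F : set_system T} {FF : Filter F} (f g : T -> U)
    (G : set_system U) :
  f @ F `=>` G -> (\forall s \near F, f s = g s) -> g @ F `=>` G.
Proof.
move=> fG fg; apply: cvg_trans fG; apply: near_eq_cvg.
by apply: filterS fg => s.
Qed.

(** * Difference quotients along a filter and their calculus *)

Section slope.
Context {R : realType} (F : set_system R) {FF : ProperFilter F} (a : R).
Hypothesis Fa : F --> a^'.
Implicit Types (g h : R -> R) (l : R).

(** The filter is arbitrary so that one set of rules serves both the time derivative, one-sided at
    0, and the directional derivatives in space, which are slopes at 0 along a line. *)
Definition has_slope g l := (g s - g a) / (s - a) @[s --> F] --> l.

Lemma slope_near_neq : \forall s \near F, s != a.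
Proof. exact: (Fa (nbhs_dnbhs_neq a)). Qed.

Lemma slope_cvg_id : s @[s --> F] --> a.
Proof. exact: (cvg_trans Fa (@nbhs_dnbhs _ a)). Qed.

Lemma slope_cont g l : has_slope g l -> g s @[s --> F] --> g a.
Proof.
move=> gl; have s0 : s - a @[s --> F] --> (0 : R).
  by rewrite -(subrr a); apply: cvgB; [exact: slope_cvg_id|exact: cvg_cst].
pose proof (cvgD (cvgM gl s0) (cvg_cst (g a))) as c0; move: c0.
rewrite mulr0 add0r => glc; apply: (cvg_near glc).
near=> s; rewrite !fctE /= mulfVK ?subrK// subr_eq0.
by near: s; exact: slope_near_neq.
Unshelve. all: by end_near. Qed.

Lemma has_slope_near g h l : (\forall s \near F, g s = h s) -> g a = h a ->
  has_slope g l -> has_slope h l.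
Proof.
move=> gh gha; rewrite /has_slope => c0; apply: (cvg_near c0).
by near=> s; rewrite -gha; congr ((_ - _) / _); near: s.
Unshelve. all: by end_near. Qed.

Lemma has_slope_eq g h l : g =1 h -> has_slope g l -> has_slope h l.
Proof. by move=> gh; apply: has_slope_near => //; exact: nearW. Qed.

Lemma has_slope_cst l : has_slope (fun=> l) 0.
Proof.
have c0 : (fun=> 0 : R) @ F --> (0 : R) by exact: cvg_cst.
by apply: (cvg_near c0); apply: nearW => s; rewrite subrr mul0r.
Qed.

Lemma has_slopeD g h l m : has_slope g l -> has_slope h m ->
  has_slope (fun s => g s + h s) (l + m).
Proof.
move=> gl hm; pose proof (cvgD gl hm) as c0; apply: (cvg_near c0).
by near=> s; rewrite !fctE /=; ring.
Unshelve. all: by end_near. Qed.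

Lemma has_slopeM g h l m : has_slope g l -> has_slope h m ->
  has_slope (fun s => g s * h s) (l * h a + g a * m).
Proof.
move=> gl hm.
pose proof (cvgD (cvgM gl (slope_cont hm)) (cvgM (cvg_cst (g a)) hm)) as c0; move: c0.
apply: cvg_trans; apply: near_eq_cvg.
by near=> s; rewrite !fctE /=; ring.
Unshelve. all: by end_near. Qed.

Lemma has_slopeZ k g l : has_slope g l -> has_slope (fun s => k * g s) (k * l).
Proof.
by move=> /(has_slopeM (has_slope_cst k)); rewrite mul0r add0r.
Qed.

Lemma has_slopeN g l : has_slope g l -> has_slope (fun s => - g s) (- l).
Proof.
move=> /(has_slopeZ (k := -1)); rewrite mulN1r; apply: has_slope_eq => s.
by rewrite mulN1r.
Qed.

Lemma has_slopeB g h l m : has_slope g l -> has_slope h m ->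
  has_slope (fun s => g s - h s) (l - m).
Proof. by move=> gl /has_slopeN; exact: has_slopeD. Qed.

Lemma has_slope_sum n (g : 'I_n -> R -> R) (l : 'I_n -> R) :
  (forall i, has_slope (g i) (l i)) ->
  has_slope (fun s => \sum_i g i s) (\sum_i l i).
Proof.
elim: n g l => [|n ih] g l gl.
  rewrite big_ord0; apply: has_slope_eq (has_slope_cst 0) => s.
  by rewrite big_ord0.
rewrite big_ord_recl.
apply: has_slope_eq (has_slopeD (gl ord0) (ih _ _ (fun i => gl (lift ord0 i)))).
by move=> s; rewrite big_ord_recl.
Qed.

(* Caratheodory: the slope of phi at g a, extended by its limit phi', is
   continuous at g a, which covers the times s with g s = g a. *)
Lemma has_slope_comp g l phi phi' : is_derive (g a) (1 : R) phi phi' ->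
  has_slope g l -> has_slope (phi \o g) (phi' * l).
Proof.
move=> [dphi phiE] gl.
pose psi y := if y == g a then phi' else (phi y - phi (g a)) / (y - g a).
have psic : psi y @[y --> g a] --> psi (g a).
  have psid : psi y @[y --> (g a)^'] --> psi (g a).
    have shift0 : y - g a @[y --> (g a)^'] --> (0 : R)^'.
      move=> A [e /= e0 eA]; exists e => //= y ye yga; apply: eA.
        by rewrite /ball/= sub0r normrN distrC.
      by rewrite subr_eq0.
    rewrite {2}/psi eqxx -phiE.
    pose proof (cvg_comp _ _ shift0 dphi) as c0; apply: (cvg_near c0).
    near=> y; rewrite /psi /= ifF.
      by rewrite /GRing.scale/= mulrC mulr1 subrK.
    by apply/negbTE; near: y; exact: (nbhs_dnbhs_neq (g a)).
  move=> A nA /=; rewrite nbhs_filterE dnbhsE; split; first exact: psid.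
  by apply/principal_filterP; exact: nbhs_singleton nA.
pose proof (cvgM (cvg_comp _ _ (slope_cont gl) psic) gl) as c0; move: c0.
rewrite {2}/psi eqxx => c0; apply: (cvg_near c0); near=> s.
rewrite /= /psi; case: eqVneq => [->|gsa]; first by rewrite !subrr !mul0r mulr0.
by rewrite mulrA mulfVK// subr_eq0.
Unshelve. all: by end_near. Qed.

End slope.

(* has_slope unfolds to a product over neighbourhoods, hence these explicit
   declarations: the inferred ones would make that last argument implicit. *)
Arguments slope_cont {R F FF a} Fa {g l} _.
Arguments has_slope_near {R F FF a g h l} _ _ _.
Arguments has_slope_eq {R F FF a g h l} _ _.
Arguments has_slope_cst {R F FF a} l.
Arguments has_slopeD {R F FF a g h l m} _ _.
Arguments has_slopeM {R F FF a} Fa {g h l m} _ _.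
Arguments has_slopeZ {R F FF a} Fa k {g l} _.
Arguments has_slopeN {R F FF a} Fa {g l} _.
Arguments has_slopeB {R F FF a} Fa {g h l m} _ _.
Arguments has_slope_sum {R F FF a n g l} _.
Arguments has_slope_comp {R F FF a} Fa {g l phi phi'} _ _.

Section slope_rules.
Context {R : realType} (F : set_system R) {FF : ProperFilter F} (a : R).
Hypothesis Fa : F --> a^'.
Implicit Types (g h : R -> R) (l : R).

Lemma has_slope_ln g l : 0 < g a -> has_slope F a g l ->
  has_slope F a (fun s => ln (g s)) (l / g a).
Proof.
move=> g0 gl; rewrite mulrC; apply: (has_slope_comp Fa _ gl).
exact: is_derive1_ln.
Qed.

Lemma has_slopeV g l : g a != 0 -> has_slope F a g l ->
  has_slope F a (fun s => (g s)^-1) (- l / g a ^+ 2).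
Proof.
move=> g0 gl; rewrite mulNr mulrC -mulNr; apply: (has_slope_comp Fa _ gl).
apply: (@is_derive_eq _ _ _ _ _ _ _ _ (is_deriveV g0 (is_derive_id _ _))).
by rewrite /GRing.scale/= mulr1.
Qed.

Lemma has_slope_sqr g l : has_slope F a g l ->
  has_slope F a (fun s => g s ^+ 2) (2 * g a * l).
Proof.
move=> gl; pose proof (has_slopeM Fa gl gl) as ggl; move: ggl.
rewrite (_ : l * _ + _ = 2 * g a * l); last by ring.
by move=> ggl; exact: (has_slope_eq _ ggl).
Qed.

End slope_rules.

Arguments has_slope_ln {R F FF a} Fa {g l} _ _.
Arguments has_slopeV {R F FF a} Fa {g l} _ _.
Arguments has_slope_sqr {R F FF a} Fa {g l} _.

(** * The logarithm of a Maxwellian and its derivative *)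

Section squared_norm.
Context {R : realType} {d : nat}.
Implicit Types v w : 'rV[R]_d.

Lemma enorm_ge0 m n (A : 'M[R]_(m, n)) : 0 <= enorm A.
Proof. exact: sqrtr_ge0. Qed.

Lemma enorm_sqrE m n (A : 'M[R]_(m, n)) :
  enorm A ^+ 2 = \sum_i \sum_j A i j ^+ 2.
Proof.
rewrite sqr_sqrtr//; apply: sumr_ge0 => i _; apply: sumr_ge0 => j _.
exact: sqr_ge0.
Qed.

Lemma enorm_sqr_rV v : enorm v ^+ 2 = \sum_i v 0 i ^+ 2.
Proof. by rewrite enorm_sqrE big_ord1. Qed.

Lemma enorm_sqrB v w : enorm (v - w) ^+ 2 = \sum_i (v 0 i - w 0 i) ^+ 2.
Proof. by rewrite enorm_sqr_rV; apply: eq_bigr => i _; rewrite !mxE. Qed.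

Lemma maxwellian_gt0 (r : R) w (th : R) v : 0 < r -> 0 < th ->
  0 < maxwellian r w th v.
Proof.
move=> r0 th0; rewrite mulr_gt0 ?expR_gt0// divr_gt0// powR_gt0//.
by rewrite !mulr_gt0 ?pi_gt0.
Qed.

Lemma ln_maxwellian (r : R) w (th : R) v : 0 < r -> 0 < th ->
  ln (maxwellian r w th v) =
  ln r - d%:R / 2 * (ln (2 * pi) + ln th) - (\sum_i (v 0 i - w 0 i) ^+ 2) / (2 * th).
Proof.
move=> r0 th0; have pi0 : 0 < 2 * pi :> R by rewrite mulr_gt0 ?pi_gt0.
have p0 : 0 < (2 * pi * th) `^ (d%:R / 2) by rewrite powR_gt0// mulr_gt0.
rewrite /maxwellian [in LHS]lnM ?posrE ?divr_gt0 ?expR_gt0//.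
by rewrite ln_div ?posrE// ln_powR (lnM pi0) ?posrE// expRK enorm_sqrB.
Qed.

(** The parameters move along an arbitrary path, so the same formula gives the time derivative and
    each partial derivative in x of [ln M]. *)
Lemma has_slope_ln_maxwellian (F : set_system R) {FF : ProperFilter F} (a : R)
    (r th : R -> R) (w : R -> 'rV[R]_d) (r' th' : R) (w' : 'I_d -> R) v :
  F --> a^' ->
  (\forall s \near F, 0 < r s /\ 0 < th s) -> 0 < r a -> 0 < th a ->
  has_slope F a r r' -> has_slope F a th th' ->
  (forall i, has_slope F a (fun s => w s 0 i) (w' i)) ->
  has_slope F a (fun s => ln (maxwellian (r s) (w s) (th s) v))
    (r' / r a - d%:R / 2 * (th' / th a)
     + (\sum_i (v 0 i - w a 0 i) * w' i) / th a
     + (\sum_i (v 0 i - w a 0 i) ^+ 2) * th' / (2 * th a ^+ 2)).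
Proof.
move=> Fa near0 r0 th0 rr' thth' ww'.
pose y s := \sum_i (v 0 i - w s 0 i) ^+ 2.
have yy' : has_slope F a y (\sum_i (2 * (v 0 i - w a 0 i) * (0 - w' i))).
  apply: has_slope_sum => i; apply: (has_slope_sqr Fa (g := fun s => v 0 i - w s 0 i)).
  by apply: (has_slopeB Fa _ (ww' i)); exact: has_slope_cst.
have th2 : 2 * th a != 0 by rewrite mulf_neq0 ?gt_eqF.
pose proof (has_slopeB Fa (has_slopeB Fa (has_slope_ln Fa r0 rr')
  (has_slopeZ Fa (d%:R / 2) (has_slopeD (has_slope_cst (ln (2 * pi))) (has_slope_ln Fa th0 thth'))))
  (has_slopeM Fa yy' (has_slopeV Fa th2 (has_slopeZ Fa 2 thth')))) as lnM'; move: lnM'.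
rewrite (_ : _ - _ - _ = r' / r a - d%:R / 2 * (th' / th a)
     + (\sum_i (v 0 i - w a 0 i) * w' i) / th a
     + (\sum_i (v 0 i - w a 0 i) ^+ 2) * th' / (2 * th a ^+ 2)).
  move=> lnM'; apply: (has_slope_near _ _ lnM'); last by rewrite ln_maxwellian.
  by near=> s; rewrite ln_maxwellian//; near: s; apply: filterS near0 => s [].
rewrite (_ : \sum_i (2 * _ * _) = - 2 * \sum_i (v 0 i - w a 0 i) * w' i); last first.
  by rewrite mulr_sumr; apply: eq_bigr => i _; ring.
by rewrite /y; field; rewrite !gt_eqF.
Unshelve. all: by end_near. Qed.

End squared_norm.

Arguments has_slope_ln_maxwellian {R d F FF a r th w r' th' w'} v _ _ _ _ _ _ _.

(** * The filters behind time and directional derivatives *)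

Section filters.
Context {R : realType}.

Lemma time_filter_proper (T t : R) : 0 <= t < T ->
  ProperFilter (within `[0, T[%classic t^').
Proof.
move=> /andP[t0 tT]; apply: Build_ProperFilter => -[e /= e0 eA].
(* The witness [t + h] lies to the right of [t], which also covers [t = 0]; the halves keep it
   inside the ball and below [T]. *)
pose h := Num.min (e / 2) ((T - t) / 2).
have h0 : 0 < h by rewrite lt_min !divr_gt0 ?subr_gt0.
have he : h < e by rewrite gt_min; apply/orP; left; lra.
have hT : h < T - t by rewrite gt_min; apply/orP; right; lra.
apply: (eA (t + h)).
- by rewrite /ball/= opprD addrA subrr sub0r normrN gtr0_norm.
- by rewrite -subr_eq0 addrC addKr gt_eqF.
- by rewrite /= in_itv/=; apply/andP; split; lra.
Qed.

Lemma time_filter_dnbhs (T t : R) : within `[0, T[%classic t^' --> t^'.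
Proof. exact: cvg_within. Qed.

Lemma is_dtE (T t l : R) g : 0 <= t < T -> is_dt T g t l -> dt T g t = l.
Proof.
by move=> tT; have FF := time_filter_proper tT; move/cvg_lim; exact.
Qed.

Lemma dirE (V : normedModType R) (g : V -> R) x v l :
  has_slope 0^' (0 : R) (fun h => g (h *: v + x)) l <->
  h^-1 *: ((g \o shift x) (h *: v) - g x) @[h --> 0^'] --> l.
Proof.
rewrite /has_slope; split=> c0; apply: (cvg_near c0); near=> h;
  by rewrite /= scale0r add0r subr0 mulrC.
Unshelve. all: by end_near. Qed.

Lemma derivable_slope (V : normedModType R) (g : V -> R) x v :
  derivable g x v -> has_slope 0^' (0 : R) (fun h => g (h *: v + x)) ('D_v g x).
Proof. by move=> dg; apply/dirE. Qed.

Lemma slope_derive (V : normedModType R) (g : V -> R) x v l :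
  has_slope 0^' (0 : R) (fun h => g (h *: v + x)) l -> 'D_v g x = l.
Proof. by move/dirE/cvg_lim; exact. Qed.

End filters.

Arguments derivable_slope {R V g x v} _.
Arguments time_filter_dnbhs {R} T t.

(** * Transport of log M along the Euler flow *)

Section euler.
Context {R : realType} {d : nat}.
Implicit Types (v w b : 'rV[R]_d) (G : 'M[R]_d).

(* (d_t + v . grad_x) log M for an Euler Maxwellian M with velocity w,
   temperature th, G = grad u and b = grad (log theta). *)
Definition transport_poly w (th : R) G b v : R :=
  (\sum_i \sum_j G i j * (v 0 i - w 0 i) * (v 0 j - w 0 j)) / th
  - (\sum_i (v 0 i - w 0 i) ^+ 2) / (d%:R * th) * \sum_i G i i
  + ((\sum_i (v 0 i - w 0 i) ^+ 2) / (2 * th) - (d%:R + 2) / 2)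
    * \sum_i (v 0 i - w 0 i) * b 0 i.

(** A pointwise identity in the values and first derivatives of the fields. The conservative
    equations are first reduced to the equations for velocity and temperature; these eliminate every
    time derivative, and the density gradient cancels. *)
Lemma euler_transport_algebra (r th rt tht : R) (w wt rx thx : 'I_d -> R)
    (wx : 'I_d -> 'I_d -> R) (v : 'I_d -> R) :
  (0 < d)%N -> 0 < r -> 0 < th ->
  rt + \sum_i (rx i * w i + r * wx i i) = 0 ->
  (forall j, rt * w j + r * wt j
     + \sum_i ((rx i * w j + r * wx i j) * w i + r * w j * wx i i)
     + (rx j * th + r * thx j) = 0) ->
  (2^-1 * (rt * \sum_j w j ^+ 2 + r * \sum_j 2 * w j * wt j)
   + d%:R / 2 * (rt * th + r * tht))
   + \sum_i ((2^-1 * (rx i * \sum_j w j ^+ 2 + r * \sum_j 2 * w j * wx i j)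
              + d%:R / 2 * (rx i * th + r * thx i) + (rx i * th + r * thx i)) * w i
           + (2^-1 * r * \sum_j w j ^+ 2 + d%:R / 2 * r * th + r * th) * wx i i)
    = 0 ->
  (rt / r - d%:R / 2 * (tht / th) + (\sum_i (v i - w i) * wt i) / th
     + (\sum_i (v i - w i) ^+ 2) * tht / (2 * th ^+ 2))
  + \sum_k v k * (rx k / r - d%:R / 2 * (thx k / th)
        + (\sum_i (v i - w i) * wx k i) / th
        + (\sum_i (v i - w i) ^+ 2) * thx k / (2 * th ^+ 2)) =
  (\sum_i \sum_j wx i j * (v i - w i) * (v j - w j)) / th
  - (\sum_i (v i - w i) ^+ 2) / (d%:R * th) * \sum_i wx i i
  + ((\sum_i (v i - w i) ^+ 2) / (2 * th) - (d%:R + 2) / 2)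
    * \sum_i (v i - w i) * (thx i / th).
Proof.
move=> d0 r0 th0 e1 e2 e3.
have dR : (d%:R : R) != 0 by rewrite pnatr_eq0 -lt0n.
pose A := \sum_i rx i * w i; pose Dv := \sum_i wx i i.
pose S := \sum_i w i ^+ 2; pose B := \sum_i w i * wt i.
pose K j := \sum_i w i * wx i j; pose C := \sum_j w j * K j.
pose Tw := \sum_i thx i * w i.
have {}e1 : rt + A + r * Dv = 0.
  by rewrite -addrA -[RHS]e1 big_split/= mulr_sumr.
have {}e2 j : rt * w j + r * wt j + (A * w j + r * K j + r * w j * Dv)
    + (rx j * th + r * thx j) = 0.
  rewrite -[RHS](e2 j); congr (_ + _ + _).
  rewrite big_split/= -mulr_sumr; congr (_ + _).
  by rewrite /A /K mulr_suml mulr_sumr -big_split/=; apply: eq_bigr => i _; ring.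
(* Momentum equation minus [w j] times the mass equation. *)
have e2r j : r * wt j + r * K j + rx j * th + r * thx j = 0.
  have := e2 j; have : (rt + A + r * Dv) * w j = 0 by rewrite e1 mul0r.
  by move=> a1 a2; lra.
have e2w : r * B + r * C + A * th + r * Tw = 0.
  rewrite /B /C /A /Tw !mulr_sumr mulr_suml -!big_split/= big1// => j _.
  by have := e2r j; move/(congr1 ( *%R (w j))); rewrite mulr0 => <-; ring.
(* Temperature equation: from the energy equation, subtract [|w|^2 / 2 + d th / 2] times the mass
   equation and the scalar product of [w] with [e2r], then divide by [r]. *)
have {}e3 : d%:R / 2 * (tht + Tw) + th * Dv = 0.
  have sS : \sum_j 2 * w j * wt j = 2 * B.
    by rewrite mulr_sumr; apply: eq_bigr => i _; rewrite mulrA.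
  move: e3; rewrite sS -/S big_split/= -!mulr_sumr -/Dv.
  have -> : \sum_(i < d) (2^-1 * (rx i * S + r * (\sum_j 2 * w j * wx i j)) +
      d%:R / 2 * (rx i * th + r * thx i) + (rx i * th + r * thx i)) * w i =
      2^-1 * A * S + r * C + (d%:R / 2 + 1) * (A * th + r * Tw).
    have -> : C = \sum_i 2^-1 * (\sum_j 2 * w j * wx i j) * w i.
      rewrite /C /K; under eq_bigr do rewrite mulr_sumr.
      rewrite exchange_big/=; apply: eq_bigr => i _.
      rewrite mulr_sumr mulr_suml; by apply: eq_bigr => j _; lra.
    transitivity (\sum_i (2^-1 * S * (rx i * w i)
        + r * (2^-1 * (\sum_j 2 * w j * wx i j) * w i)
        + (d%:R / 2 + 1) * (th * (rx i * w i) + r * (thx i * w i)))).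
      by apply: eq_bigr => i _; ring.
    by rewrite !big_split/= -!mulr_sumr big_split/= -!mulr_sumr -/A -/Tw; ring.
  move=> e3; apply: (mulfI (lt0r_neq0 r0)).
  have : (rt + A + r * Dv) * (2^-1 * S + d%:R / 2 * th) = 0 by rewrite e1 mul0r.
  by move=> a1; lra.
pose y i := v i - w i.
pose Ay := \sum_i y i * rx i; pose Ty := \sum_i y i * thx i.
pose YY := \sum_i \sum_j wx i j * y i * y j; pose N := \sum_i y i ^+ 2.
pose L := \sum_i y i * wt i; pose M := \sum_i y i * K i.
have e2y : r * (L + M) + Ay * th + r * Ty = 0.
  rewrite /L /M /Ay /Ty -big_split/= !mulr_sumr mulr_suml -!big_split/= big1// => j _.
  by have := e2r j; move/(congr1 ( *%R (y j))); rewrite mulr0 => <-; ring.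
have sk : \sum_k v k * (rx k / r - d%:R / 2 * (thx k / th)
        + (\sum_i y i * wx k i) / th + N * thx k / (2 * th ^+ 2)) =
  (A + Ay) / r - d%:R / 2 * (Tw + Ty) / th + (M + YY) / th + N * (Tw + Ty) / (2 * th ^+ 2).
  have -> : M + YY = \sum_k v k * \sum_i y i * wx k i.
    rewrite /M /YY /K; under eq_bigr do rewrite mulr_sumr.
    rewrite exchange_big -big_split/=; apply: eq_bigr => k _.
    rewrite mulr_sumr -big_split/=; apply: eq_bigr => i _.
    by rewrite /y; ring.
  transitivity (\sum_k (r^-1 * (rx k * w k + y k * rx k)
      - d%:R / 2 / th * (thx k * w k + y k * thx k)
      + th^-1 * (v k * \sum_i y i * wx k i)
      + N / (2 * th ^+ 2) * (thx k * w k + y k * thx k))).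
    by apply: eq_bigr => k _; rewrite /y; field; rewrite !gt_eqF.
  rewrite !big_split/= sumrN -!mulr_sumr !big_split/= -/A -/Ay -/Tw -/Ty.
  by field; rewrite !gt_eqF.
have tT : tht + Tw = - (2 / d%:R * th * Dv).
  apply: (mulfI (_ : d%:R / 2 != 0 :> R)); first by rewrite mulf_neq0 ?invr_eq0.
  by apply/eqP; rewrite -subr_eq0; apply/eqP; rewrite -[RHS]e3; field.
have sb : \sum_i y i * (thx i / th) = Ty / th.
  by rewrite /Ty mulr_suml; apply: eq_bigr => i _; rewrite mulrA.
rewrite -/N -/Dv -/YY sk sb -/L.
(* The term in [Ay] produced here cancels [Ay / r], so no derivative of the density survives. *)
have hL : L + M = - (Ay * th / r) - Ty.
  by apply: (mulfI (lt0r_neq0 r0)); apply/eqP; rewrite -subr_eq0; apply/eqP;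
    rewrite -[RHS]e2y; field; rewrite gt_eqF.
have hA : rt + A = - (r * Dv).
  by apply/eqP; rewrite -subr_eq0 opprK e1.
have -> : rt / r - d%:R / 2 * (tht / th) + L / th + N * tht / (2 * th ^+ 2) +
    ((A + Ay) / r - d%:R / 2 * (Tw + Ty) / th + (M + YY) / th +
     N * (Tw + Ty) / (2 * th ^+ 2)) =
  (rt + A) / r + Ay / r - d%:R / 2 * ((tht + Tw) + Ty) / th + (L + M) / th + YY / th
  + N * ((tht + Tw) + Ty) / (2 * th ^+ 2).
  by field; rewrite !gt_eqF.
by rewrite hL hA tT; field; rewrite dR !gt_eqF.
Qed.

Lemma has_slope_energy (F : set_system R) {FF : ProperFilter F} (a : R)
    (r th : R -> R) (w : R -> 'rV[R]_d) (r' th' : R) (w' : 'I_d -> R) :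
  F --> a^' -> has_slope F a r r' -> has_slope F a th th' ->
  (forall i, has_slope F a (fun s => w s 0 i) (w' i)) ->
  has_slope F a
    (fun s => 2^-1 * r s * enorm (w s) ^+ 2 + d%:R / 2 * r s * th s)
    (2^-1 * (r' * \sum_j w a 0 j ^+ 2 + r a * \sum_j 2 * w a 0 j * w' j)
     + d%:R / 2 * (r' * th a + r a * th')).
Proof.
move=> Fa rr' tt' ww'.
pose proof (has_slopeD (has_slopeZ Fa 2^-1 (has_slopeM Fa rr'
     (has_slope_sum (fun j => has_slope_sqr Fa (ww' j)))))
    (has_slopeZ Fa (d%:R / 2) (has_slopeM Fa rr' tt'))) as h.
by apply: (has_slope_eq _ h) => s; rewrite enorm_sqr_rV !mulrA.
Qed.

Arguments has_slope_energy {F FF a r th w r' th' w'} _ _ _ _.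

Section smooth_rules.
Variables (V : normedModType R) (T : R) (F : R -> V -> R).
Hypothesis sF : smooth T F.

Lemma smooth_is_dt t x : 0 <= t < T -> is_dt T (F ^~ x) t (dt T (F ^~ x) t).
Proof. by move=> tT; have [_ [dF _ _]] := sF 1; exact: dF. Qed.

Lemma smooth_derivable t (x v : V) : 0 <= t < T -> derivable (F t) x v.
Proof. by move=> tT; have [_ [_ _ /(_ v)[+ _]]] := sF 1; exact. Qed.

Lemma smooth_dt : smooth T (fun t x => dt T (F ^~ x) t).
Proof. by move=> n; have [_ []] := sF n.+1. Qed.

Lemma smooth_D (v : V) : smooth T (fun t x => 'D_v (F t) x).
Proof. by move=> n; have [_ [_ _ /(_ v)[]]] := sF n.+1. Qed.

Lemma smooth_continuous :
  {within [set p : R * V | 0 <= p.1 < T], continuous (fun p => F p.1 p.2)}.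
Proof. by have [] := sF 0. Qed.

End smooth_rules.

Arguments smooth_is_dt {V T F} sF {t} x _.
Arguments smooth_derivable {V T F} sF {t} x v _.

Variables (T : R) (rho theta : R -> 'rV[R]_d -> R) (u : R -> 'rV[R]_d -> 'rV[R]_d).
Hypotheses (srho : smooth T rho) (su : forall i, smooth T (fun t x => u t x 0 i)).
Hypotheses (sth : smooth T theta).
Hypothesis rho0 : forall t x, 0 <= t < T -> 0 < rho t x.
Hypothesis th0 : forall t x, 0 <= t < T -> 0 < theta t x.
Let M := maxwellian_field rho u theta.
Local Notation e_ i := (delta_mx 0 i : 'rV[R]_d).

Section at_point.
Variables (t : R) (x : 'rV[R]_d).
Hypothesis tT : 0 <= t < T.
Let FF := time_filter_proper tT.
Local Existing Instance FF.
Let Fa := time_filter_dnbhs T t.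

Lemma time_filter_near : \forall s \near within `[0, T[%classic t^', 0 <= s < T.
Proof.
rewrite near_withinE; near=> s => /=; rewrite in_itv/=.
by case/andP => -> ->.
Unshelve. all: by end_near. Qed.

Lemma is_dt_lnM v : is_dt T (fun s => ln (M s x v)) t
  (dt T (rho ^~ x) t / rho t x - d%:R / 2 * (dt T (theta ^~ x) t / theta t x)
   + (\sum_i (v 0 i - u t x 0 i) * dt T (fun s => u s x 0 i) t) / theta t x
   + (\sum_i (v 0 i - u t x 0 i) ^+ 2) * dt T (theta ^~ x) t / (2 * theta t x ^+ 2)).
Proof.
apply: (has_slope_ln_maxwellian v Fa _ (rho0 x tT) (th0 x tT)
  (smooth_is_dt srho x tT) (smooth_is_dt sth x tT)
  (fun i => smooth_is_dt (su i) x tT)).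
by apply: filterS time_filter_near => s sT; split; [exact: rho0|exact: th0].
Qed.

#[local] Arguments is_dt_lnM v : clear implicits.

Lemma slope_dir (F : R -> 'rV[R]_d -> R) v : smooth T F ->
  has_slope 0^' (0 : R) (fun h => F t (h *: v + x)) ('D_v (F t) x).
Proof. by move=> sF; apply: derivable_slope; exact: smooth_derivable. Qed.

#[local] Arguments slope_dir {F} v _.

Lemma derive_lnM v i : 'D_(e_ i) (fun y => ln (M t y v)) x =
  'D_(e_ i) (rho t) x / rho t x - d%:R / 2 * ('D_(e_ i) (theta t) x / theta t x)
   + (\sum_j (v 0 j - u t x 0 j) * gradv (u t) x i j) / theta t x
   + (\sum_j (v 0 j - u t x 0 j) ^+ 2) * 'D_(e_ i) (theta t) x / (2 * theta t x ^+ 2).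
Proof.
apply: slope_derive.
pose proof (has_slope_ln_maxwellian v (w := fun h => u t (h *: e_ i + x))
  (@cvg_id _ _) (nearW _ (fun h => conj (rho0 (h *: e_ i + x) tT) (th0 (h *: e_ i + x) tT)))
  (rho0 _ tT) (th0 _ tT) (slope_dir (e_ i) srho) (slope_dir (e_ i) sth)
  (fun j => slope_dir (e_ i) (su j))) as h; move: h.
rewrite scale0r add0r; congr has_slope.
by congr (_ + _ / _ + _); apply: eq_bigr => j _; rewrite mxE.
Qed.

Lemma derive_ln_theta i :
  'D_(e_ i) (fun y => ln (theta t y)) x = 'D_(e_ i) (theta t) x / theta t x.
Proof.
apply: slope_derive.
pose proof (has_slope_ln (@cvg_id _ _) (th0 _ tT) (slope_dir (e_ i) sth)) as h.
by move: h; rewrite scale0r add0r.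
Qed.

Lemma transport_lnM v : (0 < d)%N -> euler_system T rho u theta ->
  dt T (fun s => ln (M s x v)) t + dotp v (grad (fun y => ln (M t y v)) x) =
  transport_poly (u t x) (theta t x) (gradv (u t) x)
    (grad (fun y => ln (theta t y)) x) v.
Proof.
move=> d0 /(_ t x tT)[e1 e2 e3].
rewrite (is_dtE tT (is_dt_lnM v)) /dotp /transport_poly.
under [X in _ + X]eq_bigr do rewrite mxE derive_lnM.
under [X in _ + (_ - _) * X]eq_bigr do rewrite mxE derive_ln_theta.
have dur j : is_dt T (fun s => u s x 0 j) t (dt T (fun s => u s x 0 j) t).
  exact: (smooth_is_dt (su j) x tT).
have dr := smooth_is_dt srho x tT.
have dth := smooth_is_dt sth x tT.
have Du j i := slope_dir (e_ i) (su j).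
have Dr i := slope_dir (e_ i) srho.
have Dth i := slope_dir (e_ i) sth.
apply: (euler_transport_algebra (wt := fun j => dt T (fun s => u s x 0 j) t)
  (rx := fun i => 'D_(e_ i) (rho t) x) (wx := fun i j => gradv (u t) x i j)
  (fun i => v 0 i) d0 (rho0 x tT) (th0 x tT)).
- rewrite -[RHS]e1; congr (_ + _); apply: eq_bigr => i _; apply/esym.
  apply: slope_derive; pose proof (has_slopeM (@cvg_id _ _) (Dr i) (Du i i)) as h.
  move: h; rewrite scale0r add0r; rewrite mxE => h; apply: (has_slope_eq _ h) => s.
  by rewrite mxE.
- move=> j; rewrite -[RHS](e2 j); congr (_ + _ + _).
  + apply/esym/(is_dtE tT); exact: (has_slopeM Fa dr (dur j)).
  + apply: eq_bigr => i _; apply/esym; apply: slope_derive.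
    pose proof (has_slopeM (@cvg_id _ _) (has_slopeM (@cvg_id _ _) (Dr i) (Du j i)) (Du i i)) as h.
    move: h; rewrite scale0r add0r !mxE => h; apply: (has_slope_eq _ h) => s.
    by rewrite mxE.
  + rewrite mxE; apply/esym; apply: slope_derive.
    pose proof (has_slopeM (@cvg_id _ _) (Dr j) (Dth j)) as h.
    by move: h; rewrite scale0r add0r.
rewrite -[RHS]e3; congr (_ + _).
  by apply/esym/(is_dtE tT); exact: (has_slope_energy Fa dr dth dur).
apply: eq_bigr => i _; apply/esym; apply: slope_derive.
pose proof (has_slopeM (@cvg_id _ _) (has_slopeD
  (has_slope_energy (w := fun h => u t (h *: e_ i + x)) (@cvg_id _ _) (Dr i) (Dth i) (Du^~ i))
  (has_slopeM (@cvg_id _ _) (Dr i) (Dth i))) (Du i i)) as h.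
move: h; rewrite scale0r add0r enorm_sqr_rV mxE.
have -> : \sum_j 2 * u t x 0 j * gradv (u t) x i j =
    \sum_j 2 * u t x 0 j * 'D_(e_ i) (fun y => u t y 0 j) x.
  by apply: eq_bigr => j _; rewrite mxE.
by move=> h; apply: (has_slope_eq _ h) => s; rewrite mxE.
Qed.

End at_point.

End euler.

(** * Borel measurability of continuous functions of two vectors *)

Section continuous_measurable.
Context {R : realType} (n m : nat).

Let box k (q : 'rV[rat]_k) (e : R) : set 'rV[R]_k :=
  [set x | forall i, ball (ratr (q 0 i) : R) e (x 0 i)].

Let measurable_box k (q : 'rV[rat]_k) e : measurable (box q e).
Proof.
apply: (@measurable_rV_box R k (fun i => ball (ratr (q 0 i) : R) e)) => i.
exact: measurable_ball.
Qed.

Let rat_approx k (x : 'rV[R]_k) (e : R) : 0 < e ->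
  exists q : 'rV[rat]_k, box q e x.
Proof.
move=> e0; have /choice[q qP] : forall i, exists q : rat, ball (ratr q : R) e (x 0 i).
  move=> i; have [|q] := @rat_in_itvoo R (x 0 i - e) (x 0 i + e); first by lra.
  by rewrite in_itv/= => /andP[q1 q2]; exists q; rewrite /ball/= ltr_norml; lra.
by exists (\row_i q i) => i; rewrite mxE.
Qed.

Let box_ball k (q : 'rV[rat]_k) (e : R) x y : 0 < e -> box q e x -> box q e y ->
  ball x (e + e) y.
Proof.
move=> e0 qx qy; split; first by rewrite addr_gt0.
move=> i j; rewrite ord1; have := qx j; have := qy j.
by rewrite /ball/= !ltr_distl => /andP[? ?] /andP[? ?]; apply/andP; split; lra.
Qed.

(** The sigma-algebra is generated by coordinates, so openness has to be reduced to boxes: an open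
    set is the countable union of the products of boxes with rational centres and radius
    [1 / (k + 1)] that it contains. *)
Lemma open_measurable_rV2 (O : set ('rV[R]_n * 'rV[R]_m)) :
  open O -> measurable O.
Proof.
move=> oO.
pose B (q : 'rV[rat]_n * 'rV[rat]_m * nat) :=
  box q.1.1 (q.2.+1%:R^-1) `*` box q.1.2 (q.2.+1%:R^-1).
pose B' q := if `[< B q `<=` O >] then B q else set0.
have -> : O = \bigcup_q B' q.
  apply/seteqP; split => [[x y] Oxy|z [q _]]; last first.
    by rewrite /B'; case: asboolP => // BO /BO.
  have := oO (x, y) Oxy; rewrite -nbhs_ballE => -[e /= e0 eO].
  have [k ke] : exists k : nat, k.+1%:R^-1 + k.+1%:R^-1 < e.
    exists (Num.truncn (2 / e)).
    have := truncnS_gt (2 / e); set k := Num.truncn _ => ke.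
    have -> : k.+1%:R^-1 + k.+1%:R^-1 = 2 / k.+1%:R :> R by rewrite mulr_natl mulr2n.
    by rewrite ltr_pdivrMr// mulrC -ltr_pdivrMr.
  have k0 : 0 < k.+1%:R^-1 :> R by rewrite invr_gt0.
  have [q1 q1x] := rat_approx x k0; have [q2 q2y] := rat_approx y k0.
  exists (q1, q2, k) => //; rewrite /B' asboolT// => -[x' y'] [/= bx by_].
  apply: eO; split => /=.
    by apply: (@le_ball _ _ _ _ _ (ltW ke)); exact: box_ball bx.
  by apply: (@le_ball _ _ _ _ _ (ltW ke)); exact: box_ball by_.
apply: countable_bigcupT_measurable; first exact: countableP.
move=> q; rewrite /B'; case: asboolP => // _.
by apply: measurableX; exact: measurable_box.
Qed.

Lemma continuous_measurable_rV2 (F : 'rV[R]_n * 'rV[R]_m -> R) :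
  continuous F -> measurable_fun setT F.
Proof.
move=> cF; apply: (measurability _ (RGenOInfty.measurableE R)) => _ [_ [x ->] <-].
rewrite setTI; apply: open_measurable_rV2.
by apply: open_comp => //; exact: interval_open.
Qed.

End continuous_measurable.

(** * Integrals with a finite value *)

Section has_integral.
Context d (T : measurableType d) (R : realType).
Variable mu : {measure set T -> \bar R}.
Implicit Types (f g : T -> R) (a b k : R).

(** Integrability and the real value are bundled, so that linearity and comparison of integrals
    become arithmetic in [R] rather than in the extended reals. *)
Definition has_integral f a :=
  mu.-integrable setT (EFin \o f) /\ (\int[mu]_x (f x)%:E = a%:E)%E.

Lemma integrable_has_integral f : mu.-integrable setT (EFin \o f) ->
  has_integral f (fine (\int[mu]_x (f x)%:E)).
Proof. by move=> intf; split; rewrite // fineK//; exact: integrable_fin_num. Qed.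

Lemma has_integral_measurable f a : has_integral f a -> measurable_fun setT f.
Proof. by move=> [/measurable_int/measurable_EFinP]. Qed.

Lemma has_integral_unique f a b : has_integral f a -> has_integral f b -> a = b.
Proof. by move=> [_ fa] [_]; rewrite fa => -[]. Qed.

Lemma has_integral_eq f g a : f =1 g -> has_integral f a -> has_integral g a.
Proof. by move=> /funext ->. Qed.

Lemma ge0_has_integral f a : measurable_fun setT f -> (forall x, 0 <= f x) ->
  (\int[mu]_x (f x)%:E = a%:E)%E -> has_integral f a.
Proof.
move=> mf f0 fa; split=> //; apply/integrableP; split; first exact/measurable_EFinP.
by under eq_integral do rewrite /= ger0_norm//; rewrite fa ltry.
Qed.

Lemma has_integralD f g a b : has_integral f a -> has_integral g b ->
  has_integral (fun x => f x + g x) (a + b).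
Proof.
move=> [intf fa] [intg gb]; split.
  rewrite (_ : EFin \o _ = (EFin \o f) \+ (EFin \o g))%E; last exact/funext.
  exact: integrableD.
under eq_integral do rewrite EFinD.
by rewrite integralD// [X in (X + _)%E]fa [X in (_ + X)%E]gb EFinD.
Qed.

Lemma has_integralZ k f a : has_integral f a ->
  has_integral (fun x => k * f x) (k * a).
Proof.
move=> [intf fa]; split.
  rewrite (_ : EFin \o _ = (fun x => k%:E * (EFin \o f) x))%E; last exact/funext.
  exact: integrableZl.
under eq_integral do rewrite EFinM.
by rewrite integralZl// [X in (_ * X)%E]fa EFinM.
Qed.

Lemma has_integralN f a : has_integral f a -> has_integral (fun x => - f x) (- a).
Proof.
move=> /(has_integralZ (-1)); rewrite mulN1r.
by apply: has_integral_eq => x; rewrite mulN1r.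
Qed.

Lemma has_integralB f g a b : has_integral f a -> has_integral g b ->
  has_integral (fun x => f x - g x) (a - b).
Proof. by move=> fa /has_integralN; exact: has_integralD. Qed.

Lemma has_integral0 : has_integral (fun=> 0) 0.
Proof.
apply: ge0_has_integral => //.
by under eq_integral do [idtac]; rewrite integral0_eq.
Qed.

Lemma has_integral_sum n (f : 'I_n -> T -> R) (a : 'I_n -> R) :
  (forall i, has_integral (f i) (a i)) ->
  has_integral (fun x => \sum_i f i x) (\sum_i a i).
Proof.
elim: n f a => [|n ih] f a fa.
  by rewrite big_ord0; apply: has_integral_eq has_integral0 => x; rewrite big_ord0.
rewrite big_ord_recl.
apply: has_integral_eq (has_integralD (fa ord0) (ih _ _ (fun i => fa (lift ord0 i)))).
by move=> x; rewrite big_ord_recl.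
Qed.

Lemma ae_has_integral_le f g a b : has_integral f a -> has_integral g b ->
  {ae mu, forall x, f x <= g x} -> a <= b.
Proof.
move=> [intf fa] [intg gb] fg; rewrite -lee_fin -fa -gb.
have [N [mN N0 Nfg]] := fg.
rewrite [leLHS](negligible_integral mN measurableT intf N0).
rewrite [leRHS](negligible_integral mN measurableT intg N0).
apply: le_integral.
- exact: measurableD.
- by apply: integrableS intf => //; exact: measurableD.
- by apply: integrableS intg => //; exact: measurableD.
- move=> x; rewrite inE => -[_ Nx]; rewrite lee_fin.
  by apply: contrapT => fgx; apply: Nx; exact: Nfg.
Qed.

Lemma has_integral_le f g a b : has_integral f a -> has_integral g b ->
  (forall x, f x <= g x) -> a <= b.
Proof. by move=> fa gb fg; apply: (ae_has_integral_le fa gb); exact: aeW. Qed.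

Lemma ae_eq_has_integral f g a : measurable_fun setT g ->
  {ae mu, forall x, f x = g x} -> has_integral f a -> has_integral g a.
Proof.
move=> mg fg [intf fa]; split.
  move/integrableP: intf => [mf intf]; apply/integrableP; split.
    exact/measurable_EFinP.
  apply: le_lt_trans intf; rewrite le_eqVlt; apply/orP; left; apply/eqP.
  apply: ae_eq_integral => //.
  - by apply: measurableT_comp => //; exact/measurable_EFinP.
  - exact: measurableT_comp.
  - by apply: filterS fg => x /= -> _.
rewrite -fa; apply: ae_eq_integral => //.
- exact/measurable_EFinP.
- exact: measurable_int intf.
- by apply: filterS fg => x /= -> _.
Qed.

Lemma has_integral_dom f g a : measurable_fun setT g -> has_integral f a ->
  (forall x, `|g x| <= f x) -> has_integral g (fine (\int[mu]_x (g x)%:E)).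
Proof.
move=> mg [intf _] gf; apply: integrable_has_integral.
apply: le_integrable intf => //; first exact/measurable_EFinP.
by move=> x _; rewrite /= lee_fin (le_trans (gf x))// ler_norm.
Qed.

(** The integral of [|f|] is [- a], which is both nonnegative and nonpositive. *)
Lemma ae_le0_has_integral f a : has_integral f a -> 0 <= a ->
  {ae mu, forall x, f x <= 0} -> {ae mu, forall x, f x = 0}.
Proof.
move=> fa a0 f0; have mf := has_integral_measurable fa.
have hN : has_integral (fun x => `|f x|) (- a).
  apply: ae_eq_has_integral (has_integralN fa); first exact: measurableT_comp.
  by apply: filterS f0 => x fx; rewrite ler0_norm.
have Na0 : 0 <= - a by apply: (has_integral_le has_integral0 hN).
have aE : a = 0 by lra.
have : (\int[mu]_x `|(EFin \o f) x| = 0)%E.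
  by have [_ /=] := hN; rewrite aE oppr0.
have mEf : measurable_fun setT (EFin \o f) by exact/measurable_EFinP.
move=> /(ae_eq_integral_abs _ measurableT mEf).
by apply: filterS => x /(_ I) [].
Qed.

Lemma ge0_has_integral_eq0 f : (forall x, 0 <= f x) -> has_integral f 0 ->
  {ae mu, forall x, f x = 0}.
Proof.
move=> f0 /has_integralN; rewrite oppr0 => f00.
have : {ae mu, forall x, - f x <= 0} by apply: aeW => x; rewrite oppr_le0.
move=> /(ae_le0_has_integral f00 (lexx 0)).
by apply: filterS => x /eqP; rewrite oppr_eq0 => /eqP.
Qed.

End has_integral.

(** * Elementary inequalities for exp and log *)

Section inequalities.
Context {R : realType}.
Implicit Types (x y a b h K : R).

(** Used after dividing an expansion in [h] by a power of [h]: it compares the leading coefficients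
    and discards the error. *)
Lemma le_of_perturbation a b K h0 : 0 < h0 -> 0 < K ->
  (forall h, 0 < h -> h <= h0 -> b <= a + K * h) -> b <= a.
Proof.
move=> h00 K0 ab; rewrite leNgt; apply/negP => ba.
pose h := Num.min h0 ((b - a) / (2 * K)).
have h_gt0 : 0 < h by rewrite lt_min h00 divr_gt0 ?subr_gt0 ?mulr_gt0.
have hh0 : h <= h0 by rewrite ge_min lexx.
have hK : K * h <= (b - a) / 2.
  have : h <= (b - a) / (2 * K) by rewrite ge_min lexx orbT.
  rewrite -(ler_pM2l K0) => /le_trans; apply.
  by rewrite le_eqVlt; apply/orP; left; apply/eqP; field; rewrite gt_eqF.
by have := ab h h_gt0 hh0; lra.
Qed.

(* The derivative of [exp (-x) (1 + x + x^2/2 + x^3/6)] is [- exp (-x) x^3/6],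
   so that 0 is its maximum. *)
Lemma expR_ge_cubic x : 1 + x + x ^+ 2 / 2 + x ^+ 3 / 6 <= expR x.
Proof.
pose p x : R := 1 + x + x ^+ 2 / 2 + x ^+ 3 / 6.
pose g x := expR (- x) * p x.
have dg z : is_derive z (1 : R) g (- (expR (- z) * z ^+ 3 / 6)).
  have dp : is_derive z (1 : R) p (1 + z + z ^+ 2 / 2).
    rewrite /p; apply: is_derive_eq; rewrite /GRing.scale/=; lra.
  apply: is_derive_eq; rewrite /GRing.scale/= /p; lra.
have cg a b : {within `[a, b], continuous g}.
  apply: derivable_within_continuous => z _; exact: ex_derive.
suff : g x <= 1.
  rewrite /g -(ler_pM2l (expR_gt0 x)) mulrA -expRD subrr expR0 mul1r mulr1.
  exact.
have g0 : g 0 = 1 by rewrite /g /p oppr0 expR0 !expr0n/=; lra.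
have [x0|x0|->] := ltgtP x 0; last by rewrite g0.
- have [c] := MVT x0 (fun z _ => dg z) (cg x 0).
  rewrite in_itv/= => /andP[xc c0]; rewrite g0 => gx.
  have : 0 <= - (expR (- c) * c ^+ 3 / 6) * (0 - x).
    rewrite mulr_ge0//; last lra.
    rewrite oppr_ge0 -mulrA mulr_ge0_le0 ?expR_ge0//.
    rewrite pmulr_lle0 ?invr_gt0// exprS mulr_le0_ge0 ?sqr_ge0//; lra.
  by rewrite -gx; lra.
- have [c] := MVT x0 (fun z _ => dg z) (cg 0 x).
  rewrite in_itv/= => /andP[xc c0]; rewrite g0 => gx.
  have : - (expR (- c) * c ^+ 3 / 6) * (x - 0) <= 0.
    rewrite mulr_le0_ge0//; last lra.
    by rewrite oppr_le0 !mulr_ge0 ?expR_ge0 ?exprn_ge0 ?ltW// invr_gt0.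
  by rewrite -gx; lra.
Qed.

Lemma expR_cosh_ge x : 2 + x ^+ 2 <= expR x + expR (- x).
Proof.
have := expR_ge_cubic x; have := expR_ge_cubic (- x).
lra.
Qed.

(** Both bounds come from [expR a <= 1 / (1 - a)], that is, from [1 - a <= expR (- a)] inverted. *)
Lemma expR_le_small a : 0 <= a -> a <= 2^-1 ->
  expR a <= 1 + 2 * a /\ expR a <= 1 + a + 2 * a ^+ 2.
Proof.
move=> a0 a2; have := expR_ge1Dx (- a); have e0 := expR_gt0 a.
rewrite -(ler_pM2l e0) -expRD subrr expR0 => h.
have [n0 n1] : 0 <= a * (1 - 2 * a) /\ 0 <= a ^+ 2 * (1 - 2 * a).
  by split; rewrite mulr_ge0 ?sqr_ge0//; lra.
by split; rewrite -(@ler_pM2r _ (1 - a)); lra.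
Qed.

(** [384 = 4^3 * 3!]: the cube is absorbed by the term of order three in the series of
    [expR (y / 4)]. *)
Lemma cube_expR_le y : 0 <= y -> y ^+ 3 * expR (- (y / 2)) <= 384 * expR (- (y / 4)).
Proof.
move=> y0; have y4 : 0 <= y / 4 by rewrite divr_ge0.
have := expR_ge1Dxn 2 y4; rewrite (_ : 3`!%:R = 6 :> R)// => h.
have -> : - (y / 4) = y / 4 + - (y / 2) by lra.
rewrite expRD mulrA ler_wpM2r ?expR_ge0//; lra.
Qed.

Lemma ln_le_sub1 x : 0 < x -> ln x <= x - 1.
Proof. by move=> x0; rewrite -{1}(subrKC 1 x) le_ln1Dx//; lra. Qed.

(** With [s = sqrt y], the bound [ln y = 2 ln s <= 2 (s - 1)] makes the right side at least
    [(s - 1)^2]. Multiplying by [(s + 1)^2 <= 2 (y + 1)] gives [(y - 1)^2]. *)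
Lemma sub1_ln_ge y : 0 < y -> (y - 1) ^+ 2 / (2 * (y + 1)) <= y - 1 - ln y.
Proof.
move=> y0; set s := Num.sqrt y.
have s0 : 0 < s by rewrite sqrtr_gt0.
have ys : y = s ^+ 2 by rewrite sqr_sqrtr ?ltW.
have -> : ln y = 2 * ln s by rewrite ys lnXn// mulr_natl.
have : ln s <= s - 1 by exact: ln_le_sub1.
have h : (y - 1) ^+ 2 / (2 * (y + 1)) <= (s - 1) ^+ 2.
  rewrite ler_pdivrMr; last by rewrite mulr_gt0// addr_gt0.
  rewrite ys (_ : (s ^+ 2 - 1) ^+ 2 = (s - 1) ^+ 2 * (s + 1) ^+ 2); last by ring.
  rewrite ler_wpM2l ?sqr_ge0//; have := sqr_ge0 (s - 1); lra.
by move=> ls; apply: (le_trans h); rewrite [in leRHS]ys; lra.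
Qed.

(** By symmetry [y <= x], and then [ln (x / y) >= 1 - y / x = (x - y) / x], where the denominator
    may be enlarged to [x + y]. *)
Lemma log_mean_ge x y : 0 < x -> 0 < y ->
  (x - y) ^+ 2 / (x + y) <= (x - y) * ln (x / y).
Proof.
wlog yx : x y / y <= x.
  move=> H x0 y0; have [yx|/ltW xy] := leP y x; first exact: H.
  have := H _ _ xy y0 x0; rewrite ln_div ?posrE// ln_div ?posrE// (addrC y x).
  by rewrite -(sqrrN (x - y)) opprB; lra.
move=> x0 y0.
have : ln (y / x) <= y / x - 1 by apply: ln_le_sub1; rewrite divr_gt0.
rewrite ln_div ?posrE// ln_div ?posrE// => h.
have {}h : (x - y) / x <= ln x - ln y by rewrite mulrBl divff ?gt_eqF//; lra.
rewrite expr2 -mulrA ler_wpM2l ?subr_ge0//; apply: (le_trans _ h).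
rewrite ler_pdivrMr ?addr_gt0// mulrAC ler_pdivlMr// ler_wpM2l ?subr_ge0//; lra.
Qed.

(** The pointwise Gibbs inequality: once integrated, it bounds a relative entropy below by a
    difference of masses. *)
Lemma mul_ln_ge x y : 0 < x -> 0 < y -> x - y <= x * ln (x / y).
Proof.
move=> x0 y0; have : ln (y / x) <= y / x - 1 by apply: ln_le_sub1; rewrite divr_gt0.
rewrite -(ler_pM2l x0) mulrBr mulr1 mulrCA divff ?gt_eqF// mulr1.
by rewrite !ln_div ?posrE//; lra.
Qed.

End inequalities.

(** * Total mass of a Gaussian on R^n *)

Section gaussian_mass.
Context {R : realType}.
Local Notation mu := (@lebesgue_measure R).

Lemma ge0_integral_rV_lebesgueS n (f : 'rV[R]_n.+1 -> \bar R) :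
  measurable_fun setT f -> (forall v, 0 <= f v)%E ->
  (\int[rV_lebesgue n.+1]_v f v =
   \int[mu]_a \int[rV_lebesgue n]_y f (rV_cons (a, y)))%E.
Proof.
move=> mf f0.
pose proof (ge0_integral_pushforward (@measurable_rV_cons R n)
  (mu \x rV_lebesgue n)%E measurableT mf (fun v _ => f0 v)) as h.
have mfc : measurable_fun setT (f \o @rV_cons R n).
  exact: (measurableT_comp mf (@measurable_rV_cons R n)).
move: h; rewrite preimage_setT fubini_tonelli1 => [h|//|x]; last exact: f0.
apply: (etrans _ h); apply: eq_measure_integral => //.
exact: measurable_rV_cons.
Qed.

Lemma measurable_rV_coord_fun n (g : R -> R) (i : 'I_n) :
  measurable_fun setT g -> measurable_fun setT (fun v : 'rV[R]_n => g (v 0 i)).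
Proof. by move=> mg; apply: measurableT_comp => //; exact: measurable_rV_coord. Qed.

Lemma integral_prod_density n (g : 'I_n -> R -> R) :
  (forall i, measurable_fun setT (g i)) -> (forall i x, 0 <= g i x) ->
  (forall i, \int[mu]_x (g i x)%:E = 1)%E ->
  (\int[rV_lebesgue n]_v (\prod_i g i (v 0 i))%:E = 1)%E.
Proof.
elim: n g => [|n ih] g mg g0 g1.
  rewrite /= integral_dirac//.
    by rewrite diracT mul1e big_ord0.
  apply/measurable_EFinP; apply: measurable_prod => i _.
  exact: measurable_rV_coord_fun.
rewrite ge0_integral_rV_lebesgueS.
- under eq_integral => a _.
    have -> : (\int[rV_lebesgue n]_y (\prod_i g i (rV_cons (a, y) 0 i))%:E =
      (g ord0 a)%:E)%E.
      under eq_integral => y _ do rewrite big_ord_recl EFinM.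
      under eq_integral => y _.
        rewrite mxE unlift_none/=.
        under eq_bigr do rewrite mxE liftK/=.
        over.
      rewrite ge0_integralZl_EFin//.
      + by rewrite (ih (fun i => g (lift ord0 i))) ?mule1.
      + by move=> y _; rewrite lee_fin prodr_ge0.
      + apply/measurable_EFinP; apply: measurable_prod => i _.
        exact: measurable_rV_coord_fun.
    over.
  exact: g1.
- apply/measurable_EFinP; apply: measurable_prod => i _.
  exact: measurable_rV_coord_fun.
- by move=> v; rewrite lee_fin prodr_ge0.
Qed.

Lemma maxwellian_prod n (w : 'rV[R]_n) (th : R) v : 0 < th ->
  maxwellian 1 w th v = \prod_i normal_pdf (w 0 i) (Num.sqrt th) (v 0 i).
Proof.
move=> th0; have s0 : Num.sqrt th != 0 by rewrite gt_eqF ?sqrtr_gt0.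
under eq_bigr do rewrite normal_pdfE//.
rewrite big_split/= /maxwellian div1r; congr (_ * _).
  rewrite prodr_const card_ord /normal_peak sqr_sqrtr ?ltW//.
  rewrite exprVn; congr (_^-1).
  have p0 : 0 <= 2 * pi * th :> R by rewrite !mulr_ge0 ?pi_ge0 ?ltW.
  rewrite (_ : th * pi *+ 2 = 2 * pi * th); last by ring.
  by rewrite -powR12_sqrt// -powR_mulrn ?powR_ge0// -powRrM (mulrC (2^-1)).
rewrite enorm_sqrB mulr_suml -sumrN expR_sum; apply: eq_bigr => i _.
rewrite /normal_fun sqr_sqrtr ?ltW//; congr expR.
by rewrite mulNr mulr_natl.
Qed.

Lemma measurable_maxwellian n (r : R) (w : 'rV[R]_n) (th : R) :
  measurable_fun setT (maxwellian r w th).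
Proof.
apply: measurable_funM => //; apply: measurableT_comp => //.
apply: measurable_funN; apply: measurable_funM => //.
under eq_fun do rewrite enorm_sqrB.
apply: measurable_sum => i.
apply: (@measurable_rV_coord_fun _ (fun x => (x - w 0 i) ^+ 2)).
by apply: measurable_funX; apply: measurable_funB.
Qed.

Lemma maxwellianZ n (r : R) (w : 'rV[R]_n) (th : R) v :
  maxwellian r w th v = r * maxwellian 1 w th v.
Proof. by rewrite /maxwellian div1r -mulrA. Qed.

Lemma integral_maxwellian n (r : R) (w : 'rV[R]_n) (th : R) : 0 <= r -> 0 < th ->
  (\int[rV_lebesgue n]_v (maxwellian r w th v)%:E = r%:E)%E.
Proof.
move=> r0 th0.
under eq_integral do rewrite maxwellianZ EFinM.
rewrite ge0_integralZl_EFin//.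
- rewrite -[RHS]mule1; congr (_ * _)%E.
  under eq_integral do rewrite maxwellian_prod//.
  apply: (@integral_prod_density _ (fun i => normal_pdf (w 0 i) (Num.sqrt th))).
  + by move=> i; exact: measurable_normal_pdf.
  + by move=> i x; exact: normal_pdf_ge0.
  + by move=> i; exact: integral_normal_pdf.
- by move=> v _; rewrite lee_fin ltW// maxwellian_gt0.
- by apply/measurable_EFinP; exact: measurable_maxwellian.
Qed.

End gaussian_mass.

(** * Generating functions of a Gaussian and its sixth moment *)

Section gaussian_moments.
Context {R : realType} {d : nat}.
Local Notation Rd := 'rV[R]_d.
Local Notation mu := (@rV_lebesgue R d).
Implicit Types (w v e : Rd) (th r : R).

Lemma has_integral_maxwellian r w th : 0 <= r -> 0 < th ->
  has_integral mu (maxwellian r w th) r.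
Proof.
move=> r0 th0; apply: ge0_has_integral; last exact: integral_maxwellian.
  exact: measurable_maxwellian.
by move=> v; rewrite maxwellianZ mulr_ge0// ltW// maxwellian_gt0.
Qed.

(** Half of the Gaussian exponent absorbs the sixth power by [cube_expR_le]. The other half is a
    Gaussian of doubled temperature, whose normalization costs [2^(d/2)]. *)
Lemma maxwellian_sixth r w th v : 0 <= r -> 0 < th ->
  enorm (v - w) ^+ 6 * maxwellian r w th v <=
  384 * 2 `^ (d%:R / 2) * th ^+ 3 * maxwellian r w (2 * th) v.
Proof.
move=> r0 th0; pose y := enorm (v - w) ^+ 2 / th.
have y0 : 0 <= y by rewrite divr_ge0 ?sqr_ge0 ?ltW.
have N2 : enorm (v - w) ^+ 2 = y * th by rewrite divfK ?gt_eqF.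
rewrite (exprM _ 2 3) /maxwellian N2 exprMn.
have -> : y * th / (2 * th) = y / 2 by field; rewrite gt_eqF.
have -> : y * th / (2 * (2 * th)) = y / 4 by field; rewrite gt_eqF.
have p0 : 0 < (2 * pi * th) `^ (d%:R / 2) by rewrite powR_gt0// !mulr_gt0 ?pi_gt0.
have q0 : 0 < (2 : R) `^ (d%:R / 2) by rewrite powR_gt0.
have -> : (2 * pi * (2 * th)) `^ (d%:R / 2) =
    2 `^ (d%:R / 2) * (2 * pi * th) `^ (d%:R / 2).
  by rewrite -powRM ?mulr_ge0 ?pi_ge0 ?ltW//; congr (_ `^ _); ring.
rewrite [leLHS](_ : _ = th ^+ 3 * (r / (2 * pi * th) `^ (d%:R / 2)) *
  (y ^+ 3 * expR (- (y / 2)))); last by ring.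
rewrite [leRHS](_ : _ = th ^+ 3 * (r / (2 * pi * th) `^ (d%:R / 2)) *
  (384 * expR (- (y / 4)))); last by field; rewrite !gt_eqF.
rewrite ler_wpM2l ?cube_expR_le//.
by rewrite mulr_ge0 ?exprn_ge0 ?divr_ge0 ?(ltW th0) ?(ltW p0).
Qed.

Lemma integrable_maxwellianM r w th (f : Rd -> R) K : 0 <= r -> 0 < th -> 0 <= K ->
  measurable_fun setT f -> (forall v, `|f v| <= K * (1 + enorm (v - w) ^+ 6)) ->
  has_integral mu (fun v => maxwellian r w th v * f v)
    (fine (\int[mu]_v (maxwellian r w th v * f v)%:E)).
Proof.
move=> r0 th0 K0 mf fK; have th20 : 0 < 2 * th by rewrite mulr_gt0.
apply: (has_integral_dom _ (has_integralZ K (has_integralD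
  (has_integral_maxwellian w r0 th0)
  (has_integralZ (384 * 2 `^ (d%:R / 2) * th ^+ 3) (has_integral_maxwellian w r0 th20))))).
  by apply: measurable_funM => //; exact: measurable_maxwellian.
move=> v; have M0 : 0 <= maxwellian r w th v.
  by rewrite maxwellianZ mulr_ge0// ltW// maxwellian_gt0.
rewrite normrM (ger0_norm M0); apply: (le_trans (ler_wpM2l M0 (fK v))).
rewrite mulrCA ler_wpM2l// mulrDr mulr1 lerD2l mulrC.
exact: maxwellian_sixth.
Qed.

Lemma maxwellian_sixth_le r w th b : 0 <= r -> 0 < th ->
  has_integral mu (fun v => maxwellian r w th v * enorm (v - w) ^+ 6) b ->
  b <= 384 * 2 `^ (d%:R / 2) * th ^+ 3 * r.
Proof.
move=> r0 th0 hb; have th20 : 0 < 2 * th by rewrite mulr_gt0.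
apply: (has_integral_le hb (has_integralZ (384 * 2 `^ (d%:R / 2) * th ^+ 3)
  (has_integral_maxwellian w r0 th20))) => v.
by rewrite mulrC; exact: maxwellian_sixth.
Qed.

(** Completing the square: an exponential tilt shifts the mean by [th *: e]. Integrated, this is the
    moment generating function of the Gaussian. *)
Lemma maxwellian_tilt w th e v : 0 < th ->
  maxwellian 1 w th v * expR (dotp e (v - w)) =
  expR (th * dotp e e / 2) * maxwellian 1 (w + th *: e) th v.
Proof.
move=> th0; rewrite /maxwellian -mulrA -expRD mulrCA -expRD.
congr (_ * expR _).
rewrite !enorm_sqr_rV /dotp.
rewrite (_ : \sum_i (v - (w + th *: e)) 0 i ^+ 2 =
  \sum_i (v - w) 0 i ^+ 2 - 2 * th * (\sum_i e 0 i * (v - w) 0 i)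
   + th ^+ 2 * (\sum_i e 0 i * e 0 i)).
  by field; rewrite gt_eqF.
rewrite !mulr_sumr -sumrN -!big_split/=; apply: eq_bigr => i _.
by rewrite !mxE; ring.
Qed.

Lemma has_integral_tilt w th e : 0 < th ->
  has_integral mu (fun v => maxwellian 1 w th v * expR (dotp e (v - w)))
    (expR (th * dotp e e / 2)).
Proof.
move=> th0; rewrite -[X in has_integral _ _ X]mulr1.
apply: (has_integral_eq _ (has_integralZ _ (has_integral_maxwellian (w + th *: e) ler01 th0))).
by move=> v; rewrite maxwellian_tilt.
Qed.

(** The weight turns the Gaussian into one of temperature [th / (1 + 2 l th)], so the mean is the
    ratio of the two normalizations. It is the generating function of the squared norm. *)
Lemma has_integral_scaled w th (l : R) : 0 < th -> 0 < l ->
  has_integral mu (fun v => maxwellian 1 w th v * expR (- (l * enorm (v - w) ^+ 2)))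
    ((1 + 2 * l * th) `^ (- (d%:R / 2))).
Proof.
move=> th0 l0; pose s := 1 + 2 * l * th.
have s0 : 0 < s by rewrite addr_gt0// !mulr_gt0.
have ths0 : 0 < th / s by rewrite divr_gt0.
rewrite -[X in has_integral _ _ X]mulr1.
apply: (has_integral_eq _ (has_integralZ _ (has_integral_maxwellian w ler01 ths0))).
move=> v; rewrite /maxwellian -[RHS]mulrA -expRD.
have -> : - (enorm (v - w) ^+ 2 / (2 * (th / s))) =
    - (enorm (v - w) ^+ 2 / (2 * th)) + - (l * enorm (v - w) ^+ 2).
  by rewrite /s; field; rewrite (gt_eqF th0) (gt_eqF s0).
rewrite mulrA; congr (_ * _).
have q0 : 0 < 2 * pi * th by rewrite !mulr_gt0 ?pi_gt0.
rewrite (_ : 2 * pi * (th / s) = 2 * pi * th * s^-1); last by rewrite mulrA.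
rewrite powRM ?invr_ge0 ?ltW// powRN -[s^-1]powR_inv1 ?ltW// -powRrM mulN1r powRN -/s.
by field; rewrite !gt_eqF ?powR_gt0.
Qed.

End gaussian_moments.

(** * Exact Gaussian moments of orders one to three *)

Section gaussian_low_moments.
Context {R : realType} {d : nat}.
Local Notation Rd := 'rV[R]_d.
Local Notation mu := (@rV_lebesgue R d).
Implicit Types (v e : Rd).

Lemma CauchySchwarz_sum (I : finType) (x y : I -> R) :
  (\sum_i x i * y i) ^+ 2 <= (\sum_i x i ^+ 2) * (\sum_i y i ^+ 2).
Proof.
set A := \sum_i x i ^+ 2; set C := \sum_i y i ^+ 2; set B := \sum_i x i * y i.
have C0 : 0 <= C by apply: sumr_ge0 => i _; exact: sqr_ge0.
have : 0 <= \sum_i (x i * C - y i * B) ^+ 2.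
  by apply: sumr_ge0 => i _; exact: sqr_ge0.
rewrite (_ : \sum_i _ = C * (A * C - B ^+ 2)); last first.
  transitivity (\sum_i (C ^+ 2 * (x i ^+ 2) - 2 * C * B * (x i * y i)
    + B ^+ 2 * (y i ^+ 2))); first by apply: eq_bigr => i _; ring.
  by rewrite !big_split/= sumrN -!mulr_sumr -/A -/B -/C; ring.
have [C0'|Cneq0] := eqVneq C 0; last by rewrite pmulr_rge0 ?lt0r ?Cneq0// subr_ge0.
move=> _; suff -> : B = 0 by rewrite C0' mulr0 expr0n.
rewrite /B big1// => i _; suff -> : y i = 0 by rewrite mulr0.
apply/eqP; rewrite -sqrf_eq0; apply/eqP.
by apply: (psumr_eq0P _ C0') => // j _; exact: sqr_ge0.
Qed.

Lemma dotp_sqr_le v e : dotp v e ^+ 2 <= enorm v ^+ 2 * enorm e ^+ 2.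
Proof. by rewrite !enorm_sqr_rV; exact: CauchySchwarz_sum. Qed.

Lemma dotpNl v e : dotp (- v) e = - dotp v e.
Proof. by rewrite /dotp -sumrN; apply: eq_bigr => i _; rewrite mxE mulNr. Qed.

Lemma dotpZl a v e : dotp (a *: v) e = a * dotp v e.
Proof. by rewrite /dotp mulr_sumr; apply: eq_bigr => i _; rewrite mxE mulrA. Qed.

Lemma dotpDl v1 v2 e : dotp (v1 + v2) e = dotp v1 e + dotp v2 e.
Proof. by rewrite /dotp -big_split; apply: eq_bigr => i _; rewrite mxE mulrDl. Qed.

Lemma dotpC v e : dotp v e = dotp e v.
Proof. by apply: eq_bigr => i _; rewrite mulrC. Qed.

Lemma dotp_delta i e : dotp (delta_mx 0 i) e = e 0 i.
Proof.
rewrite /dotp (bigD1 i)//= big1 ?addr0 ?mxE ?eqxx ?mul1r// => j ji.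
by rewrite mxE (negPf ji) mul0r.
Qed.

Lemma enorm_sqr_dotp v : enorm v ^+ 2 = dotp v v.
Proof. by rewrite enorm_sqr_rV /dotp; apply: eq_bigr => i _; rewrite expr2. Qed.

Lemma measurable_dotpB e w : measurable_fun setT (fun v => dotp e (v - w)).
Proof.
apply: measurable_sum => i; apply: measurable_funM => //.
under eq_fun do rewrite !mxE.
by apply: measurable_funB => //; exact: measurable_rV_coord.
Qed.

Lemma measurable_enormB w : measurable_fun setT (fun v => enorm (v - w) ^+ 2).
Proof.
under eq_fun do rewrite enorm_sqr_dotp.
apply: measurable_sum => i; under eq_fun do rewrite !mxE.
by apply: measurable_funM; apply: measurable_funB => //; exact: measurable_rV_coord.
Qed.

Variables (w : Rd) (th : R).
Hypothesis th0 : 0 < th.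
Let M := maxwellian 1 w th.
Let z e v := dotp e (v - w).
Let N v := enorm (v - w) ^+ 2.
Local Notation E f a := (has_integral mu (fun v => M v * f v) a).

Let M0 v : 0 <= M v. Proof. by rewrite ltW// maxwellian_gt0. Qed.

Let E_le f g a b : E f a -> E g b -> (forall v, f v <= g v) -> a <= b.
Proof. by move=> fa gb fg; apply: (has_integral_le fa gb) => v; rewrite ler_wpM2l. Qed.

Let ED f g a b : E f a -> E g b -> E (fun v => f v + g v) (a + b).
Proof. by move=> fa gb; apply: has_integral_eq (has_integralD fa gb) => v; rewrite mulrDr. Qed.

Let EZ k f a : E f a -> E (fun v => k * f v) (k * a).
Proof. by move=> fa; apply: has_integral_eq (has_integralZ k fa) => v; rewrite mulrCA. Qed.

Let Eeq f g a : f =1 g -> E f a -> E g a.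
Proof. by move=> fg; apply: has_integral_eq => v; rewrite fg. Qed.

Let Ecst k : E (fun=> k) k.
Proof.
rewrite -[X in has_integral _ _ X]mulr1.
apply: has_integral_eq (has_integralZ k (has_integral_maxwellian w ler01 th0)) => v.
by rewrite mulrC.
Qed.

Let Epow e k : (k <= 6)%N -> exists a, E (fun v => z e v ^+ k) a.
Proof.
move=> k6; eexists; apply: (@integrable_maxwellianM _ _ _ _ _ _ (1 + (enorm e ^+ 2) ^+ 3)) => //.
- by rewrite addr_ge0// exprn_ge0// sqr_ge0.
- by apply: measurable_funX; exact: measurable_dotpB.
move=> v; rewrite normrX; set a := `|z e v|.
have a0 : 0 <= a by exact: normr_ge0.
have ak : a ^+ k <= 1 + a ^+ 6.
  have [a1|a1] := leP a 1.
    by rewrite (le_trans (exprn_ile1 k a0 a1))// lerDl exprn_ge0.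
  by rewrite (le_trans (ler_weXn2l (ltW a1) k6))// lerDr.
apply: (le_trans ak); rewrite (exprM a 2 3) real_normK ?num_real//.
have := dotp_sqr_le e (v - w); rewrite -/(z e v) (exprM _ 2 3) => h.
have {}h : (z e v ^+ 2) ^+ 3 <= (enorm e ^+ 2) ^+ 3 * (enorm (v - w) ^+ 2) ^+ 3.
  by rewrite -exprMn; apply: lerXn2r => //; rewrite nnegrE ?sqr_ge0// mulr_ge0 ?sqr_ge0.
have e0 : 0 <= (enorm e ^+ 2) ^+ 3 by rewrite exprn_ge0 ?sqr_ge0.
have v0 : 0 <= (enorm (v - w) ^+ 2) ^+ 3 by rewrite exprn_ge0 ?sqr_ge0.
by have := mulr_ge0 e0 v0; lra.
Qed.

Let tilt (h : R) e : E (fun v => expR (h * z e v)) (expR (h ^+ 2 * (th * dotp e e) / 2)).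
Proof.
pose proof (has_integral_tilt w (h *: e) th0) as t.
rewrite (_ : th * _ / 2 = h ^+ 2 * (th * dotp e e) / 2) in t; last first.
  by rewrite dotpZl dotpC dotpZl; ring.
by apply: Eeq t => v; rewrite dotpZl.
Qed.

Let S e := th * dotp e e.
Let S0 e : 0 <= S e.
Proof. by rewrite mulr_ge0 ?(ltW th0)// -enorm_sqr_dotp sqr_ge0. Qed.

Let tilt_small (h : R) e : 0 < h -> h <= (1 + S e)^-1 ->
  0 <= h ^+ 2 * S e / 2 <= 2^-1.
Proof.
move=> h0 hS; have s1 : 0 < 1 + S e by rewrite ltr_wpDr.
have hs : h * (1 + S e) <= 1 by rewrite -ler_pdivlMr// div1r.
rewrite divr_ge0 ?(mulr_ge0 (sqr_ge0 h) (S0 e))//=.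
have : h * S e <= 1 by lra.
have : h <= 1.
  by apply: (le_trans hS); rewrite invf_le1// lerDl.
move=> h1 hS1; rewrite ler_pdivrMr// mulVf// expr2 -mulrA.
by apply: mulr_ile1 => //; [exact: ltW|rewrite mulr_ge0// ltW].
Qed.

(* E[exp (h e.(v - w))] = exp (h^2 S e / 2): the inequalities below extract its
   h and h^2 coefficients, which are the first and second moments. *)
Let first_le0 e a : E (z e) a -> a <= 0.
Proof.
move=> ea; have s1 : 0 < 1 + S e by rewrite ltr_wpDr.
apply: (@le_of_perturbation _ _ _ (1 + S e) (1 + S e)^-1); rewrite ?invr_gt0// => h h0 hS.
have /andP[q0 q1] := tilt_small h0 hS.
have [q _] := expR_le_small q0 q1.
have := E_le (ED (Ecst 1) (EZ h ea)) (tilt h e) (fun v => expR_ge1Dx _).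
rewrite -/(S e) => /le_trans/(_ q) {}q.
rewrite add0r -(ler_pM2l h0); have := S0 e; have := sqr_ge0 h; move=> ? ?.
have : h * ((1 + S e) * h) = h ^+ 2 + h ^+ 2 * S e by ring.
lra.
Qed.

Lemma gaussian_first e : E (z e) 0.
Proof.
have [a ea] := @Epow e 1 isT.
have ea' : E (z e) a by apply: Eeq ea => v; rewrite expr1.
suff <- : a = 0 by [].
apply/eqP; rewrite eq_le (first_le0 ea')/=.
rewrite -oppr_le0; apply: (@first_le0 (- e)); rewrite -mulN1r.
by apply: Eeq (EZ (-1) ea') => v; rewrite /z dotpNl mulN1r.
Qed.

(** Adding the tilts by [h] and [- h] removes the odd orders, and [expR_cosh_ge] isolates the
    coefficient of [h ^+ 2]. This gives the upper bound only; equality will follow from the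
    trace. *)
Lemma gaussian_second_le e a : E (fun v => z e v ^+ 2) a -> a <= S e.
Proof.
move=> ea; have s1 : 0 < 1 + S e by rewrite ltr_wpDr.
pose K := (1 + S e ^+ 2).
have K0 : 0 < K by rewrite ltr_wpDr ?sqr_ge0.
apply: (@le_of_perturbation _ _ _ K (1 + S e)^-1); rewrite ?invr_gt0// => h h0 hS.
have /andP[q0 q1] := tilt_small h0 hS.
have [_ q] := expR_le_small q0 q1.
have h1 : h <= 1 by apply: (le_trans hS); rewrite invf_le1// lerDl.
have t2 := tilt (- h) e.
rewrite sqrrN in t2.
have := E_le (ED (Ecst 2) (EZ (h ^+ 2) ea)) (ED (tilt h e) t2) _.
rewrite -/(S e) => t.
have {}t : 2 + h ^+ 2 * a <= expR (h ^+ 2 * S e / 2) + expR (h ^+ 2 * S e / 2).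
  by apply: t => v; have := expR_cosh_ge (h * z e v); rewrite exprMn mulNr.
have h20 : 0 < h ^+ 2 by rewrite exprn_gt0.
rewrite -(ler_pM2l h20).
have k1 : h ^+ 2 * (K * h) = h ^+ 3 + (h ^+ 3) * S e ^+ 2 by rewrite /K; ring.
have k2 : h ^+ 4 * S e ^+ 2 <= h ^+ 3 * S e ^+ 2.
  by rewrite ler_wpM2r ?sqr_ge0// exprS ler_piMl// exprn_ge0// ltW.
have := exprn_ge0 3 (ltW h0).
have k3 : 2 * (h ^+ 2 * S e / 2) ^+ 2 = h ^+ 4 * S e ^+ 2 / 2 by field.
rewrite k3 in q.
have : 0 <= h ^+ 3 * S e ^+ 2 by rewrite mulr_ge0 ?sqr_ge0// exprn_ge0// ltW.
lra.
Qed.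

(** The upper bound sums [gaussian_second_le] over the coordinates. The lower one compares
    [1 - l |v - w|^2] with [exp (- l |v - w|^2)], whose mean is known, as [l] tends to 0. *)
Lemma gaussian_sqnorm : E N (d%:R * th).
Proof.
have [a ea] : exists a, E N a.
  have /choice[a ea] := fun i => @Epow (delta_mx 0 i) 2 isT.
  exists (\sum_i a i); apply: has_integral_eq (has_integral_sum ea) => v.
  rewrite -mulr_sumr /N enorm_sqr_rV; congr (_ * _); apply: eq_bigr => i _.
  by rewrite /z dotp_delta.
have ale : a <= d%:R * th.
  have /choice[b eb] := fun i => @Epow (delta_mx 0 i) 2 isT.
  have -> : a = \sum_i b i.
    apply: has_integral_unique ea _.
    apply: has_integral_eq (has_integral_sum eb) => v.
    rewrite -mulr_sumr /N enorm_sqr_rV; congr (_ * _); apply: eq_bigr => i _.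
    by rewrite /z dotp_delta.
  apply: (@le_trans _ _ (\sum_(i < d) th)).
    apply: ler_sum => i _; apply: (le_trans (gaussian_second_le (eb i))).
    by rewrite /S dotp_delta mxE !eqxx mulr1.
  by rewrite sumr_const card_ord mulr_natl.
suff : d%:R * th <= a by move=> ha; rewrite (_ : _ * th = a)//; apply/eqP; rewrite eq_le ha.
pose K := 1 + (2 + d%:R) * th * a.
have a0 : 0 <= a.
  by apply: (has_integral_le (has_integral0 mu) ea) => v; rewrite mulr_ge0 ?sqr_ge0.
have K0 : 0 < K by rewrite ltr_wpDr// !mulr_ge0// ?addr_ge0// ltW.
apply: (@le_of_perturbation _ _ _ K 1) => // l l0 _.
have := E_le (ED (Ecst 1) (EZ (- l) ea)) (has_integral_scaled w th0 l0) _.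
move=> h; have {h} : 1 + - l * a <= (1 + 2 * l * th) `^ (- (d%:R / 2)).
  by apply: h => v; rewrite mulNr; exact: expR_ge1Dx.
have lth : 0 < l * th by rewrite mulr_gt0.
have s0 : 0 < 1 + 2 * l * th by rewrite addr_gt0// !mulr_gt0.
rewrite powRN => h.
(* Bernoulli's inequality for a real exponent: write the power as an exponential, then use
   [1 + x <= exp x] and [ln y >= 1 - 1 / y]. *)
have h2 : 1 + d%:R * l * th / (1 + 2 * l * th) <= (1 + 2 * l * th) `^ (d%:R / 2).
  rewrite /powR gt_eqF//; apply: (le_trans _ (expR_ge1Dx _)); rewrite lerD2l.
  have := ln_le_sub1 (_ : 0 < (1 + 2 * l * th)^-1); rewrite invr_gt0 => /(_ s0).
  rewrite lnV ?posrE// => hl.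
  have : 2 * l * th / (1 + 2 * l * th) <= ln (1 + 2 * l * th).
    suff : 2 * l * th / (1 + 2 * l * th) = 1 - (1 + 2 * l * th)^-1 by lra.
    by field; rewrite gt_eqF.
  have d2 : 0 <= d%:R / 2 :> R by rewrite divr_ge0.
  move=> /(ler_wpM2l d2); apply: le_trans.
  by rewrite le_eqVlt; apply/orP; left; apply/eqP; field; rewrite gt_eqF.
have p0 : 0 < (1 + 2 * l * th) `^ (d%:R / 2) by rewrite powR_gt0.
have dl0 : 0 <= d%:R * l * th by rewrite -mulrA mulr_ge0// ltW.
have h3 : 0 < 1 + d%:R * l * th / (1 + 2 * l * th).
  by rewrite ltr_wpDr// divr_ge0// ltW.
have {}h : 1 - l * a <= (1 + d%:R * l * th / (1 + 2 * l * th))^-1.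
  by rewrite -mulNr; apply: (le_trans h); rewrite lef_pV2 ?posrE.
have {}h : 1 - l * a <= (1 + 2 * l * th) / (1 + 2 * l * th + d%:R * l * th).
  apply: (le_trans h); rewrite le_eqVlt; apply/orP; left; apply/eqP.
  by field; rewrite !gt_eqF// ltr_wpDr.
have t0 : 0 < 1 + 2 * l * th + d%:R * l * th by rewrite ltr_wpDr.
move: h; rewrite ler_pdivlMr// => h.
rewrite -(ler_pM2l l0) /K; have := mulr_gt0 l0 l0; lra.
Qed.

Let y i v : R := v 0 i - w 0 i.

Let z_delta i v : z (delta_mx 0 i) v = y i v.
Proof. by rewrite /z dotp_delta !mxE. Qed.

Let S_delta i : S (delta_mx 0 i) = th.
Proof. by rewrite /S dotp_delta mxE !eqxx mulr1. Qed.

Let NE v : N v = \sum_i y i v ^+ 2.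
Proof. exact: enorm_sqrB. Qed.

(** The deficits [th - a j] are nonnegative by [gaussian_second_le], and their sum is zero by the
    trace; hence each of them vanishes. *)
Let coord_sqr i : E (fun v => y i v ^+ 2) th.
Proof.
have /choice[a ea] := fun i => @Epow (delta_mx 0 i) 2 isT.
have ath j : 0 <= th - a j.
  by rewrite subr_ge0; have := gaussian_second_le (ea j); rewrite S_delta.
have : \sum_j (th - a j) = 0.
  rewrite big_split/= sumrN sumr_const card_ord -mulr_natl.
  apply/eqP; rewrite subr_eq0; apply/eqP.
  apply: has_integral_unique gaussian_sqnorm _.
  apply: has_integral_eq (has_integral_sum ea) => v.
  by rewrite -mulr_sumr -/(N v) NE; congr (_ * _); apply: eq_bigr => j _; rewrite z_delta.
move=> /psumr_eq0P => /(_ (fun j _ => ath j))/(_ i isT)/eqP.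
rewrite subr_eq0 => /eqP ->.
by apply: has_integral_eq (ea i) => v; rewrite z_delta.
Qed.

Lemma gaussian_coord2 i j : E (fun v => y i v * y j v) (th * (i == j)%:R).
Proof.
have [->|ij] := eqVneq i j.
  by rewrite mulr1; apply: Eeq (coord_sqr j) => v; rewrite expr2.
rewrite mulr0.
(* Polarization: the second moment in the direction [e_i + c e_j] is at most [2 th], which the two
   squares already use up. Taking [c = 1] and [c = -1] squeezes the mixed moment to 0. *)
have P (c : R) : c ^+ 2 = 1 -> exists2 a, E (fun v => y i v * y j v) a & c * a <= 0.
  move=> c1; pose e := delta_mx 0 i + c *: delta_mx 0 j : Rd.
  have [b eb] := @Epow e 2 isT.
  have Se : S e = 2 * th.
    have ji : (j == i) = false by rewrite eq_sym (negPf ij).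
    rewrite /S dotpDl dotpZl !dotp_delta !mxE !eqxx/= (negPf ij) ji.
    by move: c1; rewrite expr2 => c1; rewrite mulr0 addr0 add0r mulr1 c1; ring.
  have zeE v : z e v = y i v + c * y j v by rewrite /z dotpDl dotpZl !dotp_delta !mxE.
  have := gaussian_second_le eb; rewrite Se => ble.
  have eij := ED eb (EZ (-1) (ED (coord_sqr i) (coord_sqr j))).
  exists (c / 2 * (b + -1 * (th + th))).
    apply: Eeq (EZ (c / 2) eij) => v; rewrite zeE.
    have -> : (y i v + c * y j v) ^+ 2 + -1 * (y i v ^+ 2 + y j v ^+ 2) =
      2 * c * (y i v * y j v) + (c ^+ 2 - 1) * y j v ^+ 2 by ring.
    rewrite c1 subrr mul0r addr0 (_ : c / 2 * _ = c ^+ 2 * (y i v * y j v)); last by field.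
    by rewrite c1 mul1r.
  rewrite mulrA mulrA -expr2 c1; lra.
have [a ea] := P 1 (expr1n _ _).
have [b eb] : exists2 a, E (fun v => y i v * y j v) a & -1 * a <= 0.
  by apply: P; rewrite sqrrN expr1n.
rewrite (has_integral_unique eb ea) => b0 a0.
by rewrite (_ : 0 = a)//; lra.
Qed.

Lemma gaussian_second e : E (fun v => z e v ^+ 2) (S e).
Proof.
have -> : S e = \sum_i \sum_j e 0 i * e 0 j * (th * (i == j)%:R).
  rewrite /S /dotp mulr_sumr; apply: eq_bigr => i _.
  rewrite (bigD1 i)//= eqxx big1 ?addr0 ?mulr1 1?mulrC// => j.
  by rewrite eq_sym => /negPf ->; rewrite !mulr0.
apply: has_integral_eq (has_integral_sum (fun i => has_integral_sum (fun j =>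
  has_integralZ (e 0 i * e 0 j) (gaussian_coord2 i j)))) => v.
rewrite expr2 /z {1}/dotp mulr_suml mulr_sumr; apply: eq_bigr => i _.
rewrite /dotp !mulr_sumr; apply: eq_bigr => j _.
by rewrite !mxE /y; ring.
Qed.

(** The cubic Taylor polynomial of exp is a lower bound on the whole line. The moments of lower
    order are already exact and match the tilt, so at order [h ^+ 3] only [a / 6] remains, against
    an error of order [h ^+ 4]. *)
Let third_le0 e a : E (fun v => z e v ^+ 3) a -> a <= 0.
Proof.
move=> ea; have s1 : 0 < 1 + S e by rewrite ltr_wpDr.
pose K := 3 * (1 + S e ^+ 2).
have K0 : 0 < K by rewrite mulr_gt0// ltr_wpDr ?sqr_ge0.
apply: (@le_of_perturbation _ _ _ K (1 + S e)^-1); rewrite ?invr_gt0// => h h0 hS.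
have /andP[q0 q1] := tilt_small h0 hS.
have [_ q] := expR_le_small q0 q1.
have zcst := ED (ED (ED (Ecst 1) (EZ h (gaussian_first e)))
  (EZ (h ^+ 2 / 2) (gaussian_second e))) (EZ (h ^+ 3 / 6) ea).
have := E_le zcst (tilt h e) _.
rewrite -/(S e) => t.
have {t} : 1 + h * 0 + h ^+ 2 / 2 * S e + h ^+ 3 / 6 * a <= expR (h ^+ 2 * S e / 2).
  by apply: t => v; have := expR_ge_cubic (h * z e v); rewrite !exprMn; lra.
move=> /le_trans/(_ q) {}q.
have h30 : 0 < h ^+ 3 by rewrite exprn_gt0.
rewrite -(ler_pM2l h30).
have k1 : h ^+ 3 * (K * h) = 3 * h ^+ 4 + 3 * h ^+ 4 * S e ^+ 2 by rewrite /K; ring.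
have k3 : 2 * (h ^+ 2 * S e / 2) ^+ 2 = h ^+ 4 * S e ^+ 2 / 2 by field.
have := exprn_ge0 4 (ltW h0).
lra.
Qed.

Lemma gaussian_third e : E (fun v => z e v ^+ 3) 0.
Proof.
have [a ea] := @Epow e 3 isT.
suff <- : a = 0 by [].
apply/eqP; rewrite eq_le (third_le0 ea)/=.
rewrite -oppr_le0; apply: (@third_le0 (- e)); rewrite -mulN1r.
by apply: Eeq (EZ (-1) ea) => v; rewrite /z dotpNl; ring.
Qed.

(** Polarization again: [(y_j + y_i)^3 + (y_j - y_i)^3 - 2 y_j^3 = 6 y_i^2 y_j]. *)
Lemma gaussian_sqr_coord i j : E (fun v => y i v ^+ 2 * y j v) 0.
Proof.
have ecube k : E (fun v => y k v ^+ 3) 0.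
  by apply: Eeq (gaussian_third (delta_mx 0 k)) => v; rewrite z_delta.
have [->|ij] := eqVneq i j; first by apply: Eeq (ecube j) => v; rewrite [RHS]mulrC -exprS.
have e1 := gaussian_third (delta_mx 0 j + delta_mx 0 i).
have e2 := gaussian_third (delta_mx 0 j - delta_mx 0 i).
have := EZ 6^-1 (ED (ED e1 e2) (EZ (-2) (ecube j))).
rewrite !(mulr0, addr0); apply: Eeq => v.
by rewrite /z !dotpDl dotpNl -!/(z _ _) !z_delta; field.
Qed.

Lemma gaussian_sqnorm_dotp e : E (fun v => N v * z e v) 0.
Proof.
have -> : (0 : R) = \sum_(j < d) \sum_(i < d) e 0 j * 0.
  by rewrite big1// => i _; rewrite big1// => j _; rewrite mulr0.
apply: has_integral_eq (has_integral_sum (fun j => has_integral_sum (fun i =>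
  has_integralZ (e 0 j) (gaussian_sqr_coord i j)))) => v.
rewrite NE /z /dotp !mulr_sumr; apply: eq_bigr => j _.
rewrite mulr_suml mulr_sumr; apply: eq_bigr => i _.
by rewrite !mxE /y; ring.
Qed.

End gaussian_low_moments.

(** * Fubini's theorem with real-valued slices *)

Section fubini.
Context d1 d2 (T1 : measurableType d1) (T2 : measurableType d2) (R : realType).
Variable m1 : {sigma_finite_measure set T1 -> \bar R}.
Variable m2 : {sigma_finite_measure set T2 -> \bar R}.

(** The inner integral is finite only for almost every x; [F] is its [fine] part, which keeps the
    outer integral and makes slices real-valued. *)
Lemma has_integral_fubini (f : T1 * T2 -> R) a :
  has_integral (m1 \x m2)%E f a ->
  exists2 F : T1 -> R, has_integral m1 F a &
    {ae m1, forall x, has_integral m2 (fun y => f (x, y)) (F x)}.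
Proof.
move=> [intf fa].
have intF := integrable_fubini_F intf.
have ae1 := ae_integrable1 intf.
have ae2 : {ae m1, forall x, fubini_F m2 (EFin \o f) x =
    (fine (fubini_F m2 (EFin \o f) x))%:E}.
  by apply: filterS ae1 => x /= int2; rewrite fineK//; exact: integrable_fin_num.
exists (fun x => fine (fubini_F m2 (EFin \o f) x)).
  have mF : measurable_fun setT (fun x => fine (fubini_F m2 (EFin \o f) x)).
    by apply: measurableT_comp => //; exact: measurable_int intF.
  split.
    move/integrableP: (intF) => [mF' intF']; apply/integrableP; split.
      exact/measurable_EFinP.
    apply: le_lt_trans intF'; rewrite le_eqVlt; apply/orP; left; apply/eqP.
    apply: ae_eq_integral => //.
    - by apply: measurableT_comp => //; exact/measurable_EFinP.
    - exact: measurableT_comp.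
    - by apply: filterS ae2 => x /= -> _.
  rewrite -fa -(integral12_prod_meas1 intf); apply: ae_eq_integral => //.
  - exact/measurable_EFinP.
  - exact: measurable_int intF.
  - by apply: filterS ae2 => x /= -> _.
apply: filterS2 ae1 ae2 => x int2 Fx; split=> //.
Qed.

Lemma ae_prod_section (P : T1 -> T2 -> Prop) :
  {ae (m1 \x m2)%E, forall z, P z.1 z.2} -> {ae m1, forall x, {ae m2, forall y, P x y}}.
Proof.
move=> [N [mN N0 PN]].
have mx : measurable_fun setT (m2 \o xsection N) by exact: measurable_fun_xsection.
have : (\int[m1]_x `|(m2 \o xsection N) x| = 0)%E.
  rewrite -[RHS]N0; apply: eq_integral => x _; rewrite gee0_abs//=.
move=> /(ae_eq_integral_abs _ measurableT mx)-/filterS; apply => x /(_ I)/= Nx.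
exists (xsection N x); split=> //; first exact: measurable_xsection.
by move=> y /= Pxy; rewrite /xsection/= inE; apply: PN.
Qed.

End fubini.

(** * From almost every time to every time: continuous fields *)

Section times.
Context {R : realType} {d : nat}.
Local Notation Rd := 'rV[R]_d.
Local Notation mu := (@rV_lebesgue R d).

(** The bad times form a null set, so every interval []t, min (t + e, T)[], of positive length,
    contains a good one. Approaching from the right includes [t = 0]. *)
Lemma good_times (T t : R) (P : R -> Rd -> Prop) : 0 <= t < T ->
  {ae (@lebesgue_measure R \x mu)%E, forall p, 0 < p.1 < T -> P p.1 p.2} ->
  exists t_ : nat -> R, [/\ forall n, 0 <= t_ n < T, t_ n @[n --> \oo] --> t &
    forall n, {ae mu, forall x, P (t_ n) x}].
Proof.
move=> /andP[t0 tT] /(ae_prod_section (P := fun (s : measurableTypeR R) x => 0 < (s : R) < T -> P s x)).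
move=> [N [mN N0 PN]].
have good (e : R) : 0 < e -> exists s, [/\ t < s, s < t + e, s < T & ~ N s].
  move=> e0; apply: contrapT => bad.
  pose s := Num.min (t + e) T.
  have ts : t < s by rewrite lt_min tT andbT ltrDl.
  have : (lebesgue_measure `]t, s[ <= lebesgue_measure N)%E.
    apply: le_measure; rewrite ?inE//.
    move=> x /=; rewrite in_itv/= lt_min => /and3P[tx xe xT].
    by apply: contrapT => Nx; apply: bad; exists x; split.
  by rewrite N0 lebesgue_measure_itv/= lte_fin ts -EFinD lee_fin subr_le0 leNgt ts.
have /choice[t_ t_P] : forall n : nat, exists s, [/\ t < s, s < t + n.+1%:R^-1, s < T & ~ N s].
  by move=> n; apply: good; rewrite invr_gt0.
exists t_; split.
- by move=> n; have [/ltW ts _ -> _] := t_P n; rewrite (le_trans t0 ts).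
- apply: (@squeeze_cvgr _ _ _ _ (fun=> t) (fun n => t + n.+1%:R^-1)).
  + by near=> n; have [/ltW -> /ltW -> _ _] := t_P n.
  + exact: cvg_cst.
  + rewrite -[X in _ --> X]addr0; apply: cvgD; first exact: cvg_cst.
    exact: cvg_harmonic.
- move=> n; have [ts _ sT Ns] := t_P n.
  have : {ae mu, forall x, 0 < t_ n < T -> P (t_ n) x}.
    by apply: contrapT => h; apply: Ns; apply: PN.
  by apply: filterS => x; apply; rewrite (le_lt_trans t0 ts).
Unshelve. all: by end_near. Qed.

Lemma Linfty_ae (T : R) m n (F : R -> Rd -> 'M[R]_(m, n)) (L : R) :
  (Linfty T F <= L%:E)%E ->
  {ae (@lebesgue_measure R \x mu)%E, forall p, 0 < p.1 < T -> enorm (F p.1 p.2) <= L}.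
Proof.
rewrite /Linfty unlock; case: ifPn => [_|].
  move=> /ess_supP; apply: filterS => p /= + pT.
  rewrite patchE mem_set//=.
  by rewrite lee_fin ger0_norm// enorm_ge0.
(* The norm is 0 by convention on a space of measure zero; there every property holds almost
   everywhere. *)
rewrite lt0e measure_ge0 andbT negbK => /eqP m0 _.
by exists setT; split.
Qed.

Lemma Linfty_fin (T : R) m n (F : R -> Rd -> 'M[R]_(m, n)) :
  (Linfty T F < +oo)%E -> (Linfty T F <= (fine (Linfty T F))%:E)%E.
Proof. by move=> Foo; rewrite fineK// ge0_fin_numE// Lnorm_ge0. Qed.

Lemma cvgr_sum n (f : 'I_n -> nat -> R) (l : 'I_n -> R) :
  (forall i, f i k @[k --> \oo] --> l i) ->
  (\sum_i f i k) @[k --> \oo] --> \sum_i l i.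
Proof.
elim: n f l => [|n ih] f l fl.
  by rewrite big_ord0; under eq_fun do rewrite big_ord0; exact: cvg_cst.
rewrite big_ord_recl; under eq_fun do rewrite big_ord_recl.
by apply: cvgD; [exact: fl|apply: ih => i; exact: fl].
Qed.

Definition seq_continuous (T : R) (F : R -> Rd -> R) :=
  forall (t_ : nat -> R) t x, 0 <= t < T -> (forall n, 0 <= t_ n < T) ->
  t_ n @[n --> \oo] --> t -> F (t_ n) x @[n --> \oo] --> F t x.

Lemma continuous_seq (V : normedModType R) (T : R) (F : R -> V -> R) :
  {within [set p : R * V | 0 <= p.1 < T], continuous (fun p => F p.1 p.2)} ->
  forall (t_ : nat -> R) t x, 0 <= t < T -> (forall n, 0 <= t_ n < T) ->
  t_ n @[n --> \oo] --> t -> F (t_ n) x @[n --> \oo] --> F t x.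
Proof.
move=> /subspace_continuousP cF t_ t x tT t_T t_t.
have := cF (t, x) tT; rewrite /= => Ftx.
apply: (cvg_comp (fun n => (t_ n, x)) (fun p : R * V => F p.1 p.2) _ Ftx).
have tx : (t_ n, x) @[n --> \oo] --> (t, x).
  exact: (cvg_pair t_t (cvg_cst x)).
move=> A; rewrite nbhs_filterE /within => /tx tA.
by apply: (@filterS _ \oo _ _ _ _ tA) => n /=; apply; exact: t_T.
Qed.

(** The null sets of countably many good times have a null union, off which the bound passes to the
    limit at fixed x. The squared norm is used because it is a polynomial in the entries. *)
Lemma Linfty_bound (T t : R) m n (F : R -> Rd -> 'M[R]_(m, n)) : 0 <= t < T ->
  (forall i j, seq_continuous T (fun t x => F t x i j)) ->
  (Linfty T F < +oo)%E ->
  {ae mu, forall x, enorm (F t x) <= fine (Linfty T F)}.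
Proof.
move=> tT cF /Linfty_fin/Linfty_ae/(good_times (P := fun s x => enorm (F s x) <= _) tT).
move=> [t_ [t_T t_t aeF]].
have {}aeF : {ae mu, forall x n, enorm (F (t_ n) x) <= fine (Linfty T F)}.
  exact: ae_foralln.
apply: filterS aeF => x Fx; set L := fine _ in Fx *.
have L0 : 0 <= L by apply: le_trans (Fx 0); exact: enorm_ge0.
rewrite -(@ler_pXn2r _ 2) ?nnegrE ?enorm_ge0// enorm_sqrE.
have c : (\sum_i \sum_j F (t_ n) x i j ^+ 2) @[n --> \oo] -->
    (\sum_i \sum_j F t x i j ^+ 2).
  apply: cvgr_sum => i; apply: cvgr_sum => j.
  by rewrite expr2; under eq_fun do rewrite expr2; apply: cvgM; exact: cF.
apply: (cvgr_to_le c); near=> k.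
by rewrite -enorm_sqrE (@ler_pXn2r _ 2) ?nnegrE ?enorm_ge0.
Unshelve. all: by end_near. Qed.

End times.

(** * Macroscopic fields of a density with finite sixth moment *)

Section macroscopic_fields.
Context {R : realType} {d : nat}.
Local Notation Rd := 'rV[R]_d.
Local Notation mu := (@rV_lebesgue R d).
Implicit Types v : Rd.

Lemma measurable_enorm6 : measurable_fun setT (fun v : Rd => enorm v ^+ 6).
Proof.
under eq_fun do rewrite (exprM _ 2 3) -[X in enorm X]subr0.
by apply: measurable_funX; exact: (@measurable_enormB _ _ 0).
Qed.

Lemma coord_sqr_le v i : v 0 i ^+ 2 <= enorm v ^+ 2.
Proof.
by rewrite enorm_sqr_rV (bigD1 i)//= lerDl sumr_ge0// => j _; exact: sqr_ge0.
Qed.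

Lemma norm_coord_le v i : `|v 0 i| <= enorm v.
Proof.
by rewrite -(@ler_pXn2r _ 2) ?nnegrE ?enorm_ge0// real_normK ?num_real ?coord_sqr_le.
Qed.

Lemma le1_exprn6 (x : R) k : (k <= 6)%N -> 0 <= x -> x ^+ k <= 1 + x ^+ 6.
Proof.
move=> k6 x0; have [x1|x1] := leP x 1.
  by rewrite (le_trans (exprn_ile1 k x0 x1))// lerDl exprn_ge0.
by rewrite (le_trans (ler_weXn2l (ltW x1) k6))// lerDr.
Qed.

Variables (g : Rd -> R) (m : R).
Hypotheses (mg : measurable_fun setT g) (g0 : forall v, 0 <= g v).
Hypothesis gm : has_integral mu (fun v => (1 + enorm v ^+ 6) * g v) m.

Lemma sixth_integrable (p : Rd -> R) K : measurable_fun setT p ->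
  (forall v, `|p v| <= K * (1 + enorm v ^+ 6)) ->
  has_integral mu (fun v => p v * g v) (fine (\int[mu]_v (p v * g v)%:E)).
Proof.
move=> mp pK; apply: (has_integral_dom _ (has_integralZ K gm)) => [|v].
  exact: measurable_funM.
by rewrite normrM (ger0_norm (g0 v)) mulrA ler_wpM2r.
Qed.

Lemma density_has_integral : has_integral mu g (density g).
Proof.
have m1 : measurable_fun setT (fun _ : Rd => 1 : R) by [].
have h1 v : `|1| <= 1 * (1 + enorm v ^+ 6).
  by rewrite mul1r normr1 lerDl exprn_ge0// enorm_ge0.
have := sixth_integrable m1 h1.
by under [X in has_integral _ X]eq_fun do rewrite mul1r;
  under eq_integral do rewrite mul1r.
Qed.

Lemma velocity_has_integral i : 0 < density g ->
  has_integral mu (fun v => v 0 i * g v) (density g * velocity g 0 i).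
Proof.
move=> n0; rewrite /velocity n0 !mxE mulVKf ?gt_eqF//.
apply: (@sixth_integrable _ 1); first exact: measurable_rV_coord.
move=> v; rewrite mul1r; apply: (le_trans (norm_coord_le v i)).
by have := @le1_exprn6 (enorm v) 1 isT (enorm_ge0 v); rewrite expr1.
Qed.

Lemma temperature_has_integral : (0 < d)%N -> 0 < density g ->
  has_integral mu (fun v => enorm (v - velocity g) ^+ 2 * g v)
    (d%:R * density g * temperature g).
Proof.
move=> d0 n0; rewrite /temperature n0 mulVKf; last first.
  by rewrite mulf_neq0 ?gt_eqF// ltr0n.
set a := velocity g.
apply: (@sixth_integrable _ (2 * (1 + enorm a ^+ 2))); first exact: measurable_enormB.
move=> v; rewrite ger0_norm ?sqr_ge0//.
have h2 : enorm (v - a) ^+ 2 <= 2 * enorm v ^+ 2 + 2 * enorm a ^+ 2.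
  rewrite enorm_sqrB !enorm_sqr_rV !mulr_sumr -big_split/= ler_sum// => i _.
  have := sqr_ge0 (v 0 i + a 0 i); lra.
have := @le1_exprn6 (enorm v) 2 isT (enorm_ge0 v).
have := mulr_ge0 (sqr_ge0 (enorm a)) (exprn_ge0 6 (enorm_ge0 v)).
lra.
Qed.

Lemma density_ge0 : 0 <= density g.
Proof. exact: (has_integral_le (has_integral0 mu) density_has_integral). Qed.

Lemma density0_ae : density g = 0 -> {ae mu, forall v, g v = 0}.
Proof.
move=> n0; apply: ge0_has_integral_eq0 => //; rewrite -n0.
exact: density_has_integral.
Qed.

(** For positive density this is the definition of the velocity; in vacuum [g] vanishes almost
    everywhere and both sides are 0. *)
Lemma has_integral_velocity i c : has_integral mu (fun v => v 0 i * g v) c ->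
  c = density g * velocity g 0 i.
Proof.
have := density_ge0; rewrite le_eqVlt => /predU1P[n0|n0] hc; last first.
  exact: has_integral_unique hc (velocity_has_integral i n0).
rewrite -n0 mul0r; apply: has_integral_unique hc _.
apply: ae_eq_has_integral (has_integral0 mu).
  by apply: measurable_funM => //; exact: measurable_rV_coord.
by apply: filterS (density0_ae (esym n0)) => v ->; rewrite mulr0.
Qed.

End macroscopic_fields.

(** * The velocity bound at every time *)

Section velocity_bound.
Context {R : realType} {d : nat}.
Local Notation Rd := 'rV[R]_d.
Local Notation mu := (@rV_lebesgue R d).
Local Notation phase := (@phase_measure R d).

Lemma continuous_at_time (V : normedModType R) (T : R) (F : R -> V -> R) t :
  {within [set p : R * V | 0 <= p.1 < T], continuous (fun p => F p.1 p.2)} ->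
  0 <= t < T -> continuous (F t).
Proof.
move=> /subspace_continuousP cF tT z.
have := cF (t, z) tT; rewrite /= => Ftx.
apply: (cvg_comp (fun y => (t, y)) (fun p : R * V => F p.1 p.2) _ Ftx).
have tz : (t, y) @[y --> z] --> (t, z) by exact: (cvg_pair (cvg_cst t) cvg_id).
move=> A; rewrite nbhs_filterE /within => /tz tA.
by apply: (@filterS _ (nbhs z) _ _ _ _ tA) => y /=; apply.
Qed.

Lemma smooth_measurable (T : R) (F : R -> (Rd * Rd)%type -> R) t :
  smooth T F -> 0 <= t < T -> measurable_fun setT (F t).
Proof.
move=> sF tT; apply: continuous_measurable_rV2.
exact: (continuous_at_time (smooth_continuous sF) tT).
Qed.

Lemma limn_einf_le (u : nat -> \bar R) (c : \bar R) :
  (forall n, u n <= c)%E -> (limn_einf u <= c)%E.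
Proof.
move=> uc; rewrite limn_einf_lim; apply: lime_le.
  exact: is_cvg_einfs.
apply: nearW => n; apply: le_trans (uc n); apply: ereal_inf_lbound.
by exists n => //=.
Qed.

Variables (T A U : R) (g : R -> Rd -> Rd -> R).
Hypothesis sg : smooth T (fun t (z : Rd * Rd) => g t z.1 z.2).
Hypothesis g0 : forall t x v, 0 <= t < T -> 0 <= g t x v.
Hypothesis g1 : forall t, 0 <= t < T -> (\int[phase]_z (g t z.1 z.2)%:E = 1)%E.
Hypothesis gA : forall t, 0 <= t < T ->
  (\int[phase]_z (enorm z.2 ^+ 6 * g t z.1 z.2)%:E <= A%:E)%E.

Lemma phase_mass t : 0 <= t < T ->
  has_integral phase (fun z => g t z.1 z.2) 1.
Proof.
move=> tT; apply: ge0_has_integral; [exact: (smooth_measurable sg tT)| |exact: g1].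
by move=> z; exact: g0.
Qed.

Lemma phase_sixth t : 0 <= t < T -> exists2 c, c <= A &
  has_integral phase (fun z => enorm z.2 ^+ 6 * g t z.1 z.2) c.
Proof.
move=> tT; have c0 : (0 <= \int[phase]_z (enorm z.2 ^+ 6 * g t z.1 z.2)%:E)%E.
  apply: integral_ge0 => z _; rewrite lee_fin mulr_ge0 ?g0//.
  by rewrite exprn_ge0// enorm_ge0.
have cfin : (\int[phase]_z (enorm z.2 ^+ 6 * g t z.1 z.2)%:E)%E \is a fin_num.
  by rewrite ge0_fin_numE// (le_lt_trans (gA tT))// ltry.
exists (fine (\int[phase]_z (enorm z.2 ^+ 6 * g t z.1 z.2)%:E)).
  by rewrite -lee_fin fineK// gA.
apply: ge0_has_integral; last by rewrite fineK.
  apply: measurable_funM; last exact: (smooth_measurable sg tT).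
  exact: (measurableT_comp measurable_enorm6 measurable_snd).
by move=> z; rewrite mulr_ge0 ?g0// exprn_ge0// enorm_ge0.
Qed.

Lemma ae_sixth t : 0 <= t < T ->
  {ae mu, forall x, exists m, has_integral mu (fun v => (1 + enorm v ^+ 6) * g t x v) m}.
Proof.
move=> tT; have [c _ hc] := phase_sixth tT.
have [F _ aeF] := has_integral_fubini (has_integralD (phase_mass tT) hc).
apply: filterS aeF => x Fx; exists (F x); apply: has_integral_eq Fx => v /=.
by rewrite mulrDl mul1r.
Qed.

Lemma measurable_slice t x : 0 <= t < T -> measurable_fun setT (g t x).
Proof.
move=> tT.
exact: (measurableT_comp (smooth_measurable sg tT) (pair1_measurable x)).
Qed.

Lemma phase_integrable t (p : Rd * Rd -> R) K : 0 <= t < T ->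
  measurable_fun setT p -> (forall z, `|p z| <= K * (1 + enorm z.2 ^+ 6)) ->
  exists c, has_integral phase (fun z => p z * g t z.1 z.2) c.
Proof.
move=> tT mp pK; have [c _ hc] := phase_sixth tT.
eexists; apply: (has_integral_dom _ (has_integralZ K (has_integralD (phase_mass tT) hc))).
  by apply: measurable_funM => //; exact: (smooth_measurable sg tT).
move=> z; rewrite normrM (ger0_norm (g0 _ _ tT)).
have -> : K * (g t z.1 z.2 + enorm z.2 ^+ 6 * g t z.1 z.2) =
  K * (1 + enorm z.2 ^+ 6) * g t z.1 z.2 by ring.
by rewrite ler_wpM2r// g0.
Qed.

Hypothesis U0 : 0 < U.

(** Integrated against [g] it gives [\int_B rho (U + sgn u_i)]. Signs for all [B] encode the bound
    on the velocity by inequalities linear in [g], without the quotient by the density. *)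
Definition flux_weight (sgn : R) (i : 'I_d) (B : set Rd) (z : Rd * Rd) : R :=
  \1_B z.1 * (U + sgn * z.2 0 i).

Section flux.
Variables (sgn : R) (i : 'I_d) (B : set Rd).
Hypotheses (sgn1 : `|sgn| = 1) (mB : measurable B).
Local Notation p := (flux_weight sgn i B).

Let mp : measurable_fun setT p.
Proof.
apply: measurable_funM.
  exact: (measurableT_comp (measurable_indic mB) measurable_fst).
apply: measurable_funD => //; apply: measurable_funM => //.
exact: (measurableT_comp (measurable_rV_coord i) measurable_snd).
Qed.

Let p_le z : `|p z| <= U + enorm z.2.
Proof.
rewrite normrM/=; apply: (@le_trans _ _ (1 * `|U + sgn * z.2 0 i|)).
  by rewrite ler_wpM2r// indicE; case: (_ \in _); rewrite ?normr1 ?normr0.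
rewrite mul1r; have := ler_normD U (sgn * z.2 0 i).
rewrite normrM sgn1 mul1r (gtr0_norm U0).
by have := norm_coord_le z.2 i; lra.
Qed.

Lemma flux_integrable t : 0 <= t < T -> exists c, has_integral phase (fun z => p z * g t z.1 z.2) c.
Proof.
move=> tT; apply: (phase_integrable (K := U + 1) tT mp) => z.
have := @le1_exprn6 _ (enorm z.2) 1 isT (enorm_ge0 _); rewrite expr1.
have := mulr_ge0 (ltW U0) (exprn_ge0 6 (enorm_ge0 z.2)).
by have := p_le z; lra.
Qed.

Lemma flux_slice t : 0 <= t < T -> {ae mu, forall x, forall a,
  has_integral mu (fun v => p (x, v) * g t x v) a ->
  a = \1_B x * (density (g t x) * (U + sgn * velocity (g t x) 0 i))}.
Proof.
move=> tT; apply: filterS (ae_sixth tT) => x [m hm] a ha.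
have mgx := measurable_slice x tT.
have gx0 v : 0 <= g t x v by exact: g0.
have hv1 (v : Rd) : `|v 0 i| <= 1 * (1 + enorm v ^+ 6).
  rewrite mul1r (le_trans (norm_coord_le v i))//.
  by have := @le1_exprn6 _ (enorm v) 1 isT (enorm_ge0 v); rewrite expr1.
have hv := sixth_integrable (p := fun v : Rd => v 0 i) mgx gx0 hm
  (@measurable_rV_coord R d i) hv1.
have hvE := has_integral_velocity mgx gx0 hm hv; rewrite hvE in hv.
apply: has_integral_unique ha _.
rewrite (_ : density _ * _ =
    U * density (g t x) + sgn * (density (g t x) * velocity (g t x) 0 i)); last by ring.
apply: has_integral_eq (has_integralZ (\1_B x : R) (has_integralD
  (has_integralZ U (density_has_integral mgx gx0 hm)) (has_integralZ sgn hv))) => v.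
by rewrite /flux_weight /=; ring.
Qed.

Let flux_good_time t c : 0 <= t < T ->
  {ae mu, forall x, enorm (velocity (g t x)) <= U} ->
  has_integral phase (fun z => p z * g t z.1 z.2) c -> 0 <= c.
Proof.
move=> tT velU /has_integral_fubini[F hF aeF].
apply: (ae_has_integral_le (has_integral0 mu) hF).
apply: filterS3 (ae_sixth tT) velU (filterI (flux_slice tT) aeF) => x [m hm] vel_le [Fslice Fx].
rewrite (Fslice _ Fx) mulr_ge0// mulr_ge0//.
  exact: density_ge0 (measurable_slice x tT) (fun v => g0 _ _ tT) hm.
have : `|sgn * velocity (g t x) 0 i| <= U.
  by rewrite normrM sgn1 mul1r (le_trans (norm_coord_le _ _)).
by rewrite ler_norml; lra.
Qed.

(* The bound on the velocity only holds at almost every time; Fatou's lemma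
   along a sequence of such times, for the nonnegative weights
   U + h^-1 + h^5 |v|^6 - p, gives it at t up to an error O(h). *)
Lemma flux_ge0 t c : 0 <= t < T ->
  (exists t_ : nat -> R, [/\ forall n, 0 <= t_ n < T, t_ n @[n --> \oo] --> t &
    forall n, {ae mu, forall x, enorm (velocity (g (t_ n) x)) <= U}]) ->
  has_integral phase (fun z => p z * g t z.1 z.2) c -> 0 <= c.
Proof.
move=> tT [t_ [t_T t_t vel_le]] hc.
have A1 : 0 < `|A| + 1 by rewrite ltr_wpDl.
apply: (@le_of_perturbation _ _ _ (`|A| + 1) 1) => // h h0 h1.
pose psi z := U + h^-1 + h ^+ 5 * enorm z.2 ^+ 6 - p z.
have psi0 z : 0 <= psi z.
  have e0 := enorm_ge0 z.2.
  (* This is [h |v| <= 1 + (h |v|)^6] divided by [h]. *)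
  have : enorm z.2 <= h^-1 + h ^+ 5 * enorm z.2 ^+ 6.
    have := @le1_exprn6 _ (h * enorm z.2) 1 isT (mulr_ge0 (ltW h0) e0).
    rewrite expr1 -(ler_pM2l (_ : 0 < h^-1)) ?invr_gt0// mulKf ?gt_eqF//.
    rewrite exprMn exprS mulrDr mulr1 -!mulrA mulKf ?gt_eqF//.
  have := p_le z; have := ler_norm (p z); rewrite /psi; lra.
have psi_int s : 0 <= s < T -> exists m a, [/\ 0 <= m <= A,
    has_integral phase (fun z => p z * g s z.1 z.2) a &
    has_integral phase (fun z => psi z * g s z.1 z.2) (U + h^-1 + h ^+ 5 * m - a)].
  move=> sT; have [m mA hm] := phase_sixth sT; have [a ha] := flux_integrable sT.
  exists m, a; split=> //.
    rewrite mA andbT; apply: (has_integral_le (has_integral0 phase) hm) => z.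
    by rewrite mulr_ge0 ?g0// exprn_ge0// enorm_ge0.
  have := has_integralB (has_integralD (has_integralZ (U + h^-1) (phase_mass sT))
    (has_integralZ (h ^+ 5) hm)) ha.
  rewrite mulr1; apply: has_integral_eq => z; rewrite /psi; ring.
have h5 : 0 <= h ^+ 5 by rewrite exprn_ge0// ltW.
have bound n : (\int[phase]_z (psi z * g (t_ n) z.1 z.2)%:E <= (U + h^-1 + h ^+ 5 * A)%:E)%E.
  have [m [a [/andP[_ mA] ha [_ ->]]]] := psi_int _ (t_T n).
  rewrite lee_fin; have := flux_good_time (t_T n) (vel_le n) ha.
  have := ler_wpM2l h5 mA; lra.
have [m [a [/andP[m0 _] ha [_ it]]]] := psi_int _ tT.
have mpsi s : 0 <= s < T -> measurable_fun setT (fun z => (psi z * g s z.1 z.2)%:E).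
  move=> sT; have [m' [a' [_ _ [hh _]]]] := psi_int _ sT; exact: measurable_int hh.
have fat := @fatou _ _ _ phase setT measurableT (fun n z => (psi z * g (t_ n) z.1 z.2)%:E)
   (fun n => mpsi _ (t_T n)) _.
(* The mass is 1 at every time, so the large constant [U + h^-1] is the same on both sides and
   cancels; only the sixth moments, of size [h ^+ 5], can be lost in the limit. *)
have {}fat : (U + h^-1 + h ^+ 5 * m - a <= U + h^-1 + h ^+ 5 * A).
  rewrite -lee_fin -it; apply: le_trans (limn_einf_le bound).
  have -> : (\int[phase]_z (psi z * g t z.1 z.2)%:E)%E =
    (\int[phase]_z limn_einf (fun n => (psi z * g (t_ n) z.1 z.2)%:E))%E.
    apply: eq_integral => z _; apply/esym.
    have gz : g (t_ n) z.1 z.2 @[n --> \oo] --> g t z.1 z.2.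
      exact: (continuous_seq (x := z) (smooth_continuous sg) tT t_T t_t).
    have cz : (psi z * g (t_ n) z.1 z.2)%:E @[n --> \oo] --> (psi z * g t z.1 z.2)%:E.
      by apply: cvg_EFin; [exact: nearW|apply: cvgM; [exact: cvg_cst|exact: gz]].
    by have [-> _] := cvg_limn_einf_sup cz.
  by apply: fat => n z _; rewrite lee_fin mulr_ge0// g0.
rewrite (has_integral_unique hc ha).
have hA : h ^+ 5 * A <= h * (`|A| + 1).
  apply: (@le_trans _ _ (h ^+ 5 * `|A|)); first by rewrite ler_wpM2l// ler_norm.
  apply: ler_pM => //; last by rewrite lerDl.
  by rewrite exprS ler_piMr ?(ltW h0)// exprn_ile1// ltW.
have := mulr_ge0 h5 m0; lra.
Qed.

End flux.

Let flux_density_ge0 (sgn : R) (i : 'I_d) t : `|sgn| = 1 -> 0 <= t < T ->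
  (exists t_ : nat -> R, [/\ forall n, 0 <= t_ n < T, t_ n @[n --> \oo] --> t &
    forall n, {ae mu, forall x, enorm (velocity (g (t_ n) x)) <= U}]) ->
  {ae mu, forall x, 0 <= density (g t x) * (U + sgn * velocity (g t x) 0 i)}.
Proof.
move=> sgn1 tT good.
have [c hc] := flux_integrable i sgn1 measurableT tT.
have [F hF aeF] := has_integral_fubini hc.
(* The test set is where the flux is negative; a nonnegative integral over it forces it to be
   null. *)
pose B := F @^-1` `]-oo, 0[%classic.
have mB : measurable B.
  rewrite -[B]setTI; apply: (has_integral_measurable hF) => //.
have [cB hcB] := flux_integrable i sgn1 mB tT.
have cB0 := flux_ge0 sgn1 mB tT good hcB.
have [FB hFB aeFB] := has_integral_fubini hcB.
have sB := flux_slice sgn i B tT; have sT := flux_slice sgn i setT tT.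
have FBE : {ae mu, forall x, FB x = \1_B x * F x}.
  apply: filterS2 (filterI aeF aeFB) (filterI sT sB) => x [Fx FBx] [sTx sBx].
  by rewrite (sBx _ FBx) (sTx _ Fx) indicT mul1r.
have FB0 : {ae mu, forall x, FB x = 0}.
  apply: (ae_le0_has_integral hFB cB0); apply: filterS FBE => x ->.
  rewrite indicE; have [/set_mem|_] := boolP (x \in B); last by rewrite mul0r.
  by rewrite /B/= in_itv/= mul1r => /ltW.
apply: filterS2 (filterI FBE FB0) (filterI aeF sT) => x [FBx FB0x] [Fx sTx].
have := sTx _ Fx; rewrite indicT mul1r => <-; rewrite leNgt; apply/negP => Fx0.
move: FB0x; rewrite FBx indicE mem_set ?mul1r; last by rewrite /B/= in_itv.
by move=> Fx00; rewrite Fx00 ltxx in Fx0.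
Qed.

(** Coordinatewise rather than in Euclidean norm, since each flux weight tests one direction; this
    later costs a factor [d] in the bound on the velocity. *)
Lemma velocity_coord_le t :
  (Linfty T (fun t x => velocity (g t x)) <= U%:E)%E -> 0 <= t < T ->
  {ae mu, forall x i, `|velocity (g t x) 0 i| <= U}.
Proof.
move=> /Linfty_ae velU tT.
have good := good_times (P := fun t x => enorm (velocity (g t x)) <= U) tT velU.
(* The coordinate is indexed by a natural number [k] so that a countable intersection of sets of
   full measure applies. *)
have ae_i (sgn : R) : `|sgn| = 1 -> {ae mu, forall x (k : nat) (i : 'I_d),
    i = k :> nat -> 0 <= density (g t x) * (U + sgn * velocity (g t x) 0 i)}.
  move=> sgn1; apply: ae_foralln => k; have [kd|kd] := leqP d k.
    by apply: aeW => x i ik; have := ltn_ord i; rewrite ik ltnNge kd.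
  apply: filterS (flux_density_ge0 (Ordinal kd) sgn1 tT good) => x hx i ik.
  by rewrite (_ : i = Ordinal kd)//; exact: val_inj.
have aep := ae_i 1 (normr1 _); have aem := ae_i (-1) (normrN1 _).
apply: filterS2 aep aem => x hp hm i.
rewrite {1}/velocity; case: ifPn => [n0|_]; last by rewrite mxE normr0 ltW.
have := hp i i erefl; have := hm i i erefl.
rewrite !pmulr_rge0// /velocity n0 ler_norml; lra.
Qed.

End velocity_bound.

(** * Growth of the transport polynomial *)

Section transport_poly_bounds.
Context {R : realType} {d : nat}.
Local Notation Rd := 'rV[R]_d.
Local Notation mu := (@rV_lebesgue R d).
Implicit Types (v e a u b : Rd) (G : 'M[R]_d).

Definition mx_form G v : R := \sum_i \sum_j G i j * v 0 i * v 0 j.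

Lemma mx_form_sqr_le G v : mx_form G v ^+ 2 <= enorm G ^+ 2 * (enorm v ^+ 2) ^+ 2.
Proof.
rewrite /mx_form pair_big/=.
pose x (p : 'I_d * 'I_d) := G p.1 p.2; pose y (p : 'I_d * 'I_d) := v 0 p.1 * v 0 p.2.
rewrite (eq_bigr (fun p => x p * y p)); last by move=> p _; rewrite /x /y mulrA.
apply: (le_trans (CauchySchwarz_sum x y)).
rewrite !enorm_sqrE big_ord1 pair_big/= ler_wpM2l ?sumr_ge0//.
  by move=> p _; exact: sqr_ge0.
rewrite expr2 mulr_suml [leRHS](_ : _ = \sum_i \sum_j v 0 i ^+ 2 * v 0 j ^+ 2).
  by rewrite pair_big/= ler_sum// => p _; rewrite /y exprMn.
by apply: eq_bigr => i _; rewrite mulr_sumr.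
Qed.

Lemma mxtrace_sqr_le G : (\sum_i G i i) ^+ 2 <= d%:R * enorm G ^+ 2.
Proof.
pose o (i : 'I_d) : R := 1.
rewrite (eq_bigr (fun i => o i * G i i)); last by move=> i _; rewrite /o mul1r.
apply: (le_trans (CauchySchwarz_sum o _)).
rewrite /o expr1n sumr_const card_ord ler_wpM2l// enorm_sqrE ler_sum// => i _.
by rewrite (bigD1 i)//= lerDl sumr_ge0// => j _; exact: sqr_ge0.
Qed.

(** [32 = 2^3 * 4]: first [|x + y|^2 <= 2 |x|^2 + 2 |y|^2], then [(p + q)^3 <= 4 (p^3 + q^3)] for
    nonnegative p and q. *)
Lemma enormB_sixth_le v a u :
  enorm (v - u) ^+ 6 <= 32 * enorm (v - a) ^+ 6 + 32 * enorm (a - u) ^+ 6.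
Proof.
have h2 : enorm (v - u) ^+ 2 <= 2 * enorm (v - a) ^+ 2 + 2 * enorm (a - u) ^+ 2.
  rewrite !enorm_sqrB !mulr_sumr -big_split/= ler_sum// => i _.
  have := sqr_ge0 ((v 0 i - a 0 i) - (a 0 i - u 0 i)); lra.
rewrite !(exprM _ 2 3); set x := enorm _ ^+ 2 in h2 *; set y := enorm _ ^+ 2 in h2 *.
set z := enorm _ ^+ 2 in h2 *.
have x0 : 0 <= x by exact: sqr_ge0. have y0 : 0 <= y by exact: sqr_ge0.
have z0 : 0 <= z by exact: sqr_ge0.
have : x ^+ 3 <= (2 * y + 2 * z) ^+ 3.
  by apply: lerXn2r => //; rewrite nnegrE// addr_ge0// mulr_ge0.
move=> /le_trans; apply.
have : 0 <= (y - z) ^+ 2 * (y + z) by rewrite mulr_ge0 ?sqr_ge0// addr_ge0.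
lra.
Qed.

Variables (u : Rd) (th : R) (G : 'M[R]_d) (b : Rd) (thlo V L1 L2 : R).
Hypotheses (d0 : (0 < d)%N) (thlo0 : 0 < thlo) (thlo_le : thlo <= th).
Hypotheses (uV : enorm u <= V) (GL1 : enorm G <= L1) (bL2 : enorm b <= L2).
Let Q := transport_poly u th G b.

Let th0 : 0 < th. Proof. exact: lt_le_trans thlo_le. Qed.
Let dR : 1 <= d%:R :> R. Proof. by rewrite ler1n. Qed.

Let sqr_le_bound (x y : R) : 0 <= x -> x <= y -> x ^+ 2 <= y ^+ 2.
Proof. by move=> x0 xy; rewrite lerXn2r ?nnegrE// (le_trans x0). Qed.

(** The factor 3 comes from squaring a sum of three terms. The velocity gradient and its trace
    contribute [(L1 / thlo)^2] each, the term in [grad (log theta)] the rest; powers of [|v - u|]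
    below six are absorbed in [1 + |v - u|^6]. *)
Definition transport_sqr_bound : R :=
  3 * (2 * (L1 / thlo) ^+ 2
       + 2 * (2 * L2 ^+ 2 * ((2 * thlo)^-1 ^+ 2 + ((d%:R + 2) / 2) ^+ 2))).

Lemma transport_sqr_bound_ge0 : 0 <= transport_sqr_bound.
Proof.
have := mulr_ge0 (sqr_ge0 L2)
  (addr_ge0 (sqr_ge0 (2 * thlo)^-1) (sqr_ge0 ((d%:R + 2) / 2))).
by have := sqr_ge0 (L1 / thlo); rewrite /transport_sqr_bound; lra.
Qed.

Lemma transport_poly_sqr_le v :
  Q v ^+ 2 <= transport_sqr_bound * (1 + enorm (v - u) ^+ 6).
Proof.
pose q := enorm (v - u) ^+ 2; have q0 : 0 <= q by exact: sqr_ge0.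
pose a1 := mx_form G (v - u) / th.
pose a2 := q / (d%:R * th) * \sum_i G i i.
pose a3 := (q / (2 * th) - (d%:R + 2) / 2) * dotp (v - u) b.
have QE : Q v = a1 - a2 + a3.
  rewrite /Q /transport_poly /a1 /a2 /a3 /q enorm_sqrB; congr (_ / _ - _ + _ * _).
  - by apply: eq_bigr => i _; apply: eq_bigr => j _; rewrite !mxE.
  - by apply: eq_bigr => i _; rewrite !mxE.
have l1 : enorm G ^+ 2 <= L1 ^+ 2 by apply: sqr_le_bound => //; exact: enorm_ge0.
have l2 : enorm b ^+ 2 <= L2 ^+ 2 by apply: sqr_le_bound => //; exact: enorm_ge0.
have iv : th^-1 <= thlo^-1 by rewrite lef_pV2 ?posrE.
have iv0 : 0 <= th^-1 by rewrite invr_ge0 ltW.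
have iv2 : th^-1 ^+ 2 <= thlo^-1 ^+ 2 by exact: sqr_le_bound.
have h1 : a1 ^+ 2 <= (L1 / thlo) ^+ 2 * q ^+ 2.
  rewrite /a1 !exprMn (mulrAC (L1 ^+ 2)); apply: ler_pM => //; rewrite ?sqr_ge0//.
  by apply: (le_trans (mx_form_sqr_le _ _)); rewrite ler_wpM2r ?sqr_ge0.
have h2 : a2 ^+ 2 <= (L1 / thlo) ^+ 2 * q ^+ 2.
  have -> : a2 = (\sum_i G i i) / d%:R * th^-1 * q.
    by rewrite /a2; field; rewrite !gt_eqF// (lt_le_trans _ dR).
  rewrite !exprMn ler_wpM2r ?sqr_ge0//.
  apply: ler_pM; [by rewrite mulr_ge0 ?sqr_ge0|exact: sqr_ge0| |exact: iv2].
  rewrite exprVn ler_pdivrMr; last by rewrite exprn_gt0// (lt_le_trans _ dR).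
  apply: (le_trans (mxtrace_sqr_le G)); rewrite mulrC ler_pM ?sqr_ge0//.
  by rewrite expr2 ler_peMl// (le_trans _ dR).
have h3 : a3 ^+ 2 <= 2 * L2 ^+ 2 * ((2 * thlo)^-1 ^+ 2 + ((d%:R + 2) / 2) ^+ 2) * (q ^+ 3 + q).
  have c3 : dotp (v - u) b ^+ 2 <= q * L2 ^+ 2.
    by apply: (le_trans (dotp_sqr_le _ _)); rewrite ler_wpM2l.
  have c4 : (q / (2 * th) - (d%:R + 2) / 2) ^+ 2 <=
      2 * ((2 * thlo)^-1 ^+ 2 * q ^+ 2 + ((d%:R + 2) / 2) ^+ 2).
    have : (q / (2 * th)) ^+ 2 <= (2 * thlo)^-1 ^+ 2 * q ^+ 2.
      rewrite exprMn mulrC ler_wpM2r ?sqr_ge0// !invfM !exprMn ler_wpM2l ?sqr_ge0//.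
    by have := sqr_ge0 (q / (2 * th) + (d%:R + 2) / 2); lra.
  rewrite /a3 exprMn; apply: (le_trans (ler_pM _ _ c4 c3)); rewrite ?sqr_ge0//.
  set k1 := (2 * thlo)^-1 ^+ 2; set k2 := ((d%:R + 2) / 2) ^+ 2.
  have k10 : 0 <= k1 by exact: sqr_ge0. have k20 : 0 <= k2 by exact: sqr_ge0.
  have ll : 0 <= L2 ^+ 2 by exact: sqr_ge0.
  have p1 := mulr_ge0 (mulr_ge0 k10 q0) ll.
  have p2 := mulr_ge0 (mulr_ge0 k20 (exprn_ge0 3 q0)) ll.
  lra.
have q2 : q ^+ 2 <= 1 + q ^+ 3.
  have [q1|q1] := leP q 1.
    by rewrite (le_trans (exprn_ile1 2 q0 q1))// lerDl exprn_ge0.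
  by rewrite (le_trans (ler_weXn2l (ltW q1) (_ : 2 <= 3)%N))// lerDr.
have q1 : q <= 1 + q ^+ 3.
  have [q1|q1] := leP q 1.
    by rewrite (le_trans q1)// lerDl exprn_ge0.
  by rewrite (le_trans (ler_weXn2l (ltW q1) (_ : 1 <= 3)%N))// lerDr.
rewrite (exprM _ 2 3) -/q QE /transport_sqr_bound.
set k1 := (L1 / thlo) ^+ 2 in h1 h2 *.
set k2 := 2 * L2 ^+ 2 * _ in h3 *.
have k10 : 0 <= k1 by exact: sqr_ge0.
have k20 : 0 <= k2 by rewrite /k2 -mulrA mulr_ge0// mulr_ge0 ?addr_ge0 ?sqr_ge0.
have e1 := ler_wpM2l k10 q2.
have e2 := ler_wpM2l k20 q1.
have e3 : 0 <= k2 * q ^+ 3 by rewrite mulr_ge0// exprn_ge0.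
have : (a1 - a2 + a3) ^+ 2 <= 3 * (a1 ^+ 2 + a2 ^+ 2 + a3 ^+ 2).
  by have := sqr_ge0 (a1 + a2); have := sqr_ge0 (a1 - a3); have := sqr_ge0 (a2 + a3); lra.
lra.
Qed.

End transport_poly_bounds.

(** * Gaussian average of the transport polynomial *)

Section local_estimate.
Context {R : realType} {d : nat}.
Local Notation Rd := 'rV[R]_d.
Local Notation mu := (@rV_lebesgue R d).
Implicit Types (v e a u b : Rd) (G : 'M[R]_d).

(* Gaussian average of transport_poly u th G b over the Maxwellian of velocity
   a and temperature s. *)
Definition mean_transport (u : Rd) (th : R) (G : 'M[R]_d) (b a : Rd) (s : R) : R :=
  (mx_form G (a - u) - enorm (a - u) ^+ 2 * (\sum_i G i i) / d%:R) / th
  + (enorm (a - u) ^+ 2 + (d%:R + 2) * (s - th)) / (2 * th) * dotp (a - u) b.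

(** The expansion is centred at the mean [a] of the Gaussian and sorted into terms of known average:
    a quadratic form, the squared norm, a cubic and a linear term that average to 0, and a
    constant. *)
Lemma transport_poly_expand u th G b a v : (0 < d)%N -> th != 0 ->
  transport_poly u th G b v =
  \sum_i \sum_j (G i j / th + (a - u) 0 i * b 0 j / th)
                * ((v 0 i - a 0 i) * (v 0 j - a 0 j))
  + (- (\sum_i G i i) / (d%:R * th) + dotp (a - u) b / (2 * th)) * enorm (v - a) ^+ 2
  + (2 * th)^-1 * (enorm (v - a) ^+ 2 * dotp b (v - a))
  + dotp (\row_i ((\sum_j (G i j + G j i) * (a - u) 0 j) / th
        - 2 * (\sum_j G j j) / (d%:R * th) * (a - u) 0 i
        + dotp (a - u) b / th * (a - u) 0 i
        + (enorm (a - u) ^+ 2 / (2 * th) - (d%:R + 2) / 2) * b 0 i)) (v - a)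
  + (mx_form G (a - u) / th - enorm (a - u) ^+ 2 * (\sum_i G i i) / (d%:R * th)
     + (enorm (a - u) ^+ 2 / (2 * th) - (d%:R + 2) / 2) * dotp (a - u) b).
Proof.
move=> d0 th0; have dR : (d%:R : R) != 0 by rewrite pnatr_eq0 -lt0n.
pose y i := v 0 i - a 0 i; pose e i := a 0 i - u 0 i.
have yE i : (v - a) 0 i = y i by rewrite !mxE.
have eE i : (a - u) 0 i = e i by rewrite !mxE.
rewrite /transport_poly /mx_form !enorm_sqr_rV /dotp.
set tr := \sum_i G i i.
pose N := \sum_i y i ^+ 2; pose D := \sum_i e i ^+ 2; pose P := \sum_i y i * e i.
pose B := \sum_i e i * b 0 i; pose Y := \sum_i b 0 i * y i.
pose Gyy := \sum_i \sum_j G i j * (y i * y j).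
pose Gye := \sum_i \sum_j (G i j + G j i) * e j * y i.
pose Gee := \sum_i \sum_j G i j * e i * e j.
have s1 : \sum_i \sum_j G i j * (v 0 i - u 0 i) * (v 0 j - u 0 j) = Gyy + Gye + Gee.
  have -> : Gye = \sum_i \sum_j G i j * (y i * e j + e i * y j).
    transitivity (\sum_i \sum_j G i j * e j * y i + \sum_i \sum_j G j i * e j * y i).
      by rewrite -big_split; apply: eq_bigr => i _; rewrite -big_split; apply: eq_bigr => j _ /=; ring.
    rewrite [X in _ + X]exchange_big -big_split; apply: eq_bigr => i _.
    by rewrite -big_split; apply: eq_bigr => j _ /=; ring.
  rewrite -!big_split; apply: eq_bigr => i _; rewrite -!big_split; apply: eq_bigr => j _ /=.
  by rewrite /y /e; ring.
have s2 : \sum_i (v 0 i - u 0 i) ^+ 2 = N + 2 * P + D.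
  rewrite mulr_sumr -!big_split; apply: eq_bigr => i _ /=.
  by rewrite /y /e; ring.
have s3 : \sum_i (v 0 i - u 0 i) * b 0 i = Y + B.
  by rewrite -big_split; apply: eq_bigr => i _ /=; rewrite /y /e; ring.
have sN : \sum_i (v - a) 0 i ^+ 2 = N by apply: eq_bigr => i _; rewrite yE.
have sD : \sum_i (a - u) 0 i ^+ 2 = D by apply: eq_bigr => i _; rewrite eE.
have sB : \sum_i (a - u) 0 i * b 0 i = B by apply: eq_bigr => i _; rewrite eE.
have sY : \sum_i b 0 i * (v - a) 0 i = Y by apply: eq_bigr => i _; rewrite yE.
have sG : \sum_i \sum_j G i j * (a - u) 0 i * (a - u) 0 j = Gee.
  by apply: eq_bigr => i _; apply: eq_bigr => j _; rewrite !eE.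
have sq : \sum_i \sum_j (G i j / th + (a - u) 0 i * b 0 j / th) *
    ((v 0 i - a 0 i) * (v 0 j - a 0 j)) = Gyy / th + P * Y / th.
  have -> : P * Y / th = \sum_i \sum_j e i * b 0 j / th * (y i * y j).
    rewrite /P /Y mulr_suml mulr_suml; apply: eq_bigr => i _.
    by rewrite mulr_sumr mulr_suml; apply: eq_bigr => j _; ring.
  rewrite /Gyy mulr_suml -big_split; apply: eq_bigr => i _ /=.
  rewrite mulr_suml -big_split; apply: eq_bigr => j _ /=.
  by rewrite eE /y; ring.
rewrite s1 s2 s3 sN sD sB sY sG sq.
have -> : \sum_i (\row_i ((\sum_j (G i j + G j i) * (a - u) 0 j) / th
        - 2 * tr / (d%:R * th) * (a - u) 0 i
        + B / th * (a - u) 0 i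
        + (D / (2 * th) - (d%:R + 2) / 2) * b 0 i)) 0 i * (v - a) 0 i =
   Gye / th - 2 * tr / (d%:R * th) * P + B / th * P
     + (D / (2 * th) - (d%:R + 2) / 2) * Y.
  transitivity (\sum_i (th^-1 * (\sum_j (G i j + G j i) * e j * y i)
     - 2 * tr / (d%:R * th) * (y i * e i) + B / th * (y i * e i)
     + (D / (2 * th) - (d%:R + 2) / 2) * (b 0 i * y i))).
    apply: eq_bigr => i _; rewrite mxE yE eE.
    under eq_bigr do rewrite eE.
    by rewrite -mulr_suml; ring.
  rewrite !big_split/= sumrN -!mulr_sumr -/P -/Y -/Gye; ring.
field; rewrite th0; exact: dR.
Qed.

Lemma gaussian_bilinear a (s : R) (C : 'I_d -> 'I_d -> R) : 0 < s ->
  has_integral mu (fun v => maxwellian 1 a s v *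
      \sum_i \sum_j C i j * ((v 0 i - a 0 i) * (v 0 j - a 0 j)))
    (s * \sum_i C i i).
Proof.
move=> s0.
have -> : s * \sum_i C i i = \sum_i \sum_j C i j * (s * (i == j)%:R).
  rewrite mulr_sumr; apply: eq_bigr => i _.
  rewrite (bigD1 i)//= eqxx big1 ?addr0 ?mulr1 1?mulrC// => j.
  by rewrite eq_sym => /negPf ->; rewrite !mulr0.
apply: has_integral_eq (has_integral_sum (fun i => has_integral_sum (fun j =>
  has_integralZ (C i j) (gaussian_coord2 a s0 i j)))) => v.
rewrite mulr_sumr; apply: eq_bigr => i _; rewrite mulr_sumr; apply: eq_bigr => j _.
by rewrite mulrCA.
Qed.

Lemma has_integral_transport u th G b a (s : R) : (0 < d)%N -> th != 0 -> 0 < s ->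
  has_integral mu (fun v => maxwellian 1 a s v * transport_poly u th G b v)
    (mean_transport u th G b a s).
Proof.
move=> d0 th0 s0; have dR : (d%:R : R) != 0 by rewrite pnatr_eq0 -lt0n.
set C := fun i j => G i j / th + (a - u) 0 i * b 0 j / th.
set k := - (\sum_i G i i) / (d%:R * th) + dotp (a - u) b / (2 * th).
set c := mx_form G (a - u) / th - enorm (a - u) ^+ 2 * (\sum_i G i i) / (d%:R * th)
     + (enorm (a - u) ^+ 2 / (2 * th) - (d%:R + 2) / 2) * dotp (a - u) b.
set e := \row_i ((\sum_j (G i j + G j i) * (a - u) 0 j) / th
        - 2 * (\sum_j G j j) / (d%:R * th) * (a - u) 0 i
        + dotp (a - u) b / th * (a - u) 0 i
        + (enorm (a - u) ^+ 2 / (2 * th) - (d%:R + 2) / 2) * b 0 i).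
(* The trace of [G] enters twice at second order with opposite signs and cancels, so [s] survives
   only in the factor [s - th] of [dotp (a - u) b]. *)
have -> : mean_transport u th G b a s =
    s * \sum_i C i i + k * (d%:R * s) + (2 * th)^-1 * 0 + 0 + c * 1.
  rewrite /C big_split/= -!mulr_suml -/(dotp (a - u) b) /k /c /mean_transport.
  by field; rewrite th0; exact: dR.
apply: has_integral_eq (has_integralD (has_integralD (has_integralD (has_integralD
  (gaussian_bilinear a C s0) (has_integralZ k (gaussian_sqnorm a s0)))
  (has_integralZ (2 * th)^-1 (gaussian_sqnorm_dotp a s0 b))) (gaussian_first a s0 e))
  (has_integralZ c (has_integral_maxwellian a ler01 s0))) => v.
by rewrite (transport_poly_expand u G b a v d0 th0) -/c -/k -/e; ring.
Qed.

(** Each term has at least two small factors among [a - u] and [s - th]. The cubic term spends one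
    of them on the bound [D]; the mixed product is split into squares. *)
Lemma mean_transport_le u th G b a (s thlo D L1 L2 : R) : (0 < d)%N ->
  0 < thlo -> thlo <= th -> enorm (a - u) <= D -> enorm G <= L1 -> enorm b <= L2 ->
  `|mean_transport u th G b a s| <=
  (2 * L1 + D * L2 + (d%:R + 2) * L2) / thlo * (enorm (a - u) ^+ 2 + (s - th) ^+ 2).
Proof.
move=> d0 thlo0 thlo_le aD GL1 bL2.
have dR : 1 <= d%:R :> R by rewrite ler1n.
have dR0 : 0 < d%:R :> R by exact: lt_le_trans dR.
have th0 : 0 < th by exact: lt_le_trans thlo_le.
have normr_le_sqr (x y : R) : 0 <= y -> x ^+ 2 <= y ^+ 2 -> `|x| <= y.
  by move=> y0 xy; rewrite -(@ler_pXn2r _ 2) ?nnegrE// real_normK ?num_real.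
set q := enorm (a - u) in aD *; have q0 : 0 <= q by exact: enorm_ge0.
have G0 : 0 <= enorm G by exact: enorm_ge0.
have b0 : 0 <= enorm b by exact: enorm_ge0.
have h1 : `|mx_form G (a - u)| <= L1 * q ^+ 2.
  apply: normr_le_sqr; first by rewrite mulr_ge0 ?sqr_ge0// (le_trans G0).
  apply: (le_trans (mx_form_sqr_le _ _)); rewrite [leRHS]exprMn -/q ler_wpM2r ?sqr_ge0//.
  by rewrite lerXn2r ?nnegrE// (le_trans G0).
have h2 : `|(\sum_i G i i) / d%:R| <= L1.
  apply: normr_le_sqr; first by rewrite (le_trans G0).
  rewrite exprMn exprVn ler_pdivrMr ?exprn_gt0//.
  apply: (le_trans (mxtrace_sqr_le G)); rewrite mulrC.
  apply: ler_pM => //; rewrite ?sqr_ge0//.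
    by rewrite lerXn2r ?nnegrE// (le_trans G0).
  by rewrite expr2 ler_peMl// (le_trans _ dR).
have h3 : `|dotp (a - u) b| <= q * L2.
  apply: normr_le_sqr; first by rewrite mulr_ge0// (le_trans b0).
  apply: (le_trans (dotp_sqr_le _ _)); rewrite [leRHS]exprMn -/q ler_wpM2l ?sqr_ge0//.
  by rewrite lerXn2r ?nnegrE// (le_trans b0).
have iv : th^-1 <= thlo^-1 by rewrite lef_pV2 ?posrE.
have iv0 : 0 <= th^-1 by rewrite invr_ge0 ltW.
have L10 : 0 <= L1 by exact: le_trans GL1.
have L20 : 0 <= L2 by exact: le_trans bL2.
have D0 : 0 <= D by exact: le_trans aD.
have -> : mean_transport u th G b a s =
  th^-1 * (mx_form G (a - u) - q ^+ 2 * ((\sum_i G i i) / d%:R)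
   + 2^-1 * ((q ^+ 2 + (d%:R + 2) * (s - th)) * dotp (a - u) b)).
  by rewrite /mean_transport -/q; field; rewrite !gt_eqF.
rewrite normrM (ger0_norm iv0) [leRHS]mulrAC [leRHS]mulrC.
have t1 : `|mx_form G (a - u) - q ^+ 2 * ((\sum_i G i i) / d%:R)| <= 2 * L1 * q ^+ 2.
  apply: (le_trans (ler_normB _ _)); rewrite normrM (ger0_norm (sqr_ge0 q)).
  have := ler_wpM2l (sqr_ge0 q) h2; lra.
have t2 : `|(q ^+ 2 + (d%:R + 2) * (s - th)) * dotp (a - u) b| <=
    2 * (D * L2 + (d%:R + 2) * L2) * (q ^+ 2 + (s - th) ^+ 2).
  set w := s - th; rewrite normrM.
  apply: (@le_trans _ _ ((q ^+ 2 + (d%:R + 2) * `|w|) * (q * L2))).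
    apply: ler_pM => //; apply: (le_trans (ler_normD _ _)).
    by rewrite (ger0_norm (sqr_ge0 q)) normrM (ger0_norm (_ : 0 <= d%:R + 2))// addr_ge0.
  have w2 : w ^+ 2 = `|w| ^+ 2 by rewrite real_normK ?num_real.
  rewrite w2; set z := `|w|; have z0 : 0 <= z by exact: normr_ge0.
  have e1 : q ^+ 2 * q * L2 <= D * L2 * q ^+ 2.
    have := ler_wpM2r (mulr_ge0 L20 (sqr_ge0 q)) aD; lra.
  have e2 : (d%:R + 2) * L2 * (z * q) <= (d%:R + 2) * L2 * (z ^+ 2 + q ^+ 2).
    rewrite ler_wpM2l ?mulr_ge0 ?addr_ge0//.
    have := sqr_ge0 (z - q); have := sqr_ge0 z; have := sqr_ge0 q; lra.
  have e3 : 0 <= D * L2 * (q ^+ 2 + z ^+ 2) by rewrite !mulr_ge0 ?addr_ge0 ?sqr_ge0.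
  have e4 : 0 <= D * L2 * z ^+ 2 by rewrite !mulr_ge0 ?sqr_ge0.
  have e5 : 0 <= (d%:R + 2) * L2 * (q ^+ 2 + z ^+ 2).
    by rewrite !mulr_ge0 ?addr_ge0 ?sqr_ge0.
  lra.
have t3 : `|mx_form G (a - u) - q ^+ 2 * ((\sum_i G i i) / d%:R)
   + 2^-1 * ((q ^+ 2 + (d%:R + 2) * (s - th)) * dotp (a - u) b)| <=
   (2 * L1 + D * L2 + (d%:R + 2) * L2) * (q ^+ 2 + (s - th) ^+ 2).
  apply: (le_trans (ler_normD _ _)).
  rewrite [X in _ + X]normrM (ger0_norm (_ : 0 <= 2^-1))//.
  have : 0 <= L1 * (s - th) ^+ 2 by rewrite mulr_ge0 ?sqr_ge0.
  lra.
exact: ler_pM.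
Qed.

End local_estimate.

(** * Dissipation estimate at a fixed position with positive density *)

Section local_estimate_main.
Context {R : realType} {d : nat}.
Local Notation Rd := 'rV[R]_d.
Local Notation mu := (@rV_lebesgue R d).
Implicit Types (v e : Rd).

(** Expanded around [a], so that the linear term integrates to zero against every density of mean
    velocity [a]. *)
Lemma ln_maxwellian_ratio (n r s th : R) (a u : Rd) v :
  0 < n -> 0 < r -> 0 < s -> 0 < th ->
  ln (maxwellian n a s v / maxwellian r u th v) =
  ln n - ln r - d%:R / 2 * (ln s - ln th) + enorm (a - u) ^+ 2 / (2 * th)
  + ((2 * th)^-1 - (2 * s)^-1) * enorm (v - a) ^+ 2
  + dotp (th^-1 *: (a - u)) (v - a).
Proof.
move=> n0 r0 s0 th0; rewrite ln_div ?posrE ?maxwellian_gt0//.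
rewrite !ln_maxwellian// -!enorm_sqrB dotpZl.
have -> : enorm (v - u) ^+ 2 =
    enorm (v - a) ^+ 2 + 2 * dotp (a - u) (v - a) + enorm (a - u) ^+ 2.
  rewrite !enorm_sqr_rV /dotp mulr_sumr -!big_split; apply: eq_bigr => i _ /=.
  by rewrite !mxE; ring.
by field; rewrite !gt_eqF.
Qed.

Variables (g : Rd -> R) (n m s r th : R) (a u b : Rd) (G : 'M[R]_d).
Variables (thlo thhi shi V D L1 L2 : R).
Hypotheses (d0 : (0 < d)%N) (n0 : 0 < n) (r0 : 0 < r) (s0 : 0 < s).
Hypotheses (mg : measurable_fun setT g) (g0 : forall v, 0 <= g v).
Hypothesis gm : has_integral mu (fun v => (1 + enorm v ^+ 6) * g v) m.
Hypothesis gn : has_integral mu g n.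
Hypothesis ga : forall i, has_integral mu (fun v => v 0 i * g v) (n * a 0 i).
Hypothesis gs : has_integral mu (fun v => enorm (v - a) ^+ 2 * g v) (d%:R * n * s).
Hypotheses (thlo0 : 0 < thlo) (thlo_le : thlo <= th) (thhi_ge : th <= thhi).
Hypotheses (shi_ge : s <= shi) (uV : enorm u <= V) (aD : enorm (a - u) <= D).
Hypotheses (GL1 : enorm G <= L1) (bL2 : enorm b <= L2).
Let Mg := maxwellian n a s.
Let M := maxwellian r u th.
Let Q := transport_poly u th G b.
Let l v := ln (Mg v / M v).

Let th0 : 0 < th. Proof. exact: lt_le_trans thlo_le. Qed.
Let Mg0 v : 0 < Mg v. Proof. exact: maxwellian_gt0. Qed.
Let M0 v : 0 < M v. Proof. exact: maxwellian_gt0. Qed.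

Let g_dotp e : has_integral mu (fun v => g v * dotp e (v - a)) 0.
Proof.
have -> : 0 = \sum_(i < d) e 0 i * (n * a 0 i - a 0 i * n).
  by rewrite big1// => i _; rewrite (mulrC n) subrr mulr0.
apply: has_integral_eq (has_integral_sum (fun i => has_integralZ (e 0 i)
  (has_integralB (ga i) (has_integralZ (a 0 i) gn)))) => v.
by rewrite /dotp mulr_sumr; apply: eq_bigr => i _; rewrite !mxE; ring.
Qed.

Let Mg_r f c : has_integral mu (fun v => maxwellian 1 a s v * f v) c ->
  has_integral mu (fun v => Mg v * f v) (n * c).
Proof.
by move=> h; apply: has_integral_eq (has_integralZ n h) => v; rewrite /Mg (maxwellianZ n) mulrA.
Qed.

Let l0 := ln n - ln r - d%:R / 2 * (ln s - ln th) + enorm (a - u) ^+ 2 / (2 * th).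
Let l2 := (2 * th)^-1 - (2 * s)^-1.

Let lE v : l v = l0 + l2 * enorm (v - a) ^+ 2 + dotp (th^-1 *: (a - u)) (v - a).
Proof. exact: ln_maxwellian_ratio. Qed.

Let g_l : has_integral mu (fun v => g v * l v) (n * (l0 + l2 * (d%:R * s))).
Proof.
have -> : n * (l0 + l2 * (d%:R * s)) = l0 * n + l2 * (d%:R * n * s) + 0 by ring.
apply: has_integral_eq (has_integralD (has_integralD (has_integralZ l0 gn)
  (has_integralZ l2 gs)) (g_dotp (th^-1 *: (a - u)))) => v.
by rewrite lE; ring.
Qed.

Let Mg_l : has_integral mu (fun v => Mg v * l v) (n * (l0 + l2 * (d%:R * s))).
Proof.
rewrite (_ : l0 + _ = l0 * 1 + l2 * (d%:R * s) + 0); last by ring.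
apply: has_integral_eq (Mg_r (has_integral_eq _ (has_integralD (has_integralD
  (has_integralZ l0 (has_integral_maxwellian a ler01 s0))
  (has_integralZ l2 (gaussian_sqnorm a s0))) (gaussian_first a s0 (th^-1 *: (a - u)))))) => v //.
by rewrite lE /=; ring.
Qed.

(** The left side is the entropy of [Mg] relative to [M] at this position. It differs from [B] by
    the entropy of [g] relative to [Mg], which is nonnegative because their masses agree. *)
Let entropy_ge B : has_integral mu (fun v => g v * ln (g v / M v)) B ->
  n * (l0 + l2 * (d%:R * s)) <= B.
Proof.
move=> gB.
have h : has_integral mu (fun v => g v - Mg v + g v * l v)
    (n * (l0 + l2 * (d%:R * s))).
  rewrite -[X in has_integral _ _ X]add0r -(subrr n).
  exact: has_integralD (has_integralB gn (has_integral_maxwellian a (ltW n0) s0)) g_l.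
apply: (has_integral_le h gB) => v.
have := g0 v; rewrite le_eqVlt => /predU1P[<-|gv0].
  by rewrite !mul0r addr0 sub0r oppr_le0 ltW.
have := mul_ln_ge gv0 (Mg0 v).
by rewrite /l !ln_div ?posrE//; lra.
Qed.

(** The entropy of [Mg] relative to [M] splits into three parts. The density part is at least
    [n - r]; the velocity part is [|a - u|^2 / (2 th)]; [sub1_ln_ge] makes the temperature part
    quadratic in [s - th]. The constant dominates both [2 th] and [4 th (s + th)]. *)
Let variance_le :
  n * (enorm (a - u) ^+ 2 + (s - th) ^+ 2) <=
  4 * thhi * (1 + thhi + shi) * (n * (l0 + l2 * (d%:R * s)) - n + r).
Proof.
have dR : 1 <= d%:R :> R by rewrite ler1n.
have hn : n - r <= n * (ln n - ln r) by rewrite -ln_div ?posrE// mul_ln_ge.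
have := sub1_ln_ge (divr_gt0 s0 th0); rewrite ln_div ?posrE//.
set Z := (_ - 1) ^+ 2 / _.
have ZE : Z = (s - th) ^+ 2 / (2 * th * (s + th)).
  by rewrite /Z; field; rewrite !gt_eqF ?addr_gt0.
move=> hs; have thhi0 : 0 < thhi by exact: lt_le_trans thhi_ge.
have shi0 : 0 < shi by exact: lt_le_trans shi_ge.
have k0 : 0 < 4 * thhi * (1 + thhi + shi) by rewrite !mulr_gt0// !addr_gt0.
set k := 4 * thhi * _ in k0 *.
have Z1 : k^-1 * (s - th) ^+ 2 <= Z / 2.
  rewrite ZE [leLHS]mulrC -[leRHS]mulrA ler_wpM2l ?sqr_ge0// -invfM lef_pV2 ?posrE//; last first.
    by rewrite !mulr_gt0// addr_gt0.
  apply: (@le_trans _ _ (4 * thhi * (shi + thhi))).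
    rewrite mulrAC (_ : 2 * th * 2 = 4 * th); last by ring.
    by apply: ler_pM => //; rewrite ?mulr_ge0 ?addr_ge0 ?(ltW s0) ?(ltW th0)// ?lerD// ler_wpM2l.
  by rewrite /k ler_wpM2l ?mulr_ge0 ?(ltW thhi0)//; lra.
have Z0 : 0 <= Z by rewrite ZE divr_ge0 ?sqr_ge0// !mulr_ge0 ?addr_ge0 ?ltW.
have q1 : k^-1 * enorm (a - u) ^+ 2 <= enorm (a - u) ^+ 2 / (2 * th).
  rewrite [leLHS]mulrC ler_wpM2l ?sqr_ge0// lef_pV2 ?posrE// ?mulr_gt0//.
  apply: (@le_trans _ _ (2 * thhi)); first by rewrite ler_wpM2l.
  rewrite /k -[leLHS]mulr1; apply: ler_pM => //; rewrite ?mulr_ge0 ?(ltW thhi0)//.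
    by rewrite ler_wpM2r ?(ltW thhi0)//; lra.
  lra.
rewrite -ler_pdivrMl// mulrCA.
have key : k^-1 * (enorm (a - u) ^+ 2 + (s - th) ^+ 2) <=
    l0 + l2 * (d%:R * s) - (ln n - ln r).
  have -> : l0 + l2 * (d%:R * s) - (ln n - ln r) =
      enorm (a - u) ^+ 2 / (2 * th) + d%:R / 2 * (s / th - 1 - (ln s - ln th)).
    by rewrite /l0 /l2; field; rewrite !gt_eqF.
  have : Z / 2 <= d%:R / 2 * (s / th - 1 - (ln s - ln th)).
    apply: (@le_trans _ _ (d%:R / 2 * Z)); last by rewrite ler_wpM2l ?divr_ge0.
    have := ler_wpM2r Z0 dR; lra.
  lra.
have := ler_wpM2l (ltW n0) key; lra.
Qed.

Let sixth_const := 384 * 2 `^ (d%:R / 2) * shi ^+ 3.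
Let K3 := @transport_sqr_bound R d thlo L1 L2.

Let mQ : measurable_fun setT Q.
Proof.
have m_y i : measurable_fun setT (fun v : Rd => v 0 i - u 0 i).
  by apply: measurable_funB => //; exact: measurable_rV_coord.
have mN : measurable_fun setT (fun v : Rd => \sum_i (v 0 i - u 0 i) ^+ 2).
  by apply: measurable_sum => i; apply: measurable_funX; exact: m_y.
apply: measurable_funD; [apply: measurable_funB|]; apply: measurable_funM => //.
- apply: measurable_sum => i; apply: measurable_sum => j.
  by apply: measurable_funM; [apply: measurable_funM => //|]; exact: m_y.
- by apply: measurable_funM.
- by apply: measurable_funB => //; apply: measurable_funM.
- by apply: measurable_sum => i; apply: measurable_funM => //; exact: m_y.
Qed.

Let K30 : 0 <= K3. Proof. exact: transport_sqr_bound_ge0. Qed.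

Let Q2_le v : Q v ^+ 2 <= K3 * (1 + enorm (v - u) ^+ 6).
Proof. exact: transport_poly_sqr_le. Qed.

Let V0 : 0 <= V. Proof. by apply: le_trans uV; exact: enorm_ge0. Qed.
Let D0 : 0 <= D. Proof. by apply: le_trans aD; exact: enorm_ge0. Qed.

Let gQ2 : exists2 c, has_integral mu (fun v => g v * Q v ^+ 2) c &
  c <= K3 * (32 * (1 + V ^+ 6)) * m.
Proof.
have dom v : g v * Q v ^+ 2 <= K3 * (32 * (1 + V ^+ 6)) * ((1 + enorm v ^+ 6) * g v).
  rewrite mulrC [leRHS]mulrA ler_wpM2r//; apply: (le_trans (Q2_le v)).
  rewrite -[leRHS]mulrA ler_wpM2l//.
  have := enormB_sixth_le v 0 u; rewrite subr0 sub0r.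
  have -> : enorm (- u) = enorm u.
    by congr Num.sqrt; apply: eq_bigr => i _; apply: eq_bigr => j _; rewrite mxE sqrrN.
  have : enorm u ^+ 6 <= V ^+ 6 by rewrite lerXn2r ?nnegrE// enorm_ge0.
  have v6 : 0 <= enorm v ^+ 6 by rewrite exprn_ge0// enorm_ge0.
  have := mulr_ge0 (exprn_ge0 6 V0) v6; lra.
have gQm : measurable_fun setT (fun v => g v * Q v ^+ 2).
  exact: measurable_funM mg (measurable_funX 2 mQ).
have gQd v : `|g v * Q v ^+ 2| <= K3 * (32 * (1 + V ^+ 6)) * ((1 + enorm v ^+ 6) * g v).
  by rewrite ger0_norm ?dom// mulr_ge0 ?sqr_ge0.
have h := has_integral_dom gQm (has_integralZ (K3 * (32 * (1 + V ^+ 6))) gm) gQd.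
eexists; first exact: h.
exact: has_integral_le h (has_integralZ _ gm) dom.
Qed.

Let MgQ2 : exists2 c, has_integral mu (fun v => Mg v * Q v ^+ 2) c &
  c <= K3 * (1 + 32 * sixth_const + 32 * D ^+ 6) * n.
Proof.
have m6 : measurable_fun setT (fun v : Rd => enorm (v - a) ^+ 6).
  under eq_fun do rewrite (exprM _ 2 3).
  by apply: measurable_funX; exact: measurable_enormB.
have d6 v : `|enorm (v - a) ^+ 6| <= 1 * (1 + enorm (v - a) ^+ 6).
  by rewrite mul1r ger0_norm ?lerDr// exprn_ge0// enorm_ge0.
have h6 := @integrable_maxwellianM R d n a s _ 1 (ltW n0) s0 ler01 m6 d6.
have h6le := maxwellian_sixth_le (ltW n0) s0 h6.
set I6 := fine _ in h6 h6le.
have {}h6le : I6 <= sixth_const * n.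
  apply: (le_trans h6le); rewrite ler_wpM2r ?(ltW n0)//.
  apply: ler_wpM2l; first exact: (mulr_ge0 (ler0n _ _) (powR_ge0 _ _)).
  by rewrite lerXn2r ?nnegrE ?(ltW s0)// (le_trans (ltW s0)).
have hn := has_integral_maxwellian a (ltW n0) s0.
pose c := K3 * ((1 + 32 * D ^+ 6) * n + 32 * I6).
have hc : has_integral mu (fun v => K3 * ((1 + 32 * D ^+ 6) * Mg v
    + 32 * (Mg v * enorm (v - a) ^+ 6))) c.
  exact: has_integralZ (has_integralD (has_integralZ _ hn) (has_integralZ 32 h6)).
have dom v : Mg v * Q v ^+ 2 <= K3 * ((1 + 32 * D ^+ 6) * Mg v
    + 32 * (Mg v * enorm (v - a) ^+ 6)).
  rewrite (_ : (1 + 32 * D ^+ 6) * Mg v + _ =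
    (1 + 32 * D ^+ 6 + 32 * enorm (v - a) ^+ 6) * Mg v); last by ring.
  rewrite mulrC [leRHS]mulrA ler_wpM2r ?(ltW (Mg0 v))//.
  apply: (le_trans (Q2_le v)); rewrite ler_wpM2l//.
  have := enormB_sixth_le v a u.
  have : enorm (a - u) ^+ 6 <= D ^+ 6 by rewrite lerXn2r ?nnegrE// enorm_ge0.
  lra.
have mgQ : measurable_fun setT (fun v => Mg v * Q v ^+ 2).
  by apply: measurable_funM; [exact: measurable_maxwellian|exact: measurable_funX].
have domn v : `|Mg v * Q v ^+ 2| <= K3 * ((1 + 32 * D ^+ 6) * Mg v
    + 32 * (Mg v * enorm (v - a) ^+ 6)).
  by rewrite ger0_norm ?dom// mulr_ge0 ?sqr_ge0// ltW.
have h := has_integral_dom mgQ hc domn.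
eexists; first exact: h.
apply: (le_trans (has_integral_le h hc dom)).
by rewrite /c -mulrA ler_wpM2l//; lra.
Qed.

Let K2 := (2 * L1 + D * L2 + (d%:R + 2) * L2) / thlo.

Lemma local_dissipation (e A B : R) : 0 < e ->
  has_integral mu (fun v => - (g v * Q v)
    - e^-1 * ((g v - Mg v) * ln (g v / M v))) A ->
  has_integral mu (fun v => g v * ln (g v / M v)) B ->
  {ae mu, forall v, 0 < g v} ->
  A <= K2 * (4 * thhi * (1 + thhi + shi)) * (B - n + r)
       + e * (K3 * (33 * (1 + V ^+ 6) + 32 * sixth_const + 32 * D ^+ 6)) * m.
Proof.
move=> e0 hA hB gpos.
have [c1 h1 c1le] := gQ2; have [c2 h2 c2le] := MgQ2.
pose q := mean_transport u th G b a s.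
have h3 : has_integral mu (fun v => Mg v * Q v) (n * q).
  exact: Mg_r (has_integral_transport u G b a d0 (lt0r_neq0 th0) s0).
have h4 := has_integralB g_l Mg_l; rewrite subrr in h4.
have qle : `|q| <= K2 * (enorm (a - u) ^+ 2 + (s - th) ^+ 2).
  exact: mean_transport_le.
(* The three pieces of the majorant: the remainder of Young's inequality, the Gaussian average of
   [Q], and the exchange of [ln (g / M)] for [ln (g / Mg)], whose integral [h4] is zero. *)
have hR := has_integralB (has_integralB (has_integralZ (e / 4) (has_integralD h1 h2)) h3)
  (has_integralZ e^-1 h4).
have AR : A <= e / 4 * (c1 + c2) - n * q - e^-1 * 0.
  apply: (ae_has_integral_le hA hR); apply: filterS gpos => v gv0.
  have Mgv0 := Mg0 v; have Mv0 := M0 v.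
  have lm := log_mean_ge gv0 Mgv0.
  have -> : ln (g v / M v) = ln (g v / Mg v) + l v by rewrite /l !ln_div ?posrE//; ring.
  set x := g v in gv0 lm *; set y := Mg v in Mgv0 lm *.
  set L := ln (x / y) in lm *; set k := l v; set w := Q v.
  have xy0 : 0 < x + y by rewrite addr_gt0.
  suff : - ((x - y) * w) - e^-1 * ((x - y) * L) <= e / 4 * ((x + y) * w ^+ 2) by lra.
  have {}lm : e^-1 * ((x - y) ^+ 2 / (x + y)) <= e^-1 * ((x - y) * L).
    by rewrite ler_wpM2l// invr_ge0 ltW.
  (* the square in Young's inequality for (x - y) w *)
  have sq : 0 <= (e * (x + y)) ^-1 * ((x - y) + e * (x + y) * w / 2) ^+ 2.
    by rewrite mulr_ge0 ?sqr_ge0// invr_ge0 mulr_ge0 ?ltW.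
  have : (e * (x + y)) ^-1 * ((x - y) + e * (x + y) * w / 2) ^+ 2 =
    e^-1 * ((x - y) ^+ 2 / (x + y)) + (x - y) * w + e / 4 * ((x + y) * w ^+ 2).
    by field; rewrite !gt_eqF.
  lra.
have nm : n <= m.
  apply: (has_integral_le gn gm) => v; rewrite mulrDl mul1r lerDl mulr_ge0//.
  by rewrite exprn_ge0// enorm_ge0.
have K20 : 0 <= K2.
  have L10 : 0 <= L1 by apply: le_trans GL1; exact: enorm_ge0.
  have L20 : 0 <= L2 by apply: le_trans bL2; exact: enorm_ge0.
  rewrite divr_ge0 ?(ltW thlo0)//.
  by rewrite !addr_ge0 ?mulr_ge0 ?addr_ge0.
have nq : - (n * q) <= K2 * (4 * thhi * (1 + thhi + shi)) * (B - n + r).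
  apply: (@le_trans _ _ (n * `|q|)).
    by rewrite -mulrN ler_wpM2l ?(ltW n0)// -normrN ler_norm.
  apply: (le_trans (ler_wpM2l (ltW n0) qle)); rewrite mulrCA -[leRHS]mulrA.
  rewrite ler_wpM2l//; apply: (le_trans variance_le).
  have thhi0 : 0 < thhi by exact: lt_le_trans thhi_ge.
  have shi0 : 0 < shi by exact: lt_le_trans shi_ge.
  rewrite ler_wpM2l//; first by rewrite !mulr_ge0// ?addr_ge0// ltW.
  by have := entropy_ge hB; lra.
have D6 : 0 <= D ^+ 6 by rewrite exprn_ge0.
have V6 : 0 <= V ^+ 6 by rewrite exprn_ge0.
have S6 : 0 <= sixth_const.
  apply: mulr_ge0; first exact: (mulr_ge0 (ler0n _ _) (powR_ge0 _ _)).
  by rewrite exprn_ge0// (le_trans (ltW s0)).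
have c2m : c2 <= K3 * (1 + 32 * sixth_const + 32 * D ^+ 6) * m.
  by apply: (le_trans c2le); rewrite ler_wpM2l// mulr_ge0//; lra.
have m0 : 0 <= m by rewrite (le_trans _ nm)// ltW.
(* The 33 is the 32 of [c1] plus the leading 1 in the bound of [c2]. *)
have c12 : c1 + c2 <= K3 * (33 * (1 + V ^+ 6) + 32 * sixth_const + 32 * D ^+ 6) * m.
  have := mulr_ge0 K30 (mulr_ge0 V6 m0); lra.
have P0 : 0 <= K3 * (33 * (1 + V ^+ 6) + 32 * sixth_const + 32 * D ^+ 6) * m.
  have c0 : 0 <= 33 * (1 + V ^+ 6) + 32 * sixth_const + 32 * D ^+ 6 by lra.
  exact: mulr_ge0 (mulr_ge0 K30 c0) m0.
have := ler_wpM2l (ltW e0) c12; have := mulr_ge0 (ltW e0) P0.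
lra.
Qed.

End local_estimate_main.

(** * The estimate for the fields of f at a fixed position, vacuum included *)

Section slice.
Context {R : realType} {d : nat}.
Local Notation Rd := 'rV[R]_d.
Local Notation mu := (@rV_lebesgue R d).

(** Product of the constants of [mean_transport_le] and of the bound of the squared deviations by
    the relative entropy. *)
Definition dissipation_coeff (thlo thhi shi D L1 L2 : R) : R :=
  (2 * L1 + D * L2 + (d%:R + 2) * L2) / thlo * (4 * thhi * (1 + thhi + shi)).

Definition remainder_coeff (thlo shi V D L1 L2 : R) : R :=
  @transport_sqr_bound R d thlo L1 L2 *
  (33 * (1 + V ^+ 6) + 32 * (384 * 2 `^ (d%:R / 2) * shi ^+ 3) + 32 * D ^+ 6).

Lemma dissipation_coeff_ge0 thlo thhi shi D L1 L2 : 0 <= thlo -> 0 <= thhi ->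
  0 <= shi -> 0 <= D -> 0 <= L1 -> 0 <= L2 ->
  0 <= dissipation_coeff thlo thhi shi D L1 L2.
Proof.
move=> t1 t2 s D0 l1 l2; apply: mulr_ge0.
  by rewrite divr_ge0// !addr_ge0 ?mulr_ge0 ?addr_ge0.
by rewrite !mulr_ge0 ?addr_ge0.
Qed.

Lemma remainder_coeff_ge0 thlo shi V D L1 L2 : 0 <= shi -> 0 <= V -> 0 <= D ->
  0 <= remainder_coeff thlo shi V D L1 L2.
Proof.
move=> s V0 D0; apply: mulr_ge0; first exact: transport_sqr_bound_ge0.
have h1 : 0 <= 384 * 2 `^ (d%:R / 2) * shi ^+ 3.
  exact: (mulr_ge0 (mulr_ge0 (ler0n _ _) (powR_ge0 _ _)) (exprn_ge0 3 s)).
by have := exprn_ge0 6 V0; have := exprn_ge0 6 D0; lra.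
Qed.

Variables (g : Rd -> R) (m r th : R) (u b : Rd) (G : 'M[R]_d).
Variables (thlo thhi slo shi V U L1 L2 : R).
Hypotheses (d0 : (0 < d)%N) (r0 : 0 < r).
Hypotheses (mg : measurable_fun setT g) (g0 : forall v, 0 <= g v).
Hypothesis gm : has_integral mu (fun v => (1 + enorm v ^+ 6) * g v) m.
Hypotheses (thlo0 : 0 < thlo) (thlo_le : thlo <= th) (thhi_ge : th <= thhi).
Hypotheses (slo0 : 0 < slo) (temp : slo <= temperature g <= shi).
Hypotheses (uV : enorm u <= V) (velU : forall i, `|velocity g 0 i| <= U).
Hypotheses (GL1 : enorm G <= L1) (bL2 : enorm b <= L2).
Let M := maxwellian r u th.
(** The summand 1 avoids a square root: [D] bounds the squared norm, and [D <= D ^+ 2] since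
    [D >= 1]. *)
Let D := 1 + 2 * (d%:R * U ^+ 2) + 2 * V ^+ 2.

Let velD : enorm (velocity g - u) <= D.
Proof.
set a := velocity g.
have D1 : 1 <= D.
  by have := mulr_ge0 (ler0n R d) (sqr_ge0 U); have := sqr_ge0 V; rewrite /D; lra.
have h1 : enorm a ^+ 2 <= d%:R * U ^+ 2.
  rewrite enorm_sqr_rV; apply: (@le_trans _ _ (\sum_(i < d) U ^+ 2)).
    apply: ler_sum => i _; rewrite -[leLHS]real_normK ?num_real//.
    by rewrite lerXn2r ?nnegrE ?velU// (le_trans _ (velU i)).
  by rewrite sumr_const card_ord mulr_natl.
have h2 : enorm u ^+ 2 <= V ^+ 2.
  by rewrite lerXn2r ?nnegrE ?enorm_ge0// (le_trans _ uV) ?enorm_ge0.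
have h3 : enorm (a - u) ^+ 2 <= 2 * enorm a ^+ 2 + 2 * enorm u ^+ 2.
  rewrite enorm_sqrB !enorm_sqr_rV !mulr_sumr -big_split/= ler_sum// => i _.
  have := sqr_ge0 (a 0 i + u 0 i); lra.
rewrite -(@ler_pXn2r _ 2) ?nnegrE ?enorm_ge0//; last by rewrite (le_trans _ D1).
apply: (@le_trans _ _ D); first by rewrite /D; lra.
by rewrite expr2 ler_peMl// (le_trans _ D1).
Qed.

Lemma slice_entropy_ge B : has_integral mu (fun v => g v * ln (g v / M v)) B ->
  density g - r <= B.
Proof.
have th0 : 0 < th by exact: lt_le_trans thlo_le.
move=> hB; apply: (has_integral_le (has_integralB (density_has_integral mg g0 gm)
  (has_integral_maxwellian u (ltW r0) th0)) hB) => v.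
have := g0 v; rewrite le_eqVlt => /predU1P[<-|gv0].
  by rewrite mul0r sub0r oppr_le0 ltW// maxwellian_gt0.
by rewrite mul_ln_ge// maxwellian_gt0.
Qed.

Lemma slice_dissipation e A B : 0 < e ->
  has_integral mu (fun v => - (g v * transport_poly u th G b v)
    - e^-1 * ((g v - local_maxwellian g v) * ln (g v / M v))) A ->
  has_integral mu (fun v => g v * ln (g v / M v)) B ->
  {ae mu, forall v, g v = 0 -> local_maxwellian g v = 0} ->
  A <= dissipation_coeff thlo thhi shi D L1 L2 * (B - density g + r)
       + e * remainder_coeff thlo shi V D L1 L2 * m.
Proof.
move=> e0 hA hB gMg; have /andP[slo_le shi_ge] := temp.
have s0 : 0 < temperature g by exact: lt_le_trans slo_le.
have [n0|n0] := ltP 0 (density g).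
  apply: (local_dissipation d0 n0 r0 s0 mg g0 gm (density_has_integral mg g0 gm)
    (fun i => velocity_has_integral mg g0 gm i n0)
    (temperature_has_integral mg g0 gm d0 n0) thlo0 thlo_le thhi_ge shi_ge uV velD
    GL1 bL2 e0 hA hB).
  (* With positive density the local Maxwellian vanishes nowhere, so [gMg] yields [g > 0] almost
     everywhere. *)
  apply: filterS gMg => v; have := g0 v; rewrite le_eqVlt => /predU1P[<-|//] /(_ erefl).
  by move/eqP; rewrite gt_eqF// maxwellian_gt0.
(* Vacuum: [g] is zero almost everywhere and its Maxwellian everywhere, so [A] and [B] are zero
   while the right side is nonnegative. *)
have {}n0 : density g = 0 by apply/eqP; rewrite eq_le n0 (density_ge0 mg g0 gm).
have gae := density0_ae mg g0 gm n0.
have zero (f : Rd -> R) c : has_integral mu f c -> {ae mu, forall v, g v = 0 -> f v = 0} -> c = 0.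
  move=> hf f0; apply: (has_integral_unique hf).
  apply: ae_eq_has_integral (has_integral0 mu); first exact: has_integral_measurable hf.
  by apply: filterS2 gae f0 => v gv /(_ gv).
have Mg0 v : local_maxwellian g v = 0.
  by rewrite /local_maxwellian n0 maxwellianZ mul0r.
rewrite (zero _ _ hA); last by apply: aeW => v ->; rewrite Mg0; ring.
rewrite (zero _ _ hB); last by apply: aeW => v ->; rewrite mul0r.
have m0 : 0 <= m.
  apply: (has_integral_le (has_integral0 mu) gm) => v.
  by rewrite mulr_ge0// addr_ge0// exprn_ge0// enorm_ge0.
have V0 : 0 <= V by apply: le_trans uV; exact: enorm_ge0.
have L10 : 0 <= L1 by apply: le_trans GL1; exact: enorm_ge0.
have L20 : 0 <= L2 by apply: le_trans bL2; exact: enorm_ge0.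
have D0 : 0 <= D by apply: le_trans velD; exact: enorm_ge0.
have shi0 : 0 <= shi by rewrite (le_trans (ltW s0)).
have thhi0 : 0 <= thhi by rewrite (le_trans _ thhi_ge)// (le_trans _ thlo_le)// ltW.
rewrite n0 subrr add0r addr_ge0//.
  by apply: mulr_ge0; [apply: dissipation_coeff_ge0; rewrite // ltW|exact: ltW].
apply: mulr_ge0 => //; apply: mulr_ge0; first exact: ltW.
exact: remainder_coeff_ge0.
Qed.

End slice.

(** * Integrands with infinite logarithms *)

Section ereal_integrands.
Context d (T : measurableType d) (R : realType).
Variable mu : {measure set T -> \bar R}.

(** The integral is the difference of those of the positive and negative parts, and a difference of
    two nonnegative extended reals is finite only if both are. *)
Lemma fin_num_has_integral (h : T -> R) : measurable_fun setT h ->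
  (\int[mu]_x (h x)%:E)%E \is a fin_num ->
  has_integral mu h (fine (\int[mu]_x (h x)%:E)).
Proof.
move=> mh hfin; apply: integrable_has_integral.
have mEh : measurable_fun setT (EFin \o h) by exact/measurable_EFinP.
have p0 : (0 <= \int[mu]_x (EFin \o h)^\+ x)%E by exact: integral_ge0.
have n0 : (0 <= \int[mu]_x (EFin \o h)^\- x)%E by exact: integral_ge0.
move: hfin; rewrite integralE => hfin.
have pfin : (\int[mu]_x (EFin \o h)^\+ x < +oo)%E.
  rewrite ltey; apply/eqP => p; move: hfin; rewrite [X in (X - _)%E]p.
  by case: (\int[mu]_x _)%E n0 => [r||].
have nfin : (\int[mu]_x (EFin \o h)^\- x < +oo)%E.
  rewrite ltey; apply/eqP => p; move: hfin; rewrite [X in (_ - X)%E]p.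
  by case: (\int[mu]_x _)%E p0 => [r||].
apply/integrableP; split => //.
under eq_integral do rewrite -/((abse \o (EFin \o h)) _) fune_abse.
rewrite ge0_integralD//; first by rewrite lte_add_pinfty.
  exact: measurable_funepos.
exact: measurable_funeneg.
Qed.

Lemma ereal_has_integral (E : T -> \bar R) (h : T -> R) :
  mu.-integrable setT E -> measurable_fun setT h ->
  {ae mu, forall x, E x = (h x)%:E} -> has_integral mu h (fine (\int[mu]_x E x)).
Proof.
move=> intE mh Eh; have mEh : measurable_fun setT (EFin \o h) by exact/measurable_EFinP.
have mE := measurable_int mu intE.
have Eint : (\int[mu]_x E x = \int[mu]_x (h x)%:E)%E.
  by apply: ae_eq_integral => //; apply: filterS Eh => x /= -> _.
rewrite Eint; apply: fin_num_has_integral => //.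
by rewrite -Eint integrable_fin_num.
Qed.

Lemma integrable_ae_fin (E : T -> \bar R) : mu.-integrable setT E ->
  {ae mu, forall x, E x \is a fin_num}.
Proof. by move=> /(integrable_ae measurableT); apply: filterS => x; apply. Qed.

End ereal_integrands.

Section log_ratio.
Context {R : realType}.
Implicit Types a b c : R.

Lemma mul_elog_ratio a b : 0 <= a -> 0 < b ->
  (a%:E * elog_ratio a b)%E = (a * ln (a / b))%:E.
Proof.
rewrite le_eqVlt => /predU1P[<-|a0] b0; first by rewrite !mul0e mul0r.
by rewrite elog_ratioE// -EFinM.
Qed.

(** At [a = 0] the logarithm is -oo, and its product with [c] is finite only for [c = 0]. This is
    how integrability carries information about the zeros of [f]. *)
Lemma mul_elog_ratio_fin c a b : 0 <= a -> 0 < b ->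
  (c%:E * elog_ratio a b)%E \is a fin_num ->
  (c%:E * elog_ratio a b)%E = (c * ln (a / b))%:E /\ (a = 0 -> c = 0).
Proof.
rewrite le_eqVlt => /predU1P[<-|a0] b0; last first.
  by move=> _; rewrite elog_ratioE// -EFinM; split=> // a00; rewrite a00 ltxx in a0.
rewrite elog_ratio0l//; have [c0|c0|->] := ltgtP c 0.
- by rewrite lt0_muleNy// lte_fin.
- by rewrite gt0_muleNy// lte_fin.
- by rewrite mul0e mul0r.
Qed.

End log_ratio.

(** * Measurability and time derivative of the terms of the entropy identity *)

Section global_estimate.
Context {R : realType} {d : nat}.
Local Notation Rd := 'rV[R]_d.
Local Notation mu := (@rV_lebesgue R d).
Local Notation phase := (@phase_measure R d).
Local Notation e_ i := (delta_mx 0 i : Rd).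

Lemma smooth_measurable_fst (T : R) (F : R -> Rd -> R) t :
  smooth T F -> 0 <= t < T -> measurable_fun setT (fun z : Rd * Rd => F t z.1).
Proof.
move=> sF tT; apply: continuous_measurable_rV2 => z.
have cF : continuous (F t) by exact: (continuous_at_time (smooth_continuous sF) tT).
apply: (@continuous_comp _ _ _ fst (F t) z); first exact: cvg_fst.
exact: cF.
Qed.

Lemma smooth_measurable_rV (T : R) (F : R -> Rd -> R) t :
  smooth T F -> 0 <= t < T -> measurable_fun setT (F t).
Proof.
move=> sF tT.
exact: (measurableT_comp (smooth_measurable_fst sF tT) (pair2_measurable (0 : Rd))).
Qed.

Lemma derive_fst (F : Rd -> Rd -> R) x v i :
  derivable (fun z : Rd * Rd => F z.1 z.2) (x, v) (e_ i, 0) ->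
  'D_(e_ i) (F ^~ v) x = 'D_(e_ i, 0) (fun z : Rd * Rd => F z.1 z.2) (x, v).
Proof.
move=> dF; apply: slope_derive.
apply: (has_slope_eq _ (derivable_slope dF)) => h /=.
by rewrite scaler0 add0r.
Qed.

Section kinetic.
Variables (T : R) (f : R -> Rd -> Rd -> R).
Hypothesis sf : smooth T (fun t (z : Rd * Rd) => f t z.1 z.2).
Variables (t : R) (tT : 0 <= t < T).

Lemma measurable_dtf :
  measurable_fun setT (fun z : Rd * Rd => dt T (fun s => f s z.1 z.2) t).
Proof. exact: (smooth_measurable (smooth_dt sf) tT). Qed.

Lemma measurable_vgradf : measurable_fun setT
  (fun z : Rd * Rd => dotp z.2 (grad (fun y => f t y z.2) z.1)).
Proof.
apply: measurable_sum => i; apply: measurable_funM.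
  exact: (measurableT_comp (measurable_rV_coord i) measurable_snd).
apply: eq_measurable_fun (smooth_measurable (smooth_D sf (e_ i, 0)) tT).
move=> [x v] _ /=; rewrite mxE derive_fst//.
exact: (smooth_derivable sf).
Qed.

End kinetic.

Section maxwellian_measurability.
Variables (T : R) (rho theta : R -> Rd -> R) (u : R -> Rd -> Rd).
Hypotheses (srho : smooth T rho) (su : forall i, smooth T (fun t x => u t x 0 i)).
Hypotheses (sth : smooth T theta).
Hypothesis rho0 : forall t x, 0 <= t < T -> 0 < rho t x.
Hypothesis th0 : forall t x, 0 <= t < T -> 0 < theta t x.
Variables (t : R) (tT : 0 <= t < T).
Let M := maxwellian_field rho u theta.

Lemma maxwellian_field_gt0 x v : 0 < M t x v.
Proof. by rewrite maxwellian_gt0 ?rho0 ?th0. Qed.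

Lemma measurable_lnM : measurable_fun setT (fun z : Rd * Rd => ln (M t z.1 z.2)).
Proof.
(* Division by the positive [theta] is written as a product with [expR (- ln theta)], a composition
   of measurable functions. *)
rewrite (_ : (fun z => _) = fun z : Rd * Rd => ln (rho t z.1)
    - d%:R / 2 * (ln (2 * pi) + ln (theta t z.1))
    - (\sum_i (z.2 0 i - u t z.1 0 i) ^+ 2) * (2^-1 * expR (- ln (theta t z.1)))).
  have mth : measurable_fun setT (fun z : Rd * Rd => ln (theta t z.1)).
    by apply: measurableT_comp; [exact: measurable_ln|exact: smooth_measurable_fst sth tT].
  apply: measurable_funB; first apply: measurable_funB.
  - by apply: measurableT_comp; [exact: measurable_ln|exact: smooth_measurable_fst srho tT].
  - by apply: measurable_funM => //; exact: measurable_funD.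
  - apply: measurable_funM.
      apply: measurable_sum => i; apply: measurable_funX; apply: measurable_funB.
        exact: (measurableT_comp (measurable_rV_coord i) measurable_snd).
      exact: (smooth_measurable_fst (su i) tT).
    apply: measurable_funM => //; apply: measurableT_comp; first exact: measurable_expR.
    exact: measurable_funN.
apply/funext => z; rewrite /M /maxwellian_field ln_maxwellian ?rho0 ?th0//.
by rewrite expRN lnK ?posrE ?th0// invfM.
Qed.

Lemma measurable_ln_ratio (h : Rd * Rd -> R) : measurable_fun setT h ->
  measurable_fun setT (fun z => ln (h z / M t z.1 z.2)).
Proof.
move=> mh; apply: measurableT_comp; first exact: measurable_ln.
rewrite (_ : (fun z => _) = fun z => h z * expR (- ln (M t z.1 z.2))).
  apply: measurable_funM => //; apply: measurableT_comp; first exact: measurable_expR.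
  by apply: measurable_funN; exact: measurable_lnM.
by apply/funext => z; rewrite expRN lnK ?posrE ?maxwellian_field_gt0.
Qed.

Lemma is_dt_ln_ratio (f : R -> R) x v l : 0 < f t -> is_dt T f t l ->
  f t * dt T (fun s => ln (f s / M s x v)) t =
  f t * dt T (fun s => ln (f s)) t - f t * dt T (fun s => ln (M s x v)) t.
Proof.
move=> f0 fl; have FF := time_filter_proper tT.
have Fa := time_filter_dnbhs T t.
have lnf : is_dt T (fun s => ln (f s)) t (l / f t).
  exact: (has_slope_ln Fa f0 fl).
pose proof (@is_dt_lnM _ _ _ _ _ _ srho su sth rho0 th0 t x tT v) as lnM.
rewrite (is_dtE tT lnf) (is_dtE tT lnM) -mulrBr; congr (_ * _).
apply: (is_dtE tT).
apply: (has_slope_near _ _ (has_slopeB Fa lnf lnM)); last first.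
  by rewrite ln_div ?posrE// maxwellian_field_gt0.
have fpos : \forall s \near within `[0, T[%classic t^', 0 < f s.
  exact: (cvgr_gt _ (slope_cont Fa fl) _ f0).
apply: filterS2 fpos (time_filter_near T t) => s fs sT.
by rewrite ln_div ?posrE// maxwellian_gt0 ?rho0 ?th0.
Qed.

End maxwellian_measurability.

End global_estimate.

(** * Entropy identity and entropy inequality at a fixed time *)

Section entropy_inequality.
Context {R : realType} {d : nat}.
Local Notation Rd := 'rV[R]_d.
Local Notation mu := (@rV_lebesgue R d).
Local Notation phase := (@phase_measure R d).
Variables (T : R) (rho theta : R -> Rd -> R) (u : R -> Rd -> Rd) (thlo thhi : R).
Variables (eps : R) (f : R -> Rd -> Rd -> R) (U Tlo Thi A : R).
Hypotheses (d0 : (0 < d)%N) (srho : smooth T rho).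
Hypotheses (su : forall i, smooth T (fun t x => u t x 0 i)) (sth : smooth T theta).
Hypothesis euler : euler_system T rho u theta.
Hypothesis rho1 : forall t, 0 <= t < T -> (\int[mu]_x (rho t x)%:E = 1)%E.
Hypothesis rho0 : forall t x, 0 <= t < T -> 0 < rho t x.
Hypothesis thlo0 : 0 < thlo.
Hypothesis thb : forall t x, 0 <= t < T -> thlo <= theta t x <= thhi.
Hypothesis Lu : (Linfty T u < +oo)%E.
Hypothesis LG : (Linfty T (fun t x => gradv (u t) x) < +oo)%E.
Hypothesis Lb : (Linfty T (fun t x => grad (fun y => ln (theta t y)) x) < +oo)%E.
Hypothesis eps0 : 0 < eps.
Hypothesis sf : smooth T (fun t (z : Rd * Rd) => f t z.1 z.2).
Hypothesis f0 : forall t x v, 0 <= t < T -> 0 <= f t x v.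
Hypothesis bgk : bgk_equation T eps f.
Hypothesis f1 : forall t, 0 <= t < T -> (\int[phase]_z (f t z.1 z.2)%:E = 1)%E.
Hypotheses (U0 : 0 < U) (Tlo0 : 0 < Tlo).
Hypothesis LU : (Linfty T (fun t x => velocity (f t x)) <= U%:E)%E.
Hypothesis temp : forall t x, 0 <= t < T -> Tlo <= temperature (f t x) <= Thi.
Hypothesis fA : forall t, 0 <= t < T ->
  (\int[phase]_z (enorm z.2 ^+ 6 * f t z.1 z.2)%:E <= A%:E)%E.
Let M := maxwellian_field rho u theta.
Variable t : R.
Hypotheses (tT : 0 <= t < T) (reg : regular_at T f M t).

Let th0 s x : 0 <= s < T -> 0 < theta s x.
Proof. by move=> sT; have /andP[+ _] := thb x sT; exact: lt_le_trans. Qed.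

Let M0 x v : 0 < M t x v. Proof. exact: (maxwellian_field_gt0 u rho0 th0 tT). Qed.

Let L0 := fine (Linfty T u).
Let L1 := fine (Linfty T (fun t x => gradv (u t) x)).
Let L2 := fine (Linfty T (fun t x => grad (fun y => ln (theta t y)) x)).
Let Q z : R := transport_poly (u t z.1) (theta t z.1) (gradv (u t) z.1)
  (grad (fun y => ln (theta t y)) z.1) z.2.
Let H := rel_entropy (f t) (M t).
Let lnfM (z : Rd * Rd) := ln (f t z.1 z.2 / M t z.1 z.2).

Let mf : measurable_fun setT (fun z : Rd * Rd => f t z.1 z.2).
Proof. exact: (smooth_measurable sf tT). Qed.

Let mlnfM : measurable_fun setT lnfM.
Proof. exact: (measurable_ln_ratio srho su sth rho0 th0 tT). Qed.

Lemma entropy_has_integral : has_integral phase (fun z => f t z.1 z.2 * lnfM z) (fine H).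
Proof.
have HE : H = (\int[phase]_z (f t z.1 z.2 * lnfM z)%:E)%E.
  by apply: eq_integral => z _; rewrite mul_elog_ratio ?f0// M0.
rewrite HE; apply: fin_num_has_integral; first exact: measurable_funM mf mlnfM.
by rewrite -HE; exact: (rel_entropy_fM reg).
Qed.

Let I3 := fine (\int[phase]_z f_dt_logM T f M t z)%E.
Let I4 := fine (\int[phase]_z f_v_grad_logM f M t z)%E.
Let J1 := fine (\int[phase]_z dtf_log_fM T f M t z)%E.

Let transport_integral : has_integral phase (fun z => f t z.1 z.2 * Q z) (I3 + I4).
Proof.
have h3 : has_integral phase (fun z => fine (f_dt_logM T f M t z)) I3.
  exact: (integrable_has_integral (integrable_f_dt_logM reg)).
have h4 : has_integral phase (fun z => fine (f_v_grad_logM f M t z)) I4.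
  exact: (integrable_has_integral (integrable_f_v_grad_logM reg)).
apply: has_integral_eq (has_integralD h3 h4) => z /=.
by rewrite -mulrDr (transport_lnM srho su sth rho0 th0).
Qed.

(** The mass stays equal to 1, so [f d_t log f] integrates to 0 and only the contribution of [M]
    remains. *)
Let dt_log_integral :
  fine (\int[phase]_z f_dt_log_fM T f M t z)%E = - I3.
Proof.
have h1 : has_integral phase (fun z => fine (f_dt_log_fM T f M t z))
    (fine (\int[phase]_z f_dt_log_fM T f M t z)%E).
  exact: (integrable_has_integral (integrable_f_dt_log_fM reg)).
have h2 : has_integral phase (fun z => fine (f_dt_logf T f t z))
    (fine (\int[phase]_z f_dt_logf T f t z)%E).
  exact: (integrable_has_integral (integrable_f_dt_logf reg)).
have h3 : has_integral phase (fun z => fine (f_dt_logM T f M t z)) I3.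
  exact: (integrable_has_integral (integrable_f_dt_logM reg)).
have mass0 : fine (\int[phase]_z f_dt_logf T f t z)%E = 0.
  rewrite (dt_mass reg); apply: (is_dtE tT).
  have FF := time_filter_proper tT.
  apply: (has_slope_near _ _ (has_slope_cst (1 : R))); last by rewrite f1.
  by apply: filterS (time_filter_near T t) => s sT; rewrite f1.
rewrite mass0 in h2; rewrite -[RHS]add0r; apply: has_integral_unique h1 _.
apply: has_integral_eq (has_integralB h2 h3) => z /=.
(* At zeros of [f] both sides vanish through the factor [f], whatever value the derivative of the
   logarithm takes there. *)
have := f0 z.1 z.2 tT; rewrite le_eqVlt => /predU1P[<-|fz0].
  by rewrite !mul0r subrr.
have fz := smooth_is_dt sf (x := z) tT.
have h := is_dt_ln_ratio srho su sth rho0 th0 tT (f := fun s => f s z.1 z.2) z.1 z.2 fz0.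
exact: esym (h _ fz).
Qed.

Let S (z : Rd * Rd) := (f t z.1 z.2 - local_maxwellian (f t z.1) z.2) * lnfM z.

Let dt_fin : {ae phase, forall z, dtf_log_fM T f M t z =
    (dt T (fun s => f s z.1 z.2) t * lnfM z)%:E /\
    (f t z.1 z.2 = 0 -> dt T (fun s => f s z.1 z.2) t = 0)}.
Proof.
apply: filterS (integrable_ae_fin (integrable_dtf_log_fM reg)) => z.
by apply: mul_elog_ratio_fin; [exact: f0|exact: M0].
Qed.

Let grad_fin : {ae phase, forall z, v_gradf_log_fM f M t z =
    (dotp z.2 (grad (fun y => f t y z.2) z.1) * lnfM z)%:E /\
    (f t z.1 z.2 = 0 -> dotp z.2 (grad (fun y => f t y z.2) z.1) = 0)}.
Proof.
apply: filterS (integrable_ae_fin (integrable_v_gradf_log_fM reg)) => z.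
by apply: mul_elog_ratio_fin; [exact: f0|exact: M0].
Qed.

(** Integration by parts turns [I4] into the integral of [v . grad f] against [ln (f / M)]. Added to
    [J1] it completes the transport operator, which the BGK equation replaces by the relaxation
    term. *)
Let relaxation_integral : has_integral phase (fun z => - (eps^-1 * S z)) (J1 + I4).
Proof.
have h1 : has_integral phase (fun z => dt T (fun s => f s z.1 z.2) t * lnfM z) J1.
  apply: (ereal_has_integral (integrable_dtf_log_fM reg)).
    by apply: measurable_funM => //; exact: (measurable_dtf sf tT).
  by apply: filterS dt_fin => z [].
have h4 : has_integral phase
    (fun z => dotp z.2 (grad (fun y => f t y z.2) z.1) * lnfM z) I4.
  rewrite /I4 -(integration_by_parts_x reg).
  apply: (ereal_has_integral (integrable_v_gradf_log_fM reg)).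
    by apply: measurable_funM => //; exact: (measurable_vgradf sf tT).
  by apply: filterS grad_fin => z [].
apply: has_integral_eq (has_integralD h1 h4) => z.
by rewrite -mulrDl bgk// /S; ring.
Qed.

(* Where f = 0 the logarithm is -oo, so integrability forces both terms of the
   transport operator to vanish there, and M(f) with them. *)
Let vacuum : {ae phase, forall z, f t z.1 z.2 = 0 -> local_maxwellian (f t z.1) z.2 = 0}.
Proof.
apply: filterS2 dt_fin grad_fin => z [_ h1] [_ h2] fz.
have := bgk z.1 z.2 tT; rewrite (h1 fz) (h2 fz) fz addr0 sub0r mulrN opprK.
by move/esym/eqP; rewrite mulf_eq0 invr_eq0 gt_eqF//= => /eqP.
Qed.

Lemma dt_entropyE : dt T (fun s => fine (rel_entropy (f s) (M s))) t = J1 - I3.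
Proof. by rewrite (is_dtE tT (dt_rel_entropy reg)) dt_log_integral. Qed.

Let dissipation_integral :
  has_integral phase (fun z => - (f t z.1 z.2 * Q z) - eps^-1 * S z) (J1 - I3).
Proof.
(* [I4] is added and subtracted: one copy completes the transport of [log M], the other the
   transport of [f]. *)
rewrite (_ : J1 - I3 = - (I3 + I4) + (J1 + I4)); last by ring.
exact: (has_integralD (has_integralN transport_integral) relaxation_integral).
Qed.

Let seq_u : forall i j, seq_continuous T (fun t x => u t x i j).
Proof.
move=> i j t_ s x sT t_T t_s; rewrite ord1.
exact: (continuous_seq (smooth_continuous (su j)) sT t_T t_s).
Qed.

Let seq_gradu : forall i j, seq_continuous T (fun t x => gradv (u t) x i j).
Proof.
move=> i j t_ s x sT t_T t_s; under eq_fun do rewrite mxE; rewrite mxE.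
exact: (continuous_seq (smooth_continuous (smooth_D (su j) _)) sT t_T t_s).
Qed.

Let seq_gradlnth : forall i j,
  seq_continuous T (fun t x => grad (fun y => ln (theta t y)) x i j).
Proof.
move=> i j t_ s x sT t_T t_s.
rewrite ord1 mxE (derive_ln_theta sth th0 x sT).
rewrite (_ : (fun n => _) = fun n =>
    'D_(delta_mx 0 j) (theta (t_ n)) x * (theta (t_ n) x)^-1); last first.
  by apply/funext => n; rewrite mxE (derive_ln_theta sth th0 x (t_T n)).
apply: cvgM.
  exact: (continuous_seq (smooth_continuous (smooth_D sth _)) sT t_T t_s).
apply: cvgV; first by rewrite gt_eqF ?th0.
exact: (continuous_seq (smooth_continuous sth) sT t_T t_s).
Qed.

Let D := 1 + 2 * (d%:R * U ^+ 2) + 2 * L0 ^+ 2.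
Let K1 := @dissipation_coeff R d thlo thhi Thi D L1 L2.
Let K4 := @remainder_coeff R d thlo Thi L0 D L1 L2.

Lemma entropy_inequality : 0 <= fine H /\
  dt T (fun s => fine (rel_entropy (f s) (M s))) t <=
  `|K1| * fine H + eps * (`|K4| * (1 + A)).
Proof.
have [c cA h6] := phase_sixth sf f0 fA tT.
have [m hm aem] := has_integral_fubini (has_integralD (phase_mass sf f0 f1 tT) h6).
have [n hn aen] := has_integral_fubini (phase_mass sf f0 f1 tT).
have [B hB aeB] := has_integral_fubini entropy_has_integral.
have [D' hD aeD] := has_integral_fubini dissipation_integral.
have hrho : has_integral mu (rho t) 1.
  apply: ge0_has_integral; [exact: (smooth_measurable_rV srho tT)| |exact: rho1].
  by move=> x; rewrite ltW ?rho0.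
have aevac := ae_prod_section (P := fun x v =>
  f t x v = 0 -> local_maxwellian (f t x) v = 0) vacuum.
have aev := velocity_coord_le sf f0 f1 fA U0 LU tT.
have aeu := Linfty_bound tT seq_u Lu.
have aeG := Linfty_bound tT seq_gradu LG.
have aeb := Linfty_bound tT seq_gradlnth Lb.
have slice : {ae mu, forall x, n x - rho t x <= B x /\
    D' x <= `|K1| * (B x - n x + rho t x) + eps * `|K4| * m x}.
  pose proof (filterI (filterI aem aen) (filterI aeB aeD)) as ae1.
  pose proof (filterI (filterI aevac aev) (filterI aeu (filterI aeG aeb))) as ae2.
  apply: filterS2 ae1 ae2 => x [[mx nx] [Bx Dx]] [[vacx vx] [ux [Gx bx]]].
  have mg := measurable_slice sf x tT.
  have g0 v : 0 <= f t x v by exact: f0.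
  have {}mx : has_integral mu (fun v => (1 + enorm v ^+ 6) * f t x v) (m x).
    by apply: has_integral_eq mx => v /=; ring.
  have nE : n x = density (f t x).
    exact: has_integral_unique nx (density_has_integral mg g0 mx).
  have /andP[tl th] := thb x tT.
  have {}Bx : has_integral mu (fun v => f t x v *
      ln (f t x v / maxwellian (rho t x) (u t x) (theta t x) v)) (B x).
    by apply: has_integral_eq Bx.
  have {}Dx : has_integral mu (fun v => - (f t x v * transport_poly (u t x)
      (theta t x) (gradv (u t) x) (grad (fun y => ln (theta t y)) x) v)
    - eps^-1 * ((f t x v - local_maxwellian (f t x) v) *
      ln (f t x v / maxwellian (rho t x) (u t x) (theta t x) v))) (D' x).
    by apply: has_integral_eq Dx.
  have e1 := slice_entropy_ge (rho0 x tT) mg g0 mx thlo0 tl Bx.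
  have e2 := slice_dissipation d0 (rho0 x tT) mg g0 mx thlo0 tl th Tlo0 (temp x tT)
    ux vx Gx bx eps0 Dx Bx vacx.
  have m0 : 0 <= m x.
    apply: (has_integral_le (has_integral0 mu) mx) => v.
    by rewrite mulr_ge0// addr_ge0// exprn_ge0// enorm_ge0.
  rewrite nE; split=> //; apply: (le_trans e2); apply: lerD.
    by apply: ler_wpM2r; [lra|exact: ler_norm].
  by apply: ler_wpM2r => //; rewrite ler_wpM2l ?(ltW eps0)// ler_norm.
have Hrhs := has_integralD (has_integralZ `|K1|
    (has_integralD (has_integralB hB hn) hrho)) (has_integralZ (eps * `|K4|) hm).
have H0 : 0 <= fine H.
  (* The lower bound [n - rho] of the slice entropy integrates to [1 - 1 = 0]. *)
  have := ae_has_integral_le (has_integralB hn hrho) hB _.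
  by rewrite subrr; apply; apply: filterS slice => x [].
split=> //; rewrite dt_entropyE.
have := ae_has_integral_le hD Hrhs _.
move=> /(_ _)/le_trans; apply; first by apply: filterS slice => x [].
(* The masses of [f] and [rho] cancel, leaving [fine H]; [m] integrates to [1 + c], and [c <= A]. *)
by rewrite subrK lerD2l -mulrA ler_wpM2l ?(ltW eps0)// ler_wpM2l// lerD2l.
Qed.

End entropy_inequality.

(** * Gronwall's lemma for derivatives relative to [0, T[ *)

Section gronwall.
Context {R : realType}.

Lemma time_slope_dnbhs (T x : R) (g : R -> R) l : 0 < x < T ->
  has_slope (within `[0, T[%classic x^') x g l -> has_slope x^' x g l.
Proof.
move=> /andP[x0 xT] gl A nA.
have gA : \forall s \near x^', s \in `[0, T[ -> A ((g s - g x) / (s - x)).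
  have := gl A nA; rewrite nbhs_filterE; exact.
have inT : \forall s \near x^', s \in `[0, T[.
  apply: nbhs_dnbhs; have xin : x \in `]0, T[ by rewrite in_itv/= x0.
  apply: filterS (near_in_itvoo xin) => s.
  by rewrite !in_itv/= => /andP[s0 sT]; rewrite ltW.
have : \forall s \near x^', A ((g s - g x) / (s - x)).
  by apply: filterS2 gA inT => s + sT; exact.
by rewrite nbhs_filterE.
Qed.

Lemma slope_derivable1 (g : R -> R) (x l : R) : has_slope x^' x g l ->
  derivable g x 1 /\ derive1 g x = l.
Proof.
move=> gl; have shiftx : h + x @[h --> (0 : R)^'] --> x^'.
  move=> A [e /= e0 eA]; exists e => //= h he h0; apply: eA.
    by rewrite /ball/= opprD addrCA subrr addr0 in he *; rewrite sub0r in he.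
  by rewrite -subr_eq0 addrK.
have c0 : h^-1 *: ((g \o shift x) (h *: 1) - g x) @[h --> (0 : R)^'] --> l.
  pose proof (cvg_comp _ _ shiftx gl) as c0; apply: (cvg_near c0); near=> h.
  by rewrite /= addrK /GRing.scale/= mulr1 mulrC.
split; first by apply/cvg_ex; exists l.
by rewrite derive1E; exact: cvg_lim c0.
Unshelve. all: by end_near. Qed.

(** The function [(h + e) exp (- C s)] has nonpositive derivative. Monotonicity uses the derivative
    only in the open interval, where it is two-sided, and continuity up to 0, which the one-sided
    slope provides. *)
Lemma gronwall (T C e : R) (h l : R -> R) : 0 <= C ->
  (forall t, 0 <= t < T -> is_dt T h t (l t) /\ l t <= C * (h t + e)) ->
  forall t, 0 <= t < T -> h t + e <= (h 0 + e) * expR (C * t).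
Proof.
move=> C0 hl t /andP[t0 tT].
pose phi s := (h s + e) * expR (- (C * s)).
have slope s : 0 <= s < T -> has_slope (within `[0, T[%classic s^') s phi
    ((l s - C * (h s + e)) * expR (- (C * s))).
  move=> sT; have FF := time_filter_proper sT; have Fs := time_filter_dnbhs T s.
  have [hs _] := hl s sT.
  have ids : has_slope (within `[0, T[%classic s^') s id 1.
    have c1 : (fun=> 1 : R) @ within `[0, T[%classic s^' --> (1 : R) by exact: cvg_cst.
    apply: (cvg_near c1).
    apply: filterS (slope_near_neq Fs) => r rs; by rewrite divff ?subr_eq0.
  pose proof (has_slope_comp Fs (phi := expR) (g := fun s => - (C * s))
    (is_derive_expR _) (has_slopeN Fs (has_slopeZ Fs C ids))) as es.
  pose proof (has_slopeM Fs (has_slopeD hs (has_slope_cst e)) es) as p.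
  move: p; rewrite (_ : _ + _ = (l s - C * (h s + e)) * expR (- (C * s))) //.
  by rewrite /=; ring.
have le_phi : phi t <= phi 0.
  have [->//|tn0] := eqVneq t 0.
  have lt0t : 0 < t by rewrite lt_neqAle eq_sym tn0.
  have der s : s \in `]0, t[ -> derivable phi s 1 /\
      derive1 phi s = (l s - C * (h s + e)) * expR (- (C * s)).
    rewrite in_itv/= => /andP[s0 st]; apply: slope_derivable1.
    apply: (@time_slope_dnbhs T); first by rewrite s0 (lt_trans st).
    by apply: slope; rewrite ltW//= (lt_trans st).
  apply: (@ler0_derive1_nincr _ _ 0 t) => //.
  - by move=> s /der[].
  - move=> s /[dup] st /der[_ ->]; rewrite mulr_le0_ge0 ?expR_ge0// subr_le0.
    move: st; rewrite in_itv/= => /andP[s0 st].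
    by apply: (hl s _).2; rewrite ltW//= (lt_trans st).
  - apply/subspace_continuousP => s; rewrite /= in_itv/= => /andP[s0 st].
    have sT : 0 <= s < T by rewrite s0 (le_lt_trans st).
    have FF := time_filter_proper sT; have Fs := time_filter_dnbhs T s.
    have c : phi @ within `[0, T[%classic s^' --> phi s.
      exact: (slope_cont Fs (slope s sT)).
    move=> A nA.
    (* The limit is along punctured neighbourhoods inside [[0, T[]; the point [r = s] is added
       separately to get continuity on [[0, t]]. *)
    have cA : \forall r \near s, r != s -> r \in `[0, T[ -> A (phi r).
      exact: (c A nA).
    have : \forall r \near s, r \in `[0, t] -> A (phi r).
      apply: filterS cA => r cA; rewrite in_itv/= => /andP[r0 rt].
      have [->|rs] := eqVneq r s; first exact: nbhs_singleton nA.
      by apply: cA => //; rewrite in_itv/= r0 (le_lt_trans rt).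
    exact.
move: le_phi; rewrite /phi mulr0 oppr0 expR0 mulr1 => le_phi.
by rewrite -ler_pdivrMr ?expR_gt0// -expRN.
Qed.

End gronwall.
Theorem theorem2p1 (R : realType) (d : nat) (d_gt0 : (0 < d)%N) :
  exists2 C : R -> R -> R -> R -> R -> R -> R -> R -> R -> R,
    (forall a1 a2 a3 a4 a5 a6 a7 a8 a9, 0 < C a1 a2 a3 a4 a5 a6 a7 a8 a9) &
  forall (T : R) (rho theta : R -> 'rV[R]_d -> R)
    (u : R -> 'rV[R]_d -> 'rV[R]_d) (theta_lo theta_hi : R)
    (f0 : R -> 'rV[R]_d -> 'rV[R]_d -> R)
    (f : R -> R -> 'rV[R]_d -> 'rV[R]_d -> R)
    (U Theta_lo Theta_hi A : R),
  let M := maxwellian_field rho u theta in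
  let gradu t x := gradv (u t) x in
  let gradlogtheta t x := grad (fun y => ln (theta t y)) x in
  let u_ e t x := velocity (f e t x) in
  let theta_ e t x := temperature (f e t x) in
  let H e t := rel_entropy (f e t) (M t) in
  0 < T ->
  (* Euler solution *)
  smooth T rho -> (forall i, smooth T (fun t x => u t x 0 i)) ->
  smooth T theta ->
  euler_system T rho u theta ->
  (* bounds on the Euler solution *)
  (forall t, 0 <= t < T -> (\int[rV_lebesgue d]_x (rho t x)%:E = 1)%E) ->
  (forall t x, 0 <= t < T -> 0 < rho t x) ->
  0 < theta_lo ->
  (forall t x, 0 <= t < T -> theta_lo <= theta t x <= theta_hi) ->
  (Linfty T u < +oo)%E -> (Linfty T gradu < +oo)%E ->
  (Linfty T gradlogtheta < +oo)%E ->
  (* BGK solutions *)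
  (forall e x v, 0 < e <= 1 -> 0 <= f0 e x v) ->
  (forall e, 0 < e <= 1 -> (\int[phase_measure]_z (f0 e z.1 z.2)%:E = 1)%E) ->
  (forall e, 0 < e <= 1 -> smooth T (fun t z => f e t z.1 z.2)) ->
  (forall e t x v, 0 < e <= 1 -> 0 <= t < T -> 0 <= f e t x v) ->
  (forall e, 0 < e <= 1 -> bgk_equation T e (f e)) ->
  (forall e x v, 0 < e <= 1 -> f e 0 x v = f0 e x v) ->
  (* bounds on the BGK solutions *)
  (forall e t, 0 < e <= 1 -> 0 <= t < T ->
    (\int[phase_measure]_z (f e t z.1 z.2)%:E = 1)%E) ->
  0 < U -> 0 < Theta_lo -> Theta_lo <= Theta_hi -> 0 < A ->
  (forall e, 0 < e <= 1 -> (Linfty T (u_ e) <= U%:E)%E) ->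
  (forall e t x, 0 < e <= 1 -> 0 <= t < T ->
    Theta_lo <= theta_ e t x <= Theta_hi) ->
  (forall e t, 0 < e <= 1 -> 0 <= t < T ->
    (\int[phase_measure]_z (enorm z.2 ^+ 6 * f e t z.1 z.2)%:E <= A%:E)%E) ->
  (* regularity, decay and finite entropies *)
  (forall e t, 0 < e <= 1 -> 0 <= t < T -> regular_at T (f e) M t) ->
  (forall e t, 0 < e <= 1 -> 0 <= t < T ->
    dt T (fun s => fine (H e s)) t <=
      C theta_lo theta_hi U Theta_lo Theta_hi A (fine (Linfty T u))
        (fine (Linfty T gradu)) (fine (Linfty T gradlogtheta))
      * (fine (H e t) + e)) /\
  (rel_entropy (f0 e) (M 0) @[e --> 0^'+] --> 0%E ->
   ereal_sup [set H e t | t in `[0, T[] @[e --> 0^'+] --> 0%E).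
Proof.
have Kgt0 (a b c : R) : 0 < `|a| + `|b| * (1 + `|c|) + 1.
  by rewrite ltr_pwDr// addr_ge0// mulr_ge0// addr_ge0.
pose D U Lu : R := 1 + 2 * (d%:R * U ^+ 2) + 2 * Lu ^+ 2.
(* Positivity is required for all real arguments, hence the absolute values and the final 1. [1 + A]
   bounds the integral of [1 + |v|^6] against [f]. *)
exists (fun thlo thhi U _ Thi A Lu Lgu Lgth =>
  `|@dissipation_coeff R d thlo thhi Thi (D U Lu) Lgu Lgth| +
  `|@remainder_coeff R d thlo Thi Lu (D U Lu) Lgu Lgth| * (1 + `|A|) + 1).
  by move=> *; exact: Kgt0.
move=> T rho theta u theta_lo theta_hi f0 f U Theta_lo Theta_hi A M gradu
  gradlogtheta u_ theta_ H T0 srho su sth euler rho1 rho0 thlo0 thb Lu LG Lb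
  f0_ge0 f0_mass sf f_ge0 bgk f_init f_mass U0 Tlo0 Tlohi A0 LU temp fA reg.
set K := _ + 1.
have K0 : 0 <= K by apply: ltW; exact: Kgt0.
have ineq e t : 0 < e <= 1 -> 0 <= t < T -> 0 <= fine (H e t) /\
    dt T (fun s => fine (H e s)) t <= K * (fine (H e t) + e).
  move=> e01 tT; have e0 : 0 < e by have /andP[] := e01.
  have [H0 le] := entropy_inequality d_gt0 srho su sth euler rho1 rho0 thlo0 thb
    Lu LG Lb e0 (sf e e01) (fun t x v => f_ge0 e t x v e01) (bgk e e01)
    (fun t => f_mass e t e01) U0 Tlo0 (LU e e01) (fun t x => temp e t x e01)
    (fun t => fA e t e01) tT (reg e t e01 tT).
  split; first exact: H0.
  apply: (le_trans le); rewrite /K (gtr0_norm A0).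
  set k1 := `|_|; set k4 := _ * (1 + A).
  have k1_ge0 : 0 <= k1 by exact: normr_ge0.
  have k4_ge0 : 0 <= k4 by rewrite /k4 mulr_ge0// addr_ge0// ltW.
  have {}H0 : 0 <= fine (H e t) by exact: H0.
  rewrite -/(H e t) -subr_ge0.
  move: (fine (H e t)) k1 k4 H0 k1_ge0 k4_ge0 => h k1 k4 h0 k10 k40.
  have -> : (k1 + k4 + 1) * (h + e) - (k1 * h + e * k4) =
    (k4 + 1) * h + (k1 + 1) * e by ring.
  by rewrite addr_ge0// mulr_ge0// ?addr_ge0// ltW.
split; first by move=> e t e01 tT; have [_] := ineq e t e01 tT.
move=> cv0.
have zeroT : 0 <= (0 : R) < T by rewrite lexx.
have HE e t : 0 < e <= 1 -> 0 <= t < T -> H e t = (fine (H e t))%:E.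
  by move=> e01 tT; rewrite fineK//; exact: (rel_entropy_fM (reg e t e01 tT)).
have H0E e : 0 < e <= 1 -> H e 0 = rel_entropy (f0 e) (M 0).
  move=> e01; congr rel_entropy; apply/funext => x; apply/funext => v.
  exact: f_init.
have near01 : \forall e \near (0 : R)^'+, 0 < e <= 1.
  near=> e; apply/andP; split; first by near: e; exact: nbhs_right_gt.
  by near: e; exact: nbhs_right_le.
(* Since [T] is finite, [exp (K t) <= exp (K T)], and the bound no longer depends on [t]. *)
have bound e t : 0 < e <= 1 -> 0 <= t < T ->
    fine (H e t) <= (fine (H e 0) + e) * expR (K * T).
  move=> e01 tT; have e0 : 0 <= e by have /andP[/ltW] := e01.
  have der s : 0 <= s < T -> is_dt T (fun s => fine (H e s)) s
      (dt T (fun s => fine (H e s)) s) /\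
      dt T (fun s => fine (H e s)) s <= K * (fine (H e s) + e).
    move=> sT; split; last by have [] := ineq e s e01 sT.
    have h := dt_rel_entropy (reg e s e01 sT).
    by rewrite (is_dtE sT h).
  have := gronwall K0 der tT => le.
  apply: le_trans (le_trans le _); first by rewrite lerDl.
  have [h0 _] := ineq e 0 e01 zeroT.
  apply: ler_wpM2l; first exact: addr_ge0.
  by rewrite ler_expR ler_wpM2l//; have /andP[_ /ltW] := tT.
apply: (@squeeze_cvge _ _ _ _ (cst 0%E) _
  (fun e => ((fine (rel_entropy (f0 e) (M 0)) + e) * expR (K * T))%:E)).
- apply: filterS near01 => e e01; apply/andP; split.
    apply: le_ereal_sup_tmp; exists (H e 0); last first.
      by rewrite HE// lee_fin; have [] := ineq e 0 e01 zeroT.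
    by exists 0 => //=; rewrite in_itv/=.
  apply: ge_ereal_sup => y [t tT <-]; move: tT; rewrite /= in_itv/= => tT.
  by rewrite HE// lee_fin -H0E//; exact: bound.
- exact: cvg_cst.
- apply: cvg_EFin; first by near=> e.
  rewrite -[X in _ --> X](_ : (fine 0%E + 0) * expR (K * T) = _); last first.
    by rewrite /= addr0 mul0r.
  apply: cvgMr_tmp; apply: cvgD; first exact: fine_cvg.
  exact: cvg_at_right_filter cvg_id.
Unshelve. all: by end_near. Qed.
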